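(* Let $\hat{\mathfrak g}$ be the affine Kac-Moody algebra of type $A_1^{(1)}$. Let $\zeta\in\mathrm{Hom}_{\mathrm{alg}}(\mathcal H_q'(+),\mathbb{C}(q^{1/2}))$, let $a$ be a non-zero integer and let $\lambda\in\dot P$. If $M^q_{\zeta,\lambda}$ is an irreducible $\mathcal H_q$-module, then the induced $\mathcal U_q(\hat{\mathfrak g})$-module $\widehat M^q_{\zeta,\lambda}$ is irreducible.
   Context: Here $\mathfrak g=\mathfrak{sl}_2$ with simple root $\alpha$, coroot $h=\alpha^\vee$ and weight lattice $\dot P$; $[m]=\frac{q^m-q^{-m}}{q-q^{-1}}$. $\mathcal U_q(\hat{\mathfrak g})$ (type $A_1^{(1)}$, Drinfeld realization) is the unital associative $\mathbb{C}(q^{1/2})$-algebra with generators $x^\pm_r$, $h_s$, $K^{\pm1}$, $\gamma^{\pm1/2}$, $D^{\pm1}$ ($r,s\in\mathbb{Z}$, $s\neq0$) and relations: $\gamma^{\pm1/2}$ central; $KK^{-1}=DD^{-1}=\gamma^{1/2}\gamma^{-1/2}=1$ (and in the opposite order); $[D,K]=[K,h_s]=0$; $Dh_rD^{-1}=q^rh_r$; $Dx_r^\pm D^{-1}=q^rx^\pm_r$; $Kx_r^\pm K^{-1}=q^{\pm2}x_r^\pm$; $[h_k,h_l]=\delta_{k,-l}\frac{[2k]}{k}\frac{\gamma^k-\gamma^{-k}}{q-q^{-1}}$; $[h_k,x^\pm_l]=\pm\frac{[2k]}{k}\gamma^{\mp|k|/2}x^\pm_{k+l}$; $x^\pm_{k+1}x^\pm_l-q^{\pm2}x^\pm_lx^\pm_{k+1}=q^{\pm2}x^\pm_kx^\pm_{l+1}-x^\pm_{l+1}x^\pm_k$;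 $[x_k^+,x_l^-]=\frac{1}{q-q^{-1}}\big(\gamma^{(k-l)/2}\psi_{k+l}-\gamma^{(l-k)/2}\phi_{k+l}\big)$, where $\sum_{k\ge0}\psi_kz^k=K\exp\big((q-q^{-1})\sum_{l>0}h_lz^l\big)$, $\sum_{k\ge0}\phi_{-k}z^{-k}=K^{-1}\exp\big(-(q-q^{-1})\sum_{l>0}h_{-l}z^{-l}\big)$, and $\psi_k=\phi_{-k}=0$ for $k<0$. Subalgebras: $\mathcal H'_q$ is generated by $\gamma^{\pm1/2}$ and all $h_r$ ($r\ne0$); $\mathcal H'_q(+)$ by the $h_r$ with $r>0$; $\mathcal H'_q(\mathfrak b)$ by $\mathcal H_q'(+)$ and $\gamma^{\pm1/2}$; $\mathcal H_q$ by $\mathcal H_q'$ and $D^{\pm1}$; $B_q^d$ by all $x^+_k$ ($k\in\mathbb{Z}$), $\mathcal H_q$ and $K^{\pm1}$. Modules: let $\mathbb{C}_{(\zeta,a)}(q^{1/2})v$ be the one-dimensional $\mathcal H'_q(\mathfrak b)$-module with $yv=\zeta(y)v$ for $y\in\mathcal H'_q(+)$ and $\gamma^{1/2}v=q^{a/2}v$, and let $M^q_{\zeta,a}=\mathcal H_q\otimes_{\mathcal H_q'(\mathfrak b)}\mathbb{C}_{(\zeta,a)}(q^{1/2})v$ (so $D$ acts freely). $M^q_{\zeta,\lambda}$ denotes $M^q_{\zeta,a}$ with $K^{\pm1}$ acting by the scalar $q^{\pm\lambda(h)}$; it is a $B_q^d$-module with all $x_k^+$ acting by zero, and $\widehat M^q_{\zeta,\lambda}=\mathcal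 U_q(\hat{\mathfrak g})\otimes_{B_q^d}M^q_{\zeta,\lambda}$. *)

(* Defs.v *)
From HB Require Import structures.
From mathcomp Require Import all_boot all_order all_algebra.
From mathcomp Require Import boolp reals complex finmap.
From mathcomp Require Import monalg.

Set Implicit Arguments.
Unset Strict Implicit.
Unset Printing Implicit Defensive.

Import GRing.Theory.
Local Open Scope ring_scope.
Local Open Scope quotient_scope.

(* Operations defined with [op_key] are locked so that unification does not
   unfold them; rewriting with [unlock] removes the lock. *)
Fact op_key : unit. Proof. exact: tt. Qed.

Section FreeAlgebra.
Variables (F : fieldType) (X : choiceType).
Local Notation malgX := {malg F[{fmonom X}]}.

(** Formal linear combinations of words in [X]; [monalg] only provides the
    one-sided algebra structure when the monomials do not commute. *)
Definition free_alg : Type := malgX.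
HB.instance Definition _ := Choice.on free_alg.

Definition fgen : X -> free_alg :=
  locked_with op_key (fun x => << fmu x >> : malgX).
Definition fzero : free_alg := locked_with op_key (0 : malgX).
Definition fopp : free_alg -> free_alg :=
  locked_with op_key (-%R : malgX -> malgX).
Definition fadd : free_alg -> free_alg -> free_alg :=
  locked_with op_key (+%R : malgX -> malgX -> malgX).
Definition fone : free_alg := locked_with op_key (1 : malgX).
Definition fmul : free_alg -> free_alg -> free_alg :=
  locked_with op_key ( *%R : malgX -> malgX -> malgX).
Definition fscale : F -> free_alg -> free_alg :=
  locked_with op_key ( *:%R : F -> malgX -> malgX).

Lemma fopE : (fzero = (0 : malgX)) * (fone = (1 : malgX))
  * (forall x : malgX, fopp x = - x)
  * (forall x y : malgX, fadd x y = x + y)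
  * (forall x y : malgX, fmul x y = x * y)
  * (forall k (x : malgX), fscale k x = k *: x).
Proof.
have lw T (x : T) : locked_with op_key x = x by rewrite unlock.
do ?[split=> *]; rewrite ?/fzero ?/fone ?/fopp ?/fadd ?/fmul ?/fscale lw;
  reflexivity.
Qed.

Lemma faddA : associative fadd.
Proof. by move=> x y z; rewrite !fopE; apply: (@addrA malgX). Qed.
Lemma faddC : commutative fadd.
Proof. by move=> x y; rewrite !fopE; apply: (@addrC malgX). Qed.
Lemma fadd0 : left_id fzero fadd.
Proof. by move=> x; rewrite !fopE; apply: (@add0r malgX). Qed.
Lemma faddN : left_inverse fzero fopp fadd.
Proof. by move=> x; rewrite !fopE; apply: (@addNr malgX). Qed.
HB.instance Definition _ := GRing.isZmodule.Build free_alg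
  faddA faddC fadd0 faddN.

Lemma fmulA : associative fmul.
Proof. by move=> x y z; rewrite !fopE; apply: (@mulrA malgX). Qed.
Lemma fmul1l : left_id fone fmul.
Proof. by move=> x; rewrite !fopE; apply: (@mul1r malgX). Qed.
Lemma fmul1r : right_id fone fmul.
Proof. by move=> x; rewrite !fopE; apply: (@mulr1 malgX). Qed.
Lemma fmulDl : left_distributive fmul fadd.
Proof. by move=> x y z; rewrite !fopE; apply: (@mulrDl malgX). Qed.
Lemma fmulDr : right_distributive fmul fadd.
Proof. by move=> x y z; rewrite !fopE; apply: (@mulrDr malgX). Qed.
Lemma fone_neq0 : fone != fzero.
Proof. by rewrite !fopE; apply: (oner_neq0 malgX). Qed.
HB.instance Definition _ := GRing.Zmodule_isNzRing.Build free_alg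
  fmulA fmul1l fmul1r fmulDl fmulDr fone_neq0.

Lemma fscaleA a b v : fscale a (fscale b v) = fscale (a * b) v.
Proof. by rewrite !fopE; apply: (@scalerA F malgX). Qed.
Lemma fscale1 : left_id 1 fscale.
Proof. by move=> v; rewrite !fopE; apply: (@scale1r F malgX). Qed.
Lemma fscaleDr : right_distributive fscale fadd.
Proof. by move=> k x y; rewrite !fopE; apply: (@scalerDr F malgX). Qed.
Lemma fscaleDl v a b : fscale (a + b) v = fadd (fscale a v) (fscale b v).
Proof. by rewrite !fopE; apply: (@scalerDl F malgX). Qed.
HB.instance Definition _ := GRing.Zmodule_isLmodule.Build F free_alg
  fscaleA fscale1 fscaleDr fscaleDl.

Lemma fscaleAl k x y : fscale k (fmul x y) = fmul (fscale k x) y.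
Proof. by rewrite !fopE; apply: (@scalerAl F malgX). Qed.
HB.instance Definition _ := GRing.Lmodule_isLalgebra.Build F free_alg fscaleAl.

Lemma fscaleAr k (x y : malgX) : fscale k (fmul x y) = fmul x (fscale k y).
Proof.
rewrite !fopE.
have central (g : malgX) : g * k%:MP = k *: g.
  rewrite [LHS]fgmulgU [in RHS](monalgE g) scaler_sumr.
  apply: eq_bigr => m _; rewrite mulm1.
  apply/malgP => m'; rewrite mcoeffZ 2!mcoeffU mulrnAr.
  by congr (_ *+ _); apply: mulrC.
rewrite -(mul_malgC k y).
by rewrite mulrA central; apply: (@scalerAl F malgX).
Qed.
HB.instance Definition _ := GRing.Lalgebra_isAlgebra.Build F free_alg fscaleAr.

(** The algebra morphism extending [v]. *)
Section Lift.
Variables (B : algType F) (v : X -> B).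

Definition free_lift_mon (m : {fmonom X}) : B := \prod_(x <- (m : seq X)) v x.
Lemma free_lift_mon_morph : mmorphism free_lift_mon.
Proof.
split=> [m n|]; rewrite /free_lift_mon; first by rewrite fmM big_cat.
by rewrite fm1 big_nil.
Qed.
HB.instance Definition _ :=
  monalg.isMultiplicative.Build {fmonom X} B free_lift_mon free_lift_mon_morph.

Definition free_lift (u : free_alg) : B := mmap (in_alg B) free_lift_mon u.

Lemma free_lift_zmod_morphism : zmod_morphism free_lift.
Proof.
move=> x y; rewrite -[x - y]/(fadd x (fopp y)) !fopE.
exact: mmap_is_additive.
Qed.
Lemma free_lift_monoid_morphism : monoid_morphism free_lift.
Proof.
have [hM h1] : multiplicative (mmap (in_alg B) free_lift_mon).
  apply: commr_mmap_is_multiplicative => g m m'.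
  by rewrite /GRing.comm mulr_algl mulr_algr.
split=> [|x y]; first by rewrite -[1]/fone fopE; apply: h1.
by rewrite -[x * y]/(fmul x y) fopE; apply: hM.
Qed.
Lemma free_lift_scalable : scalable free_lift.
Proof.
move=> k u; rewrite -[k *: u in LHS]/(fscale k u) fopE.
by rewrite /free_lift mmapZ /= mulr_algl.
Qed.
HB.instance Definition _ :=
  GRing.isZmodMorphism.Build free_alg B free_lift free_lift_zmod_morphism.
HB.instance Definition _ :=
  GRing.isMonoidMorphism.Build free_alg B free_lift free_lift_monoid_morphism.
HB.instance Definition _ :=
  GRing.isScalable.Build F free_alg B *:%R free_lift free_lift_scalable.

Lemma free_lift_fgen x : free_lift (fgen x) = v x.
Proof.
rewrite /free_lift /fgen unlock.
by rewrite mmapU /= scale1r mul1r /free_lift_mon fmU big_seq1.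
Qed.
End Lift.

End FreeAlgebra.

Section QuotientAlgebra.
Variables (F : fieldType) (A : algType F).

Definition two_sided_ideal (I : {pred A}) : Prop :=
  zmod_closed I /\ forall a x b, x \in I -> a * x * b \in I.

Variable rel : A -> A -> Prop.

(** The smallest two-sided ideal containing [l - r] whenever [rel l r]. *)
Definition rel_ideal : {pred A} :=
  [pred x | `[< forall I : {pred A}, two_sided_ideal I ->
                  (forall l r, rel l r -> l - r \in I) -> x \in I >]].

Lemma rel_idealP : two_sided_ideal rel_ideal.
Proof.
split; first split.
- by apply/asboolP => I [[]].
- move=> x y /asboolP hx /asboolP hy; apply/asboolP => I hI hr.
  by case: (hI) => -[_ hB] _; apply: hB; [apply: hx | apply: hy].
- move=> a x b /asboolP hx; apply/asboolP => I hI hr.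
  by case: (hI) => _; apply; apply: hx.
Qed.

Lemma rel_ideal_rel l r : rel l r -> l - r \in rel_ideal.
Proof. by move=> h; apply/asboolP => I _; apply. Qed.

HB.instance Definition _ := GRing.isZmodClosed.Build A rel_ideal rel_idealP.1.

Definition quot_alg : Type := Quotient.quot rel_ideal.
HB.instance Definition _ := GRing.Zmodule.on quot_alg.

Definition qpi (x : A) : quot_alg := \pi_(Quotient.quot rel_ideal) x.

Lemma qpi_eq x y : (qpi x = qpi y) <-> (x - y \in rel_ideal).
Proof. by rewrite Quotient.idealrBE; split => [h|/eqP]; first apply/eqP. Qed.

Lemma qpi_repr (x : quot_alg) : qpi (repr x) = x.
Proof. exact: reprK. Qed.

Lemma qpiB : {morph qpi : x y / x - y}.
Proof. exact: (raddfB (\pi_(Quotient.quot rel_ideal))). Qed.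

Lemma qpiD : {morph qpi : x y / x + y}.
Proof. exact: (raddfD (\pi_(Quotient.quot rel_ideal))). Qed.

Definition qone : quot_alg := qpi 1.
Definition qmul : quot_alg -> quot_alg -> quot_alg :=
  locked_with op_key (fun x y => qpi (repr x * repr y)).
Definition qscale : F -> quot_alg -> quot_alg :=
  locked_with op_key (fun k x => qpi (k *: repr x)).

Lemma qpiM x y : qmul (qpi x) (qpi y) = qpi (x * y).
Proof.
rewrite /qmul unlock; have [[_ hB] hM] := rel_idealP.
set x' := repr (qpi x); set y' := repr (qpi y).
have /qpi_eq hx : qpi x' = qpi x by exact: qpi_repr.
have /qpi_eq hy : qpi y' = qpi y by exact: qpi_repr.
apply/qpi_eq; rewrite -/x' -/y'.
have -> : x' * y' - x * y = 1 * (x' - x) * y' + x * (y' - y) * 1.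
  by rewrite mul1r mulr1 mulrBl mulrBr addrA subrK.
by rewrite rpredD //; apply: hM.
Qed.

Lemma qpiZ k x : qscale k (qpi x) = qpi (k *: x).
Proof.
rewrite /qscale unlock; set x' := repr (qpi x).
have /qpi_eq hx : qpi x' = qpi x by exact: qpi_repr.
apply/qpi_eq; rewrite -/x' -scalerBr -mulr_algl -[X in X \in _]mulr1.
by apply: rel_idealP.2.
Qed.

Lemma qind (P : quot_alg -> Prop) : (forall x, P (qpi x)) -> forall x, P x.
Proof. by move=> h x; rewrite -(qpi_repr x). Qed.

Lemma qmulA : associative qmul.
Proof. by do 3!elim/qind=> ?; rewrite !qpiM mulrA. Qed.
Lemma qmul1l : left_id qone qmul.
Proof. by elim/qind=> ?; rewrite qpiM mul1r. Qed.
Lemma qmul1r : right_id qone qmul.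
Proof. by elim/qind=> ?; rewrite qpiM mulr1. Qed.
Lemma qmulDl : left_distributive qmul +%R.
Proof. by do 3!elim/qind=> ?; rewrite -qpiD !qpiM mulrDl qpiD. Qed.
Lemma qmulDr : right_distributive qmul +%R.
Proof. by do 3!elim/qind=> ?; rewrite -qpiD !qpiM mulrDr qpiD. Qed.

HB.instance Definition _ :=
  GRing.Zmodule_isPzRing.Build quot_alg qmulA qmul1l qmul1r qmulDl qmulDr.

Lemma qscaleA a b v : qscale a (qscale b v) = qscale (a * b) v.
Proof. by elim/qind: v => v; rewrite !qpiZ scalerA. Qed.
Lemma qscale1 : left_id 1 qscale.
Proof. by elim/qind=> ?; rewrite qpiZ scale1r. Qed.
Lemma qscaleDr : right_distributive qscale +%R.
Proof. by move=> k; do 2!elim/qind=> ?; rewrite -qpiD !qpiZ scalerDr qpiD. Qed.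
Lemma qscaleDl v : {morph qscale^~ v : a b / a + b}.
Proof. by move=> a b /=; elim/qind: v => ?; rewrite !qpiZ scalerDl qpiD. Qed.

HB.instance Definition _ :=
  GRing.Zmodule_isLmodule.Build F quot_alg qscaleA qscale1 qscaleDr qscaleDl.

Lemma quot_scalerAl (k : F) (x y : quot_alg) : k *: (x * y) = k *: x * y.
Proof.
elim/qind: x => x; elim/qind: y => y.
change (qscale k (qmul (qpi x) (qpi y)) = qmul (qscale k (qpi x)) (qpi y)).
by rewrite qpiM !qpiZ qpiM scalerAl.
Qed.
Lemma quot_scalerAr (k : F) (x y : quot_alg) : k *: (x * y) = x * (k *: y).
Proof.
elim/qind: x => x; elim/qind: y => y.
change (qscale k (qmul (qpi x) (qpi y)) = qmul (qpi x) (qscale k (qpi y))).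
by rewrite qpiM !qpiZ qpiM scalerAr.
Qed.

Lemma qpi_monoid_morphism : monoid_morphism (qpi : A -> quot_alg).
Proof. by split=> // x y; rewrite -qpiM. Qed.
Lemma qpi_scalable : scalable (qpi : A -> quot_alg).
Proof. by move=> k x; rewrite -qpiZ. Qed.
HB.instance Definition _ := GRing.isZmodMorphism.Build A quot_alg qpi qpiB.
HB.instance Definition _ :=
  GRing.isMonoidMorphism.Build A quot_alg qpi qpi_monoid_morphism.
HB.instance Definition _ :=
  GRing.isScalable.Build F A quot_alg *:%R qpi qpi_scalable.

Lemma quot_alg_neq0 (B : nzRingType) (f : {rmorphism A -> B}) :
  (forall l r, rel l r -> f l = f r) -> (1 : quot_alg) != 0.
Proof.
move=> hf; apply/eqP => e.
have /qpi_eq : qpi 1 = qpi 0.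
  by rewrite [LHS]e; symmetry; exact: (raddf0 (\pi_(Quotient.quot rel_ideal))).
rewrite subr0 => /asboolP /(_ [pred x | f x == 0]) h.
suff /h : two_sided_ideal [pred x | f x == 0].
  have hr l r : rel l r -> l - r \in [pred x | f x == 0].
    by move=> /hf e'; rewrite inE rmorphB e' subrr.
  by move=> /(_ hr); rewrite inE rmorph1 oner_eq0.
split; first split; rewrite ?inE ?rmorph0 //.
  by move=> x y; rewrite !inE rmorphB => /eqP-> /eqP->; rewrite subr0.
by move=> a x b; rewrite !inE !rmorphM => /eqP->; rewrite mulr0 mul0r.
Qed.

End QuotientAlgebra.

Section Subalgebra.
Variables (F : fieldType) (A : algType F) (S : A -> Prop).

Definition subalg_gen : {pred A} :=
  [pred x | `[< forall B : {pred A}, subalg_closed B ->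
                  (forall y, S y -> y \in B) -> x \in B >]].

Lemma subalg_gen_closed : subalg_closed subalg_gen.
Proof.
split.
- by apply/asboolP => B [].
- move=> a x y /asboolP hx /asboolP hy; apply/asboolP => B hB hS.
  by case: (hB) => _ + _; apply; [apply: hx | apply: hy].
- move=> x y /asboolP hx /asboolP hy; apply/asboolP => B hB hS.
  by case: (hB) => _ _; apply; [apply: hx | apply: hy].
Qed.
HB.instance Definition _ :=
  GRing.isSubalgClosed.Build F A subalg_gen
    (GRing.subalg_closed_semi subalg_gen_closed).

Lemma mem_subalg_gen x : S x -> x \in subalg_gen.
Proof. by move=> h; apply/asboolP => B _; apply. Qed.

Lemma subalg_gen_sub (B : {pred A}) : subalg_closed B ->
  (forall y, S y -> y \in B) -> {subset subalg_gen <= B}.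
Proof. by move=> hB hS x /asboolP; apply. Qed.

Definition subalg : Type := {x : A | x \in subalg_gen}.
HB.instance Definition _ := [isSub of subalg for @sval A _].
HB.instance Definition _ := [Choice of subalg by <:].
HB.instance Definition _ := [SubChoice_isSubAlgebra of subalg by <:].

Definition subalg_elt x (Sx : S x) : subalg := Sub x (mem_subalg_gen Sx).

End Subalgebra.

Section Inclusion.
Variables (F : fieldType) (A : algType F) (S T : A -> Prop).
Hypothesis ST : {subset subalg_gen S <= subalg_gen T}.

Definition subalg_incl (x : subalg S) : subalg T := Sub (val x) (ST (valP x)).

Lemma subalg_incl_zmod_morphism : zmod_morphism subalg_incl.
Proof. by move=> x y; apply: val_inj. Qed.
Lemma subalg_incl_monoid_morphism : monoid_morphism subalg_incl.
Proof. by split=> [|x y]; apply: val_inj. Qed.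
HB.instance Definition _ := GRing.isZmodMorphism.Build _ _ subalg_incl
  subalg_incl_zmod_morphism.
HB.instance Definition _ := GRing.isMonoidMorphism.Build _ _ subalg_incl
  subalg_incl_monoid_morphism.
End Inclusion.

Section Restriction.
Variables (B A : pzRingType) (f : {rmorphism B -> A}) (M : lmodType A).

Definition res_scalars : Type := let _ := f in M.
HB.instance Definition _ := GRing.Zmodule.copy res_scalars M.

Definition res_scale (b : B) (x : res_scalars) : res_scalars := f b *: (x : M).

Lemma res_scaleA a b v : res_scale a (res_scale b v) = res_scale (a * b) v.
Proof. by rewrite /res_scale scalerA rmorphM. Qed.
Lemma res_scale1 : left_id 1 res_scale.
Proof. by move=> v; rewrite /res_scale rmorph1 scale1r. Qed.
Lemma res_scaleDr : right_distributive res_scale +%R.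
Proof. by move=> b x y; apply: scalerDr. Qed.
Lemma res_scaleDl v : {morph res_scale^~ v : a b / a + b}.
Proof. by move=> a b; rewrite /res_scale rmorphD; apply: scalerDl. Qed.

HB.instance Definition _ := GRing.Zmodule_isLmodule.Build B res_scalars
  res_scaleA res_scale1 res_scaleDr res_scaleDl.
End Restriction.

Section Induction.
Variables (B A : pzRingType) (f : {rmorphism B -> A}) (M : lmodType B).

(** [A (x)_B M], where [B] acts on [A] on the right through [f], is the free
    abelian group on [A * M] modulo the biadditivity and balancing relations. *)
Definition free_AM : Type := {malg int[(A * M)%type]}.
HB.instance Definition _ := GRing.Zmodule.on free_AM.
Definition tsym (a : A) (m : M) : free_AM := << (a, m) >>.

Inductive tensor_rel : free_AM -> free_AM -> Prop :=
| TensorDl a a' m : tensor_rel (tsym (a + a') m) (tsym a m + tsym a' m)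
| TensorDr a m m' : tensor_rel (tsym a (m + m')) (tsym a m + tsym a m')
| TensorM a b m : tensor_rel (tsym (a * f b) m) (tsym a (b *: m)).

Definition tensor_null : {pred free_AM} :=
  [pred x | `[< forall S : {pred free_AM}, zmod_closed S ->
                  (forall l r, tensor_rel l r -> l - r \in S) -> x \in S >]].

Lemma tensor_null_closed : zmod_closed tensor_null.
Proof.
split; first by apply: asboolT => S [].
move=> x y /asboolP hx /asboolP hy; apply: asboolT => S hS hr.
by case: (hS) => _; apply; [apply: hx | apply: hy].
Qed.
Lemma tensor_null_rel l r : tensor_rel l r -> l - r \in tensor_null.
Proof. by move=> h; apply: asboolT => S _; apply. Qed.
Lemma tensor_null_ind (S : {pred free_AM}) : zmod_closed S ->
  (forall l r, tensor_rel l r -> l - r \in S) -> {subset tensor_null <= S}.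
Proof. by move=> hS hr x /asboolP; apply. Qed.
HB.instance Definition _ :=
  GRing.isZmodClosed.Build free_AM tensor_null tensor_null_closed.

Definition induced : Type := Quotient.quot tensor_null.
HB.instance Definition _ := GRing.Zmodule.on induced.

Definition tpi (x : free_AM) : induced := \pi_(Quotient.quot tensor_null) x.

Let tpi_eq x y : (tpi x = tpi y) <-> (x - y \in tensor_null).
Proof. by rewrite Quotient.idealrBE; split => [h|/eqP]; first apply/eqP. Qed.
Let tpi_repr (x : induced) : tpi (repr x) = x.
Proof. exact: reprK. Qed.
Let tpiD : {morph tpi : x y / x + y}.
Proof. exact: (raddfD (\pi_(Quotient.quot tensor_null))). Qed.
Let tpiB : {morph tpi : x y / x - y}.
Proof. exact: (raddfB (\pi_(Quotient.quot tensor_null))). Qed.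
Let tpi0 : tpi 0 = 0.
Proof. exact: (raddf0 (\pi_(Quotient.quot tensor_null))). Qed.

(** The pure tensor [a (x) m]. *)
Definition tensor (a : A) (m : M) : induced := tpi (tsym a m).

Definition lact (a : A) (g : free_AM) : free_AM :=
  \sum_(k <- msupp g) << g@_k *g (a * k.1, k.2) >>.

Let lactEw a (d : {fset (A * M)%type}) (g : free_AM) : (msupp g `<=` d)%fset ->
  lact a g = \sum_(k <- d) << g@_k *g (a * k.1, k.2) >>.
Proof.
move=> le; rewrite [LHS](big_fset_incl _ le) => //= k _ /mcoeff_outdom ->.
by rewrite monalgU0.
Qed.

Lemma lact_is_zmod_morphism a : zmod_morphism (lact a).
Proof.
move=> g1 g2.
have s1 : (msupp g1 `<=` msupp g1 `|` msupp g2)%fset := fsubsetUl _ _.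
have s2 : (msupp g2 `<=` msupp g1 `|` msupp g2)%fset := fsubsetUr _ _.
rewrite (lactEw a s1) (lactEw a s2) (lactEw a (msuppB_le _ _)) -sumrB.
by apply: eq_bigr => k _; rewrite mcoeffB monalgUB.
Qed.
HB.instance Definition _ a :=
  GRing.isZmodMorphism.Build free_AM free_AM (lact a) (lact_is_zmod_morphism a).

Let lactB a : {morph lact a : x y / x - y} := lact_is_zmod_morphism a.
Let lactD a : {morph lact a : x y / x + y} := raddfD (lact a).
Let lact0 a : lact a 0 = 0 := raddf0 (lact a).

Lemma lactU a a' m : lact a (tsym a' m) = tsym (a * a') m.
Proof. by rewrite (lactEw a msuppU_le) big_seq_fset1 mcoeffUU. Qed.

Let lact_null a x : x \in tensor_null -> lact a x \in tensor_null.
Proof.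
pose S : {pred free_AM} := [pred x | lact a x \in tensor_null].
have SE y : (y \in S) = (lact a y \in tensor_null) by [].
rewrite -SE; apply: tensor_null_ind.
  split=> [|y z]; first by rewrite SE lact0; apply: tensor_null_closed.1.
  by rewrite !SE lactB; apply: tensor_null_closed.2.
move=> l r h; rewrite SE lactB; apply: tensor_null_rel; case: h => *.
- by rewrite lactD !lactU mulrDr; apply: TensorDl.
- by rewrite lactD !lactU; apply: TensorDr.
- by rewrite !lactU mulrA; apply: TensorM.
Qed.

Definition ind_scale : A -> induced -> induced :=
  locked_with op_key (fun a x => tpi (lact a (repr x))).

Let ind_scale_pi a x : ind_scale a (tpi x) = tpi (lact a x).
Proof.
rewrite /ind_scale unlock; apply/tpi_eq.
by rewrite -lactB; apply/lact_null/tpi_eq/tpi_repr.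
Qed.

Lemma ind_scaleE a a' m : ind_scale a (tensor a' m) = tensor (a * a') m.
Proof. by rewrite ind_scale_pi lactU. Qed.

Lemma ind_scaleDr : right_distributive ind_scale +%R.
Proof.
move=> a x y; rewrite -[x]tpi_repr -[y]tpi_repr -tpiD !ind_scale_pi.
by rewrite lactD tpiD.
Qed.

Lemma induced_ind (P : induced -> Prop) :
  P 0 -> (forall x y, P x -> P y -> P (x - y)) ->
  (forall a m, P (tensor a m)) -> forall x, P x.
Proof.
move=> P0 PB Pt x; rewrite -(tpi_repr x); move: (repr x) => {x} g.
have PN x : P x -> P (- x) by move=> h; rewrite -sub0r; apply: PB.
have PD x y : P x -> P y -> P (x + y).
  by move=> hx hy; rewrite -[y]opprK; apply: PB => //; apply: PN.
have PZ (z : int) k : P (tpi << z *g k >>).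
  have -> : << z *g k >> = tsym k.1 k.2 *~ z.
    apply/malgP => k'; rewrite raddfMz /= !mcoeffU -surjective_pairing.
    by case: eqP => _; rewrite ?mulr0n ?mul0rz // mulr1n intz.
  have tpin n h : P (tpi h) -> P (tpi (h *+ n)).
    move=> ?; elim: n => [|n IH]; first by rewrite mulr0n tpi0.
    by rewrite mulrS tpiD; apply: PD.
  case: z => n; first by apply: tpin; apply: Pt.
  by rewrite NegzE mulrNz -sub0r tpiB tpi0 sub0r; apply/PN/tpin/Pt.
rewrite (monalgE g); elim/big_ind: _ => //; first by rewrite tpi0.
by move=> u v hu hv; rewrite tpiD; apply: PD.
Qed.

Let ind_scaleB c x y : ind_scale c (x - y) = ind_scale c x - ind_scale c y.
Proof.
rewrite -[x]tpi_repr -[y]tpi_repr -tpiB !ind_scale_pi lactB.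
exact: tpiB.
Qed.

Lemma ind_scaleA a b v : ind_scale a (ind_scale b v) = ind_scale (a * b) v.
Proof.
elim/induced_ind: v => [|x y hx hy|a' m].
- by rewrite -(subrr 0) !ind_scaleB !subrr.
- by rewrite !ind_scaleB hx hy.
- by rewrite !ind_scaleE mulrA.
Qed.
Lemma ind_scale1 : left_id 1 ind_scale.
Proof.
elim/induced_ind=> [|x y hx hy|a' m].
- by rewrite -{1}(subrr 0) !ind_scaleB subrr.
- by rewrite !ind_scaleB hx hy.
- by rewrite !ind_scaleE mul1r.
Qed.
Lemma ind_scaleDl v : {morph ind_scale^~ v : a b / a + b}.
Proof.
move=> a b /=.
elim/induced_ind: v => [|x y hx hy|a' m].
- by rewrite -(subrr 0) !ind_scaleB !subrr addr0.
- by rewrite !ind_scaleB hx hy opprD addrACA.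
- rewrite !ind_scaleE mulrDl -tpiD; apply/tpi_eq/tensor_null_rel.
  exact: TensorDl.
Qed.

HB.instance Definition _ := GRing.Zmodule_isLmodule.Build A induced
  ind_scaleA ind_scale1 ind_scaleDr ind_scaleDl.
End Induction.

Definition irreducible (A : pzRingType) (M : lmodType A) : Prop :=
  (exists m : M, m != 0) /\
  forall N : {pred M}, submod_closed N -> N =i pred1 0 \/ N =i predT.

Section QuantumAffineSl2.
Variable R : realType.

(** The field C(q^{1/2}); the indeterminate is [qh] = q^{1/2}. *)
Definition Cq : fieldType := {fraction {poly R[i]}}.
Definition qh : Cq := tofrac 'X.
Definition q : Cq := qh ^+ 2.

Definition qint (m : int) : Cq := (q ^ m - q ^ (- m)) / (q - q^-1).

Definition nzint : Type := {s : int | s != 0}.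
HB.instance Definition _ := SubChoice.on nzint.

(** In [Gx e k] and below, [e = true] stands for the sign + and [e = false]
    for the sign -; [Ggam] is gamma^{1/2} and the suffix [V] marks inverses. *)
Inductive qgen : Type :=
| Gx of bool & int
| Gh of nzint
| GK | GKV | Ggam | GgamV | GD | GDV.
HB.instance Definition _ := gen_eqMixin qgen.
HB.instance Definition _ := gen_choiceMixin qgen.

Definition sg (e : bool) : int := if e then 1 else -1.

Local Notation FA := (free_alg Cq qgen).
Definition fx e k : FA := fgen Cq (Gx e k).
Definition fh s : FA := fgen Cq (Gh s).
Definition fK : FA := fgen Cq GK.
Definition fKV : FA := fgen Cq GKV.
Definition fgam : FA := fgen Cq Ggam.
Definition fgamV : FA := fgen Cq GgamV.
Definition fD : FA := fgen Cq GD.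
Definition fDV : FA := fgen Cq GDV.

Definition bracket (A : pzRingType) (a b : A) : A := a * b - b * a.

(** gamma^{m/2} *)
Definition gamma_half (m : int) : FA :=
  match m with Posz n => fgam ^+ n | Negz n => fgamV ^+ n.+1 end.

Definition hpos (n : nat) : FA := fh (exist _ (Posz n.+1) isT).
Definition hneg (n : nat) : FA := fh (exist _ (Negz n) isT).

(** Coefficient of z^k in exp (sum_(n >= 0) a_n z^(n+1)); the series has no
    constant term, so that truncating it at degree k and the exponential at
    order k does not change this coefficient. *)
Definition exp_coef (A : algType Cq) (a : nat -> A) (k : nat) : A :=
  \sum_(n < k.+1) (n`!%:R : Cq)^-1 *: ((('X * \poly_(l < k) a l) ^+ n)`_k).

Definition psi (k : int) : FA :=
  if k is Posz n then fK * exp_coef (fun l => (q - q^-1) *: hpos l) n else 0.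
Definition phi (k : int) : FA :=
  if - k is Posz n then fKV * exp_coef (fun l => - (q - q^-1) *: hneg l) n
  else 0.

Inductive drinfeld_rel : FA -> FA -> Prop :=
| RgamC u : drinfeld_rel (fgam * u) (u * fgam)
| RgamVC u : drinfeld_rel (fgamV * u) (u * fgamV)
| RKKV : drinfeld_rel (fK * fKV) 1
| RKVK : drinfeld_rel (fKV * fK) 1
| RDDV : drinfeld_rel (fD * fDV) 1
| RDVD : drinfeld_rel (fDV * fD) 1
| RggV : drinfeld_rel (fgam * fgamV) 1
| RgVg : drinfeld_rel (fgamV * fgam) 1
| RDK : drinfeld_rel (bracket fD fK) 0
| RKh s : drinfeld_rel (bracket fK (fh s)) 0
| RDh s : drinfeld_rel (fD * fh s * fDV) (q ^ (val s) *: fh s)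
| RDx e r : drinfeld_rel (fD * fx e r * fDV) (q ^ r *: fx e r)
| RKx e r : drinfeld_rel (fK * fx e r * fKV) (q ^ (2 * sg e) *: fx e r)
| Rhh k l : drinfeld_rel (bracket (fh k) (fh l))
    (if val k == - val l then
       (qint (2 * val k) / (val k)%:~R / (q - q^-1))
         *: (gamma_half (2 * val k) - gamma_half (- (2 * val k)))
     else 0)
| Rhx k e l : drinfeld_rel (bracket (fh k) (fx e l))
    (((sg e)%:~R * qint (2 * val k) / (val k)%:~R)
       *: (gamma_half (- sg e * `|val k|) * fx e (val k + l)))
| Rxx e k l : drinfeld_rel
    (fx e (k + 1) * fx e l - q ^ (2 * sg e) *: (fx e l * fx e (k + 1)))
    (q ^ (2 * sg e) *: (fx e k * fx e (l + 1)) - fx e (l + 1) * fx e k)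
| Rxpxm k l : drinfeld_rel (bracket (fx true k) (fx false l))
    ((q - q^-1)^-1 *: (gamma_half (k - l) * psi (k + l)
                       - gamma_half (l - k) * phi (k + l))).

Definition Uq : Type := quot_alg drinfeld_rel.
HB.instance Definition _ := GRing.PzRing.on Uq.
HB.instance Definition _ := GRing.Lmodule.on Uq.

(* The trivial representation, used only to see that 1 != 0 in [Uq]. *)
Section TrivialRep.
Variables (B : comAlgType Cq) (f : {rmorphism FA -> B}).
Definition triv_gen (g : qgen) : B :=
  match g with Gx _ _ | Gh _ => 0 | _ => 1 end.
Hypothesis f_fgen : forall g, f (fgen Cq g) = triv_gen g.
Hypothesis fZ : forall k u, f (k *: u) = k *: f u.

Lemma triv_gamma m : f (gamma_half m) = 1.
Proof. by case: m => n; rewrite (rmorphXn f) f_fgen expr1n. Qed.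
Lemma triv_bracket u v : f (bracket u v) = 0.
Proof. by rewrite (rmorphB f) !(rmorphM f) (mulrC (f u)) subrr. Qed.
Lemma triv_exp a k : (forall l, f (a l) = 0) ->
  f (exp_coef a k) = (k == 0)%:R.
Proof.
move=> ha; rewrite /exp_coef (rmorph_sum f) big_ord_recl big1 => [|i _].
  by rewrite addr0 fZ fact0 invr1 scale1r expr0 coef1 (rmorph_nat f).
rewrite fZ -(coef_map f) rmorphXn rmorphM /= map_polyX.
suff -> : map_poly f (\poly_(l < k) a l) = 0.
  by rewrite mulr0 expr0n coef0 scaler0.
apply/polyP => j; rewrite (coef_map f) coef_poly coef0.
by case: ifP => _; [exact: ha | exact: rmorph0].
Qed.
Lemma triv_psi k : f (psi k) = (k == 0)%:R.
Proof.
case: k => n /=; last by rewrite (rmorph0 f).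
by rewrite (rmorphM f) f_fgen mul1r triv_exp // => l; rewrite fZ f_fgen scaler0.
Qed.
Lemma triv_phi k : f (phi k) = (k == 0)%:R.
Proof.
rewrite /phi -[in RHS]oppr_eq0; case: (- k) => n /=; last by rewrite (rmorph0 f).
by rewrite (rmorphM f) f_fgen mul1r triv_exp // => l; rewrite fZ f_fgen scaler0.
Qed.
Lemma triv_rel l r : drinfeld_rel l r -> f l = f r.
Proof.
have fM u v : f (u * v) = f u * f v := rmorphM f u v.
have fB u v : f (u - v) = f u - f v := rmorphB f u v.
have f0 : f 0 = 0 := rmorph0 f.
have f1 : f 1 = 1 := rmorph1 f.
have fx0 e k : f (fx e k) = 0 := f_fgen _.
have fh0 s : f (fh s) = 0 := f_fgen _.
case=> [u|u| | | | | | | |s|s|e n|e n|k m|k e m|e k m|k m].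
- by rewrite fM mulrC -fM.
- by rewrite fM mulrC -fM.
- by rewrite fM 2!f_fgen f1 mulr1.
- by rewrite fM 2!f_fgen f1 mulr1.
- by rewrite fM 2!f_fgen f1 mulr1.
- by rewrite fM 2!f_fgen f1 mulr1.
- by rewrite fM 2!f_fgen f1 mulr1.
- by rewrite fM 2!f_fgen f1 mulr1.
- by rewrite triv_bracket f0.
- by rewrite triv_bracket f0.
- by rewrite 2!fM fZ fh0 mulr0 mul0r scaler0.
- by rewrite 2!fM fZ fx0 mulr0 mul0r scaler0.
- by rewrite 2!fM fZ fx0 mulr0 mul0r scaler0.
- rewrite triv_bracket; case: ifP => _; last by rewrite f0.
  by rewrite fZ fB 2!triv_gamma subrr scaler0.
- by rewrite triv_bracket fZ fM fx0 mulr0 scaler0.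
- move: (k + 1) (m + 1) => k' m'.
  by rewrite 2!fB 2!fZ 4!fM !fx0 !mulr0 !scaler0.
- by rewrite triv_bracket fZ fB 2!fM 2!triv_gamma triv_psi triv_phi subrr scaler0.
Qed.
End TrivialRep.

Lemma Uq_neq0 : (1 : Uq) != 0.
Proof.
pose f := free_lift (@triv_gen Cq^o).
exact: (quot_alg_neq0 (triv_rel (f := f) (free_lift_fgen _) (free_lift_scalable _))).
Qed.
HB.instance Definition _ := GRing.PzSemiRing_isNonZero.Build Uq Uq_neq0.
HB.instance Definition _ :=
  GRing.Lmodule_isLalgebra.Build Cq Uq (@quot_scalerAl _ _ drinfeld_rel).
HB.instance Definition _ :=
  GRing.Lalgebra_isAlgebra.Build Cq Uq (@quot_scalerAr _ _ drinfeld_rel).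

Definition ux e k : Uq := qpi drinfeld_rel (fx e k).
Definition uh s : Uq := qpi drinfeld_rel (fh s).
Definition uK : Uq := qpi drinfeld_rel fK.
Definition uKV : Uq := qpi drinfeld_rel fKV.
Definition ugam : Uq := qpi drinfeld_rel fgam.
Definition ugamV : Uq := qpi drinfeld_rel fgamV.
Definition uD : Uq := qpi drinfeld_rel fD.
Definition uDV : Uq := qpi drinfeld_rel fDV.

Inductive Hprime_gen : Uq -> Prop :=
| Hprime_gam : Hprime_gen ugam
| Hprime_gamV : Hprime_gen ugamV
| Hprime_h s : Hprime_gen (uh s).

Inductive Hplus_gen : Uq -> Prop :=
| Hplus_h s : (0 < val s)%R -> Hplus_gen (uh s).

Inductive Hb_gen : Uq -> Prop :=
| Hb_Hplus y : y \in subalg_gen Hplus_gen -> Hb_gen y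
| Hb_gam : Hb_gen ugam
| Hb_gamV : Hb_gen ugamV.

Inductive Hq_gen : Uq -> Prop :=
| Hq_Hprime y : y \in subalg_gen Hprime_gen -> Hq_gen y
| Hq_D : Hq_gen uD
| Hq_DV : Hq_gen uDV.

Inductive Bdq_gen : Uq -> Prop :=
| Bdq_xp k : Bdq_gen (ux true k)
| Bdq_Hq y : y \in subalg_gen Hq_gen -> Bdq_gen y
| Bdq_K : Bdq_gen uK
| Bdq_KV : Bdq_gen uKV.

(** [Hplus] is H'_q(+) and [Hb] is H'_q(b). *)
Definition Hplus : algType Cq := subalg Hplus_gen.
Definition Hb : algType Cq := subalg Hb_gen.
Definition Hq : algType Cq := subalg Hq_gen.
Definition Bdq : algType Cq := subalg Bdq_gen.

Lemma Hplus_sub_Hb : {subset subalg_gen Hplus_gen <= subalg_gen Hb_gen}.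
Proof. by move=> y hy; apply/mem_subalg_gen/Hb_Hplus. Qed.
Lemma Hb_sub_Hq : {subset subalg_gen Hb_gen <= subalg_gen Hq_gen}.
Proof.
have hH : {subset subalg_gen Hprime_gen <= subalg_gen Hq_gen}.
  by move=> y hy; apply/mem_subalg_gen/Hq_Hprime.
apply: (subalg_gen_sub (subalg_gen_closed _)) => _ [y|/=|/=].
- apply: (subalg_gen_sub (subalg_gen_closed _)) => _ [s _].
  by apply/hH/mem_subalg_gen/Hprime_h.
- exact/hH/mem_subalg_gen/Hprime_gam.
- exact/hH/mem_subalg_gen/Hprime_gamV.
Qed.
Lemma Hq_sub_Bdq : {subset subalg_gen Hq_gen <= subalg_gen Bdq_gen}.
Proof. by move=> y hy; apply/mem_subalg_gen/Bdq_Hq. Qed.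

Definition Hplus_Hb : {rmorphism Hplus -> Hb} := subalg_incl Hplus_sub_Hb.
Definition Hb_Hq : {rmorphism Hb -> Hq} := subalg_incl Hb_sub_Hq.
Definition Hq_Bdq : {rmorphism Hq -> Bdq} := subalg_incl Hq_sub_Bdq.
Definition Bdq_Uq : {rmorphism Bdq -> Uq} :=
  (val : subalg Bdq_gen -> Uq).

(** The weight lattice of sl_2 is generated by the fundamental weight, which
    takes the value 1 on the coroot h; [lam : weight] is its [lam]-fold
    multiple. *)
Definition weight : Type := int.
Definition coroot_value (lam : weight) : int := lam.

(** [V] is the one-dimensional H'_q(b)-module C_(zeta,a)(q^{1/2}) v. *)
Definition is_zeta_a_line (zeta : {lrmorphism Hplus -> Cq | *%R}) (a : int)
    (V : lmodType Hb) (v : V) : Prop :=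
  [/\ forall w : V, exists! c : Cq, w = (c%:A : Hb) *: v,
      forall y : Hplus, Hplus_Hb y *: v = ((zeta y)%:A : Hb) *: v
    & (subalg_elt Hb_gam : Hb) *: v = ((qh ^ a)%:A : Hb) *: v].

(** M^q_(zeta,a), for [V] the above line. *)
Definition Mza (V : lmodType Hb) : lmodType Hq := induced Hb_Hq V.

(** [M] is M^q_(zeta,lam) as a B_q^d-module: it is M^q_(zeta,a) over H_q, K
    and its inverse act by scalars and the x^+_k act by zero. *)
Definition is_Mzlam (V : lmodType Hb) (lam : weight) (M : lmodType Bdq) :
    Prop :=
  [/\ exists th : {linear Mza V -> res_scalars Hq_Bdq M}, bijective th,
      forall m : M, (subalg_elt Bdq_K : Bdq) *: m
                    = ((q ^ coroot_value lam)%:A : Bdq) *: m,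
      forall m : M, (subalg_elt Bdq_KV : Bdq) *: m
                    = ((q ^ (- coroot_value lam))%:A : Bdq) *: m
    & forall k (m : M), (subalg_elt (Bdq_xp k) : Bdq) *: m = 0].

Definition Mhat (M : lmodType Bdq) : lmodType Uq := induced Bdq_Uq M.

End QuantumAffineSl2.

(* Main.v *)
(** The coefficients of K exp(sum_l a_l z^l) satisfy the recursion
    n E_n = sum_l l a_l E_(n-l); all relations between the currents psi, phi
    and the x^+_k, x^-_l are derived from it.

    The induced module is not zero: U_q acts on a subspace of the space of
    functions from words in the x^+_k to M, on which x^+_k acts by shift and
    the other generators are forced by their commutators with the shifts, and
    1 (x) m is sent to the function that vanishes outside the empty word.

    A nonzero submodule meets 1 (x) M.  By the quadratic relations every vector
    is a combination of sorted words in the x^-_l applied to 1 (x) M.  For k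
    very negative [x^+_k, x^-_l] is a multiple of phi_(k+l), so that x^+_k
    shortens words and inserts currents acting on M.  As gamma acts by q^a with
    a <> 0, [h_s, phi_(-r)] is a nonzero multiple of phi_(s-r), whence the
    combinations of the phi_(-r) that occur do not vanish for suitable k.  A
    triangular pairing of words singles out a leading word and follows it until
    it is empty.  Irreducibility of M then yields all of 1 (x) M, which
    generates the induced module. *)

Require Import Defs.
From HB Require Import structures.
From mathcomp Require Import all_boot all_order all_algebra.
From mathcomp Require Import boolp functions reals complex finmap.
From mathcomp Require Import monalg.
From mathcomp Require Import ring zify.

Set Implicit Arguments.
Unset Strict Implicit.
Unset Printing Implicit Defensive.
Import Order.TTheory GRing.Theory Num.Theory.
Local Open Scope ring_scope.

(** The obstacle is that no basis of the induced module is at hand: neither its nonvanishing nor the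
    leading word of a vector can be read off. Nonvanishing therefore comes from an explicit
    representation, and leading words are found by functionals on formal combinations of words,
    transposes of the lowering operators, which follow a chosen representative of the vector from
    step to step. On functions of words the x^+_k act freely, so that any operator is determined by
    its values on the empty word and its commutators with the shifts. The price is that the
    quadratic relations of the x^+_k hold only on a subspace, whose stability under all generators
    has to be proved. D acts freely on M, so h_s with s > 0 is not a scalar there: on D^j v it is
    q^(-js) zeta(h_s). Elements of M are sorted by the eigenvalues of h_s for all large s only,
    because an operator h_r or phi_(-r) commutes with h_s once s is large. Irreducibility of M
    serves to spread statements from v to all of M, and a <> 0 makes gamma^(1/2) act by q^(a/2),
    which is not a root of unity. *)

Section LinearReflection.
Variables (F : fieldType) (V : lmodType F).

Inductive lexp := LAtom of nat | LZero | LAdd of lexp & lexp | LOpp of lexp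
  | LScale of F & lexp.

Fixpoint leval (env : seq V) (e : lexp) : V :=
  match e with
  | LAtom i => nth 0 env i
  | LZero => 0
  | LAdd e1 e2 => leval env e1 + leval env e2
  | LOpp e1 => - leval env e1
  | LScale c e1 => c *: leval env e1
  end.

Fixpoint lcoef (i : nat) (e : lexp) : F :=
  match e with
  | LAtom j => if Nat.eqb i j then 1 else 0
  | LZero => 0
  | LAdd e1 e2 => lcoef i e1 + lcoef i e2
  | LOpp e1 => - lcoef i e1
  | LScale c e1 => c * lcoef i e1
  end.

Fixpoint lwf (n : nat) (e : lexp) : bool :=
  match e with
  | LAtom j => (j < n)%N
  | LZero => true
  | LAdd e1 e2 => lwf n e1 && lwf n e2
  | LOpp e1 => lwf n e1
  | LScale _ e1 => lwf n e1
  end.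

(** A nested conjunction, so that computing with concrete atoms leaves one field identity per atom
    for [ring] or [field]. *)
Fixpoint lcoefs_eq (n : nat) (e1 e2 : lexp) : Prop :=
  if n is n'.+1 then lcoef n' e1 = lcoef n' e2 /\ lcoefs_eq n' e1 e2 else True.

Lemma levalE env e : lwf (size env) e ->
  leval env e = \sum_(i < size env) lcoef i e *: nth 0 env i.
Proof.
elim: e => [j|_|e1 IH1 e2 IH2|e IH|c e IH] /=.
- move=> h; rewrite (bigD1 (Ordinal h)) //= PeanoNat.Nat.eqb_refl scale1r.
  rewrite big1 ?addr0 // => i hi; case: PeanoNat.Nat.eqb_spec => [e|_].
    by case/eqP: hi; apply: val_inj.
  by rewrite scale0r.
- by rewrite big1 // => i _; rewrite scale0r.
- by case/andP=> /IH1-> /IH2->; rewrite -big_split; apply: eq_bigr => i _; rewrite scalerDl.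
- by move=> /IH->; rewrite -sumrN; apply: eq_bigr => i _; rewrite scaleNr.
- by move=> /IH->; rewrite scaler_sumr; apply: eq_bigr => i _; rewrite scalerA.
Qed.

Lemma lmod_reflect env e1 e2 :
  lwf (size env) e1 && lwf (size env) e2 -> lcoefs_eq (size env) e1 e2 ->
  leval env e1 = leval env e2.
Proof.
case/andP=> h1 h2 h; rewrite !levalE //; apply: eq_bigr => i _; congr (_ *: _).
elim: (size env) h i => [_ []//|n IH [hn h'] i].
have := ltn_ord i; rewrite ltnS leq_eqVlt => /predU1P[->//|hi].
exact: (IH h' (Ordinal hi)).
Qed.
End LinearReflection.

(** Vectors that are convertible but displayed differently have to count as one atom, hence the
    unification after the syntactic test. *)
Ltac lmod_same x y :=
  match constr:(tt) with
  | _ => let _ := match constr:(tt) with _ => constr_eq x y end in constr:(true)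
  | _ => let _ := match constr:(tt) with _ => unify x y end in constr:(true)
  | _ => constr:(false)
  end.
Ltac lmod_mem x l :=
  lazymatch l with
  | nil => constr:(false)
  | cons ?y ?l' => let b := lmod_same x y in
      lazymatch b with true => constr:(true) | _ => lmod_mem x l' end
  end.
Ltac lmod_atoms V t l :=
  lazymatch t with
  | @Algebra.add _ ?x ?y => let l1 := lmod_atoms V x l in lmod_atoms V y l1
  | @Algebra.opp _ ?x => lmod_atoms V x l
  | @Algebra.zero _ => l
  | @GRing.scale _ _ _ ?x => lmod_atoms V x l
  | ?x => let b := lmod_mem x l in
          lazymatch b with true => l | false => constr:(@cons V x l) end
  end.
Ltac lmod_index x l :=
  lazymatch l with
  | cons ?y ?l' => let b := lmod_same x y in
      lazymatch b with true => constr:(O) | _ => let n := lmod_index x l' in constr:(S n) end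
  end.
Ltac lmod_reify F t l :=
  lazymatch t with
  | @Algebra.add _ ?x ?y =>
      let a := lmod_reify F x l in let b := lmod_reify F y l in
      constr:(@LAdd F a b)
  | @Algebra.opp _ ?x => let a := lmod_reify F x l in constr:(@LOpp F a)
  | @Algebra.zero _ => constr:(@LZero F)
  | @GRing.scale _ _ ?c ?x => let a := lmod_reify F x l in constr:(@LScale F c a)
  | ?x => let n := lmod_index x l in constr:(@LAtom F n)
  end.
(* Reduces an equation between linear combinations in [V : lmodType F] to the
   equations between the coefficients of each atom. *)
Tactic Notation "lmod_eq" constr(F) constr(W) :=
  let V := eval cbv beta in (W : lmodType F) in
  lazymatch goal with
  | |- @eq _ ?x ?y =>
    let l0 := constr:(@nil V) in
    let l1 := lmod_atoms V x l0 in let l := lmod_atoms V y l1 in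
    let e1 := lmod_reify F x l in let e2 := lmod_reify F y l in
    change (@leval F V l e1 = @leval F V l e2);
    apply: lmod_reflect;
    [by [] | cbn [lcoefs_eq size lcoef Nat.eqb]; repeat split]
  end.
Tactic Notation "lmod" constr(F) constr(V) := lmod_eq F V; try ring.

(** * Exponential currents *)

Section TriangularSums.
Variable V : nmodType.
Implicit Types f : nat -> nat -> V.

Lemma sum_triangle_diag f n :
  \sum_(l < n.+1) \sum_(i < (n - l).+1) f l i
  = \sum_(p < n.+1) \sum_(l < p.+1) f l (p - l)%N.
Proof.
elim: n => [|n IH]; first by rewrite !big_ord1.
rewrite [RHS]big_ord_recr /= -IH [X in _ = _ + X]big_ord_recr /= subnn.
rewrite [LHS]big_ord_recr /= subnn big_ord1 addrA -big_split /=; congr (_ + _).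
by apply: eq_bigr => l _; rewrite subSn ?leq_ord // [LHS]big_ord_recr.
Qed.

Lemma sum_triangle_exchange f n :
  \sum_(l < n.+1) \sum_(i < (n - l).+1) f l i
  = \sum_(i < n.+1) \sum_(l < (n - i).+1) f l i.
Proof.
have h (g : nat -> nat -> V) : \sum_(l < n.+1) \sum_(i < (n - l).+1) g l i
    = \sum_(l < n.+1) \sum_(i < n.+1 | (l + i <= n)%N) g l i.
  apply: eq_bigr => l _; have hl := leq_ord l.
  rewrite (big_ord_widen n.+1 (g l)) ?ltnS ?leq_subr //.
  by apply: eq_bigl => i; rewrite ltnS leq_subRL.
rewrite (h f) (h (fun i l => f l i)) (exchange_big_dep xpredT) //=.
by apply: eq_bigr => i _; apply: eq_bigl => l; rewrite addnC.
Qed.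
End TriangularSums.

Section Currents.
Variables (F : fieldType) (A : algType F).
Implicit Types (t c : F).
Hypothesis char0 : forall n, (n.+1%:R : F) != 0.

(** Coefficient form of z E' = (z A') E with E(0) = K, where A is the sum of the a_l z^(l+1); the
    index of [a] is shifted by one. *)
Definition exp_rec (K : A) (a E : nat -> A) : Prop :=
  E 0%N = K /\ forall n, n.+1%:R *: E n.+1
                 = \sum_(l < n.+1) l.+1%:R *: (a l * E (n - l)%N).

(** The expansion of (t - z)/(1 - t z) in powers of z: the factor that an exponential current picks
    up when it crosses x. *)
Definition Gc (t : F) (i : nat) : F :=
  if i is i'.+1 then t ^+ i'.+2 - t ^+ i' else t.

(** The logarithmic derivative of that series is t/(1 - t z) - t^-1/(1 - z/t); this is its
    coefficient form. *)
Lemma Gc_rec t i : t != 0 ->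
  i.+1%:R * Gc t i.+1 = \sum_(l < i.+1) (t ^+ l.+1 - t^-1 ^+ l.+1) * Gc t (i - l).
Proof.
move=> t0.
(* The partial sums have a closed form as long as i - l is positive; the last term, where [Gc] takes
   its exceptional value t, is added afterwards. *)
have key m : (m <= i)%N -> \sum_(l < m) (t ^+ l.+1 - t^-1 ^+ l.+1) * Gc t (i - l)
   = m%:R * (t ^+ i.+2 - t ^+ i) + t ^+ i * (t^-1 ^+ (2 * m) - 1).
  elim: m => [|m IH] hm; first by rewrite big_ord0 mul0r muln0 expr0 subrr mulr0 addr0.
  rewrite big_ord_recr /= IH ?(ltnW hm) //.
  have [p ->] : exists p, i = (p.+1 + m)%N by exists (i - m.+1)%N; lia.
  rewrite addnK /=.
  rewrite mulnS [(2 * m)%N]mulnC muln2 -addnn -natr1.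
  rewrite !exprVn !(exprS, exprD) expr0.
  have : t ^+ m != 0 by rewrite expf_neq0.
  by move: (t ^+ m) (t ^+ p) => u w u0; field; rewrite u0 t0.
rewrite big_ord_recr /= key // subnn /= -natr1.
rewrite [(2 * i)%N]mulnC muln2 -addnn !exprVn !(exprS, exprD).
have : t ^+ i != 0 by rewrite expf_neq0.
by move: (t ^+ i) => u u0; field; rewrite u0 t0.
Qed.

Section Recursion.
Variables (K : A) (a E : nat -> A).
Hypothesis recE : exp_rec K a E.

Lemma natr_inj n : injective (fun x : A => (n.+1%:R : F) *: x).
Proof. by move=> x y /(can_inj (scalerK (char0 n))). Qed.

(** The commutator with a_l multiplies the generating series of the x_j by a scalar multiple of a
    power of z, so conjugation by the exponential multiplies it by the series of [Gc]. The induction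
    uses only the recursion for E, matched against [Gc_rec]. *)
Lemma exp_rec_cross t x : t != 0 ->
  (forall j, K * x j = t *: (x j * K)) ->
  (forall l j, l.+1%:R *: (a l * x j - x j * a l)
               = (t ^+ l.+1 - t^-1 ^+ l.+1) *: x (j + l.+1)%N) ->
  forall n j, E n * x j = \sum_(i < n.+1) Gc t i *: (x (j + i)%N * E (n - i)%N).
Proof.
move=> t0 hK ha n j; elim/ltn_ind: n => -[_|n IH].
  by rewrite big_ord1 addn0 subn0 recE.1 hK.
apply: (@natr_inj n); rewrite scalerAl recE.2 mulr_suml.
set c := fun l => t ^+ l.+1 - t^-1 ^+ l.+1.
pose f1 l i : A := Gc t i *: (x (j + i)%N * (l.+1%:R *: (a l * E (n - i - l)%N))).
pose f2 l i : A := (c l * Gc t i) *: (x (j + (l + i).+1)%N * E (n - (l + i))%N).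
(* [f1] collects the terms in which a_l has passed x, [f2] those in which x has absorbed it. The
   first are resummed by the index of x, the second by the total shift l + i. *)
transitivity (\sum_(l < n.+1) \sum_(i < (n - l).+1) (f1 l i + f2 l i)).
  apply: eq_bigr => l _; rewrite -scalerAl -mulrA IH ?ltnS ?leq_subr //.
  rewrite mulr_sumr scaler_sumr; apply: eq_bigr => i _.
  have e : l.+1%:R *: (a l * x (j + i)%N)
    = l.+1%:R *: (x (j + i)%N * a l) + c l *: x (j + i + l.+1)%N.
    by rewrite -ha -scalerDr [_ * a l + _]addrC subrK.
  transitivity (Gc t i *: ((l.+1%:R *: (a l * x (j + i)%N)) * E (n - l - i)%N)).
    by rewrite -scalerAr -scalerAl mulrA !scalerA mulrC.
  rewrite e mulrDl scalerDr /f1 /f2 -!scalerAl -scalerAr !scalerA [c l * _]mulrC mulrA.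
  by congr (_ *: (_ * E _) + _ *: (x _ * E _)); lia.
under eq_bigr do rewrite big_split.
rewrite big_split /= sum_triangle_exchange sum_triangle_diag.
have F1 (i : nat) : \sum_(l < (n - i).+1) f1 l i
    = ((n - i).+1%:R * Gc t i) *: (x (j + i)%N * E (n - i).+1).
  rewrite mulrC -scalerA -scaler_sumr -mulr_sumr; congr (_ *: _).
  by rewrite -recE.2 scalerAr.
have F2 p : \sum_(l < p.+1) f2 l (p - l)%N
    = (p.+1%:R * Gc t p.+1) *: (x (j + p.+1)%N * E (n - p)%N).
  rewrite Gc_rec // scaler_suml; apply: eq_bigr => l _.
  by rewrite /f2 subnKC ?leq_ord.
under [X in X + _]eq_bigr do rewrite F1.
under [X in _ + X]eq_bigr do rewrite F2.
rewrite [RHS]scaler_sumr [RHS]big_ord_recl [X in X + _ = _]big_ord_recl /= !subn0 scalerA -addrA.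
congr (_ + _); rewrite [X in _ + X]big_ord_recr [RHS]big_ord_recr /= addrA.
congr (_ + _); last by rewrite scalerA /bump /= add1n subSS.
rewrite -big_split /=; apply: eq_bigr => i _.
rewrite /bump !add1n scalerA /= subSS -[(n - i.+1).+1]subSn ?ltn_ord // subSS.
rewrite -scalerDl; congr (_ *: _); rewrite -mulrDl -natrD; congr (_%:R * _).
by have := ltn_ord i; lia.
Qed.

(** This is [exp_rec_cross] with the denominator 1 - t z cleared: from index 1 on, [Gc] is geometric
    with ratio t. *)
Lemma exp_rec_quad t x : t != 0 ->
  (forall j, K * x j = t *: (x j * K)) ->
  (forall l j, l.+1%:R *: (a l * x j - x j * a l)
               = (t ^+ l.+1 - t^-1 ^+ l.+1) *: x (j + l.+1)%N) ->
  forall n j, E n.+1 * x j - t *: (x j * E n.+1)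
              = t *: (E n * x j.+1) - x j.+1 * E n.
Proof.
move=> t0 hK ha n j.
rewrite !(exp_rec_cross t0 hK ha) big_ord_recl /= addn0 subn0 addrC addKr.
rewrite [in LHS]big_ord_recl /= /bump /= addn1 subSS subn0 scaler_sumr.
rewrite [in RHS]big_ord_recl /= addn0 subn0 scalerA addrAC; congr (_ + _).
  by rewrite expr0 scalerBl scale1r expr2 addn0.
apply: eq_bigr => i _; rewrite /bump /= !add0n !add1n subSS scalerA !addnS addSn.
by rewrite !exprS; congr (_ *: _); ring.
Qed.

Lemma exp_rec_twist c (y : A) : y * K = K * y ->
  (forall l, y * a l = c ^+ l.+1 *: (a l * y)) ->
  forall n, y * E n = c ^+ n *: (E n * y).
Proof.
move=> hK ha; elim/ltn_ind=> -[_|n IH]; first by rewrite recE.1 scale1r.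
apply: (@natr_inj n); rewrite scalerAr recE.2 mulr_sumr scalerA mulrC -scalerA.
rewrite (scalerAl _ (E _)) recE.2 mulr_suml scaler_sumr; apply: eq_bigr => l _.
rewrite -scalerAr mulrA ha -scalerAl -mulrA IH ?ltnS ?leq_subr //.
rewrite -scalerAr -scalerAl -mulrA !scalerA; congr (_ *: _).
rewrite mulrAC -mulrA -exprD mulrC; congr (_ ^+ _ * _).
by have := ltn_ord l; lia.
Qed.

Lemma exp_rec_comm (y : A) : y * K = K * y -> (forall l, y * a l = a l * y) ->
  forall n, y * E n = E n * y.
Proof.
move=> hK ha n; rewrite (@exp_rec_twist 1 y hK) ?expr1n ?scale1r // => l.
by rewrite expr1n scale1r.
Qed.

(** The commutator of y with the exponent is k z^(s+1), and k commutes with the exponent, so the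
    commutator with the exponential is k z^(s+1) times the exponential. *)
Lemma exp_rec_heis s (y k : A) : y * K = K * y -> (forall l, k * a l = a l * k) ->
  (forall l, y * a l - a l * y = if l == s then k else 0) ->
  forall n, y * E n - E n * y = if (s < n)%N then k * E (n - s.+1)%N else 0.
Proof.
move=> hK hk ha; elim/ltn_ind=> -[_|n IH]; first by rewrite recE.1 hK subrr.
apply: (@natr_inj n).
rewrite scalerBr scalerAr [_ *: (E _ * y)]scalerAl recE.2 mulr_sumr mulr_suml -sumrB.
transitivity (\sum_(l < n.+1) (l.+1%:R *: ((if l == s :> nat then k else 0) * E (n - l)%N)
   + l.+1%:R *: (a l * (if (s < n - l)%N then k * E (n - l - s.+1)%N else 0)))).
  apply: eq_bigr => l _; rewrite -ha -(IH (n - l)%N) ?ltnS ?leq_subr //.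
  rewrite -scalerDr -scalerAr -scalerAl -scalerBr; congr (_ *: _).
  by rewrite mulrBl mulrBr !mulrA addrA subrK.
rewrite ltnS big_split /=; case: leqP => sn; last first.
  rewrite scaler0 !big1 ?addr0 // => l _.
    rewrite ifF ?mulr0 ?scaler0 //; apply/negbTE; rewrite -leqNgt.
    by rewrite (leq_trans (leq_subr _ _)) // ltnW.
  rewrite ifF ?mul0r ?scaler0 //; apply/negbTE; have := ltn_ord l; lia.
rewrite (bigD1 (Ordinal (sn : (s < n.+1)%N))) //= eqxx big1 ?addr0; last first.
  by move=> l hl; rewrite ifF ?mul0r ?scaler0 //; apply/negbTE; move: hl; apply: contra => /eqP h; apply/eqP/val_inj.
have -> : \sum_(l < n.+1) l.+1%:R *: (a l * (if (s < n - l)%N then k * E (n - l - s.+1)%N else 0))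
  = (n - s)%:R *: (k * E (n - s)%N).
  case: (posnP (n - s)%N) => [e|sn'].
    rewrite e scale0r big1 // => l _; rewrite ifF ?mulr0 ?scaler0 //.
    by apply/negbTE; rewrite -leqNgt (leq_trans (leq_subr _ _)) // -subn_eq0 e.
  have e : (n - s)%N = (n - s.+1).+1 by lia.
  rewrite e scalerAr recE.2 mulr_sumr -e (big_ord_widen n.+1 (fun i => k * (i.+1%:R *: (a i * E (n - s.+1 - i)%N)))); last lia.
  rewrite [RHS]big_mkcond /=; apply: eq_bigr => l _.
  case: (ltnP s (n - l)%N) => h1; case: (ltnP l (n - s)%N) => h2; try lia.
    rewrite -scalerAr !mulrA hk; congr (_ *: (_ * E _)); lia.
  by rewrite mulr0 scaler0.
by rewrite -scalerDl subSS -natrD addSn subnKC.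
Qed.

Lemma exp_rec_in (S : {pred A}) : subalg_closed S ->
  K \in S -> (forall l, a l \in S) -> forall n, E n \in S.
Proof.
case=> S1 SL SM SK Sa; elim/ltn_ind=> -[_|n IH]; first by rewrite recE.1.
have S0 : 0 \in S by have := SL (-1) _ _ S1 S1; rewrite scaleN1r addNr.
have SZ c u : u \in S -> c *: u \in S by move=> /(SL c _ _)/(_ S0); rewrite addr0.
have SD u v : u \in S -> v \in S -> u + v \in S.
  by move=> hu hv; rewrite -[u]scale1r; apply: SL.
have -> : E n.+1 = n.+1%:R^-1 *: (n.+1%:R *: E n.+1) by rewrite scalerA mulVf ?scale1r.
rewrite recE.2; apply: (SZ); elim/big_ind: _ => // l _.
by apply: (SZ); apply: SM => //; apply: IH; rewrite ltnS leq_subr.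
Qed.

End Recursion.

(** The expression [exp_coef] over an arbitrary field; for [Cq] the two are identified by
    conversion. *)
Definition expc (a : nat -> A) (k : nat) : A :=
  \sum_(n < k.+1) (n`!%:R : F)^-1 *: ((('X * \poly_(l < k) a l) ^+ n)`_k).

Section ExpCoef.
Variable a : nat -> A.
Hypothesis aC : forall i j, a i * a j = a j * a i.

Local Notation P N := ('X * \poly_(l < N) a l).

Lemma coef_expP i N : (P N)`_i = if i is i'.+1 then (if (i' < N)%N then a i' else 0) else 0.
Proof. by rewrite coefXM; case: i => [|i] //=; rewrite coef_poly. Qed.

Lemma coef_expP_stable N N' n j : (j <= N)%N -> (j <= N')%N ->
  (P N ^+ n)`_j = (P N' ^+ n)`_j.
Proof.
elim: n j => [|n IH] j h h'; first by rewrite !expr0.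
rewrite !exprS !coefM; apply: eq_bigr => i _; have hi := ltn_ord i.
rewrite IH; try lia; congr (_ * _); rewrite !coef_expP; case: (i : nat) hi => // i' hi.
by rewrite !ifT //; lia.
Qed.

Lemma coef_expP_lt N n j : (j < n)%N -> (P N ^+ n)`_j = 0.
Proof.
move=> h; rewrite exprMn_comm; last exact/commr_sym/commr_polyX.
by rewrite coefXnM h.
Qed.

Lemma expc_wide N M k : (k <= N)%N -> (k <= M)%N ->
  expc a k = \sum_(n < M.+1) (n`!%:R : F)^-1 *: (P N ^+ n)`_k.
Proof.
move=> hN hM; rewrite /expc.
rewrite (big_ord_widen M.+1 (fun n => (n`!%:R : F)^-1 *: (P k ^+ n)`_k)) // big_mkcond /=.
apply: eq_bigr => n _; rewrite ltnS; case: leqP => hn.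
  by rewrite (coef_expP_stable n (leqnn k) hN).
by rewrite coef_expP_lt // scaler0.
Qed.

(** The power rule for the derivative requires the exponent to commute with its derivative; here the
    commutation of the a_i enters. *)
Lemma comm_expP N : (P N)^`() * P N = P N * (P N)^`().
Proof.
apply/polyP => k; rewrite coefM coefMr; apply: eq_bigr => i _.
rewrite !coef_deriv !coef_expP.
case: (k - i)%N => [|j]; first by rewrite mulr0 mul0r.
by do 2!case: ifP => _; rewrite ?mul0rn ?mul0r ?mulr0 // mulrnAl mulrnAr aC.
Qed.

Lemma deriv_expP N n : (P N ^+ n.+1)^`() = (P N)^`() * P N ^+ n *+ n.+1.
Proof.
have C m : P N ^+ m * (P N)^`() = (P N)^`() * P N ^+ m.
  by apply/esym/commrX/comm_expP.
elim: n => [|n IH]; first by rewrite expr1 expr0 mulr1.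
rewrite exprS derivM IH mulrnAr mulrA -comm_expP -mulrA -exprS.
by rewrite [RHS]mulrS.
Qed.

(** Termwise differentiation: the term of order n + 1 in the exponential has derivative P' times the
    term of order n. *)
Lemma expc_rec k :
  k.+1%:R *: expc a k.+1 = \sum_(l < k.+1) l.+1%:R *: (a l * expc a (k - l)).
Proof.
rewrite (expc_wide (leqnn k.+1) (leqnn k.+1)) big_ord_recl expr0 coef1 scaler0 add0r.
rewrite scaler_sumr.
transitivity (\sum_(n < k.+1) \sum_(i < k.+1) (n`!%:R : F)^-1 *:
   (i.+1%:R *: (a i * (P k.+1 ^+ n)`_(k - i)))).
  apply: eq_bigr => n _; rewrite lift0 scalerA mulrC -scalerA.
  rewrite scaler_nat -coef_deriv deriv_expP coefMn -scaler_nat scalerA factS natrM.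
  rewrite invfM mulrAC mulVf // mul1r -scaler_sumr; congr (_ *: _).
  rewrite coefM; apply: eq_bigr => i _.
  by rewrite coef_deriv coef_expP ifT // scalerAl scaler_nat.
rewrite exchange_big; apply: eq_bigr => i _ /=.
rewrite (@expc_wide k.+1 k); try lia.
rewrite mulr_sumr scaler_sumr; apply: eq_bigr => n _.
by rewrite -scalerAr !scalerA mulrC.
Qed.

Lemma expc0 : expc a 0 = 1.
Proof. by rewrite /expc big_ord1 fact0 invr1 scale1r expr0 coef1. Qed.

Lemma exp_rec_expc K : (forall l, K * a l = a l * K) ->
  exp_rec K a (fun n => K * expc a n).
Proof.
move=> hK; split=> [|n]; first by rewrite expc0 mulr1.
rewrite scalerAr expc_rec mulr_sumr; apply: eq_bigr => l _.
by rewrite -scalerAr !mulrA hK.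
Qed.
End ExpCoef.
End Currents.

Lemma expc_morph (F : fieldType) (A B : algType F) (g : {lrmorphism A -> B})
  (a : nat -> A) k : g (expc a k) = expc (g \o a) k.
Proof.
rewrite /expc raddf_sum; apply: eq_bigr => n _ /=; rewrite linearZ /= -coef_map rmorphXn rmorphM /=.
rewrite map_polyX; congr (_ *: (('X * _) ^+ _)`_ _).
apply/polyP => i; rewrite coef_map !coef_poly /=.
by case: ifP => _ //; rewrite raddf0.
Qed.

(** * The algebra of linear endomorphisms of a nonzero space *)

Section Endomorphisms.
Variables (F : fieldType) (V : lmodType F) (v0 : V).
Hypothesis v0_neq0 : v0 != 0.

Definition is_endo : {pred V -> V} := [pred f | `[< linear f >]].

Lemma is_endo_submod : submod_closed is_endo.
Proof.
split=> [|c f1 f2 /asboolP h1 /asboolP h2].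
  apply/asboolP => a x y; have e (z : V) : (0 : V -> V) z = 0 by [].
  by rewrite !e scaler0 addr0.
apply/asboolP => a x y; have e (z : V) : (c *: f1 + f2) z = c *: f1 z + f2 z by [].
by rewrite !e h1 h2 !scalerDr !scalerA mulrC addrACA.
Qed.
HB.instance Definition _ :=
  GRing.isSubmodClosed.Build F (V -> V) is_endo (GRing.submod_closed_semi is_endo_submod).

(** The nonzero vector is a phantom argument: it provides 1 != 0 for the ring structure. *)
Definition endo : Type := let _ := v0_neq0 in {f : V -> V | f \in is_endo}.
HB.instance Definition _ := [isSub of endo for @sval (V -> V) _].
HB.instance Definition _ := [Choice of endo by <:].
HB.instance Definition _ := [SubChoice_isSubLmodule of endo by <:].

Definition mk_endo (f : V -> V) (hf : linear f) : endo :=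
  exist _ f (asboolT hf).
Definition endo_fun (e : endo) : V -> V := val e.
Coercion endo_fun : endo >-> Funclass.

Lemma endo_linear (e : endo) : linear e.
Proof. exact: (asboolW (valP e)). Qed.
HB.instance Definition _ (e : endo) :=
  GRing.isLinear.Build F V V *:%R (endo_fun e) (endo_linear e).

Lemma endoP (e e' : endo) : (forall v, e v = e' v) -> e = e'.
Proof. by move=> h; apply/val_inj/funext. Qed.

Fact endo1_subproof : linear (@id V). Proof. by []. Qed.
Definition endo1 := mk_endo endo1_subproof.
Fact endoM_subproof (e e' : endo) : linear (e \o e').
Proof. by move=> c x y; rewrite /= !linearP. Qed.
Definition endoM e e' := mk_endo (endoM_subproof e e').

Fact endoA : associative endoM. Proof. by move=> *; apply: endoP. Qed.
Fact endo1M : left_id endo1 endoM. Proof. by move=> *; apply: endoP. Qed.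
Fact endoM1 : right_id endo1 endoM. Proof. by move=> *; apply: endoP. Qed.
Fact endoMDl : left_distributive endoM +%R. Proof. by move=> *; apply: endoP. Qed.
Fact endoMDr : right_distributive endoM +%R.
Proof. by move=> e e1 e2; apply: endoP => v; exact: (linearD (endo_fun e)). Qed.
Fact endo1_neq0 : endo1 != 0.
Proof. by apply: contra v0_neq0 => /eqP h; rewrite -[v0]/(endo1 v0) h. Qed.
HB.instance Definition _ :=
  GRing.Zmodule_isNzRing.Build endo endoA endo1M endoM1 endoMDl endoMDr endo1_neq0.
Fact endo_scaleAl c (e e' : endo) : c *: (e * e') = (c *: e) * e'.
Proof. exact: endoP. Qed.
HB.instance Definition _ := GRing.Lmodule_isLalgebra.Build F endo endo_scaleAl.
Fact endo_scaleAr c (e e' : endo) : c *: (e * e') = e * (c *: e').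
Proof. by apply: endoP => v; apply/esym; exact: (linearZ_LR (endo_fun e)). Qed.
HB.instance Definition _ := GRing.Lalgebra_isAlgebra.Build F endo endo_scaleAr.

Lemma endoBE (e e' : endo) v : endo_fun (e - e') v = e v - e' v. Proof. by []. Qed.
Lemma endo_sumE n (e : 'I_n -> endo) v : endo_fun (\sum_i e i) v = \sum_i e i v.
Proof. by apply: (big_morph (fun e' : endo => endo_fun e' v)). Qed.

End Endomorphisms.

(** * Commutators twisted by a scalar *)

Section QCommutator.
Variables (F : fieldType) (A : algType F).
Implicit Types (a b x : A) (c t k al be : F).

Definition qbr c a b : A := a * b - c *: (b * a).

Lemma qbrDl c a a' b : qbr c (a + a') b = qbr c a b + qbr c a' b.
Proof. by rewrite /qbr mulrDl mulrDr scalerDr opprD addrACA. Qed.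
Lemma qbrDr c a b b' : qbr c a (b + b') = qbr c a b + qbr c a b'.
Proof. by rewrite /qbr mulrDl mulrDr scalerDr opprD addrACA. Qed.
Lemma qbrZl c k a b : qbr c (k *: a) b = k *: qbr c a b.
Proof. by rewrite /qbr -scalerAl -scalerAr scalerBr !scalerA mulrC. Qed.
Lemma qbrZr c k a b : qbr c a (k *: b) = k *: qbr c a b.
Proof. by rewrite /qbr -scalerAl -scalerAr scalerBr !scalerA mulrC. Qed.
Lemma qbrNl c a b : qbr c (- a) b = - qbr c a b.
Proof. by rewrite -scaleN1r qbrZl scaleN1r. Qed.
Lemma qbrNr c a b : qbr c a (- b) = - qbr c a b.
Proof. by rewrite -scaleN1r qbrZr scaleN1r. Qed.
Lemma qbr0l c b : qbr c 0 b = 0.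
Proof. by rewrite /qbr mul0r mulr0 scaler0 subrr. Qed.
Lemma qbr0r c a : qbr c a 0 = 0.
Proof. by rewrite /qbr mul0r mulr0 scaler0 subrr. Qed.
Lemma qbr_swap t a b : t != 0 -> qbr t^-1 a b = - t^-1 *: qbr t b a.
Proof.
by move=> t0; rewrite /qbr scalerBr scalerA mulNr mulVf // scaleN1r opprK addrC scaleNr.
Qed.
Lemma qbr_eq0 c a b : (qbr c a b = 0) <-> a * b = c *: (b * a).
Proof. by rewrite /qbr; split=> [/eqP|->]; rewrite ?subrr // subr_eq0 => /eqP. Qed.

(** A Leibniz rule for operators a, b that pass s up to scalars and remainders a', b'. It transports
    a quadratic relation past s and isolates the corrections. *)
Lemma qbr_leibR s al be a a' b b' c :
  a * s = al *: (s * a) + a' -> b * s = be *: (s * b) + b' ->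
  qbr c a b * s = (al * be) *: (s * qbr c a b)
    + ((be *: (a' * b) - c *: (b * a')) + (a * b' - (c * al) *: (b' * a))).
Proof.
move=> ha hb; rewrite /qbr mulrBl -scalerAl -!mulrA ha hb !mulrDr -!scalerAr !mulrA ha hb.
rewrite !mulrDl mulrN -!scalerAl -!scalerAr -!mulrA.
by lmod F A.
Qed.
End QCommutator.

(** * Crossing relations for currents indexed by the integers *)

Section IntegerIndexedCurrents.
Variables (F : fieldType) (A : algType F).
Hypothesis char0 : forall n, (n.+1%:R : F) != 0.
Variables (K : A) (a E : nat -> A) (t u : F) (x : int -> A).
Hypotheses (recE : exp_rec K a E) (t_neq0 : t != 0) (u_neq0 : u != 0).
Hypothesis Kx : forall p, K * x p = t *: (x p * K).

Section Up.
Hypothesis ax : forall (l : nat) p, l.+1%:R *: (a l * x p - x p * a l)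
  = ((t ^+ l.+1 - t^-1 ^+ l.+1) * u ^+ l.+1) *: x (p + l.+1%:Z).

(** A half-line of indices starting at p. The factor u^j absorbs the powers of u, later powers of
    gamma^(1/2), so that the lemmas with natural indices apply. *)
Let ray p j := u ^+ j *: x (p + j%:Z).
Let rayK p j : K * ray p j = t *: (ray p j * K).
Proof. by rewrite /ray -scalerAr Kx -scalerAl !scalerA mulrC. Qed.
Let ray_a p l j : l.+1%:R *: (a l * ray p j - ray p j * a l)
  = (t ^+ l.+1 - t^-1 ^+ l.+1) *: ray p (j + l.+1)%N.
Proof.
transitivity (u ^+ j *: (l.+1%:R *: (a l * x (p + j%:Z) - x (p + j%:Z) * a l))).
  by rewrite /ray -scalerAr -scalerAl; lmod F A.
by rewrite ax /ray PoszD addrA exprD; lmod F A.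
Qed.

Lemma current_quad_up n p :
  qbr t (E n.+1) (x p) + u *: qbr t (x (p + 1)) (E n) = 0.
Proof.
have := exp_rec_quad char0 recE t_neq0 (rayK p) (ray_a p) n 0.
rewrite /ray expr0 expr1 scale1r addr0 -/(qbr t _ _) => ->.
by rewrite /qbr -scalerAl -scalerAr; lmod F A.
Qed.
End Up.

Section Down.
Hypothesis ax : forall (l : nat) p, l.+1%:R *: (a l * x p - x p * a l)
  = ((t ^+ l.+1 - t^-1 ^+ l.+1) * u ^+ l.+1) *: x (p - l.+1%:Z).

Let ray p j := u ^+ j *: x (p - j%:Z).
Let rayK p j : K * ray p j = t *: (ray p j * K).
Proof. by rewrite /ray -scalerAr Kx -scalerAl !scalerA mulrC. Qed.
Let ray_a p l j : l.+1%:R *: (a l * ray p j - ray p j * a l)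
  = (t ^+ l.+1 - t^-1 ^+ l.+1) *: ray p (j + l.+1)%N.
Proof.
transitivity (u ^+ j *: (l.+1%:R *: (a l * x (p - j%:Z) - x (p - j%:Z) * a l))).
  by rewrite /ray -scalerAr -scalerAl; lmod F A.
by rewrite ax /ray PoszD opprD addrA exprD; lmod F A.
Qed.

Lemma current_cross_down n p :
  E n * x p = \sum_(i < n.+1) (Gc t i * u ^+ i) *: (x (p - i%:Z) * E (n - i)%N).
Proof.
have := exp_rec_cross char0 recE t_neq0 (rayK p) (ray_a p) n 0.
rewrite /ray expr0 scale1r subr0 => ->; apply: eq_bigr => i _.
by rewrite add0n -scalerAl scalerA.
Qed.

Lemma current_quad_down n p :
  qbr t (E n.+1) (x p) + u *: qbr t (x (p - 1)) (E n) = 0.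
Proof.
have := exp_rec_quad char0 recE t_neq0 (rayK p) (ray_a p) n 0.
rewrite /ray expr0 expr1 scale1r subr0 -/(qbr t _ _) => ->.
by rewrite /qbr -scalerAl -scalerAr; lmod F A.
Qed.
End Down.
End IntegerIndexedCurrents.

(** * The coinduced module *)

Lemma linear_scalable (F : fieldType) (V W : lmodType F) (f : V -> W) :
  linear f -> forall c x, f (c *: x) = c *: f x.
Proof.
move=> hf c x; have f0 : f 0 = 0.
  by have := hf (-1) 0 0; rewrite scaler0 addr0 scaleN1r addNr.
by have := hf c x 0; rewrite f0 !addr0.
Qed.

Section CoinducedModule.
Variables (F : fieldType) (M : lmodType F) (m0 : M).
Hypothesis char0 : forall n, (n.+1%:R : F) != 0.
Hypothesis m0_neq0 : m0 != 0.
Variables (q g kap : F).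
Hypotheses (q_neq0 : q != 0) (g_neq0 : g != 0) (kap_neq0 : kap != 0).
Local Notation qq := (q - q^-1).
Hypothesis qq_neq0 : qq != 0.
Variables (h : int -> M -> M) (d dV : M -> M).
Hypotheses (h_lin : forall s, linear (h s)) (d_lin : linear d) (dV_lin : linear dV).

Definition qi (m : int) : F := (q ^ m - q ^ (- m)) / qq.
Definition kc (k : int) : F :=
  qi (2 * k) / k%:~R / qq * (g ^ (2 * k) - g ^ (- (2 * k))).
Hypothesis hhM : forall (k l : int) m, k != 0 -> l != 0 ->
  h k (h l m) - h l (h k m) = (if k == - l then kc k else 0) *: m.
Hypothesis dhM : forall (s : int) m, s != 0 -> d (h s m) = q ^ s *: h s (d m).
Hypotheses (dVK : cancel d dV) (dK : cancel dV d).

(* [x^+_k] acts on [fock] by the shift [Sh k]; the other generators are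
   determined by their values on the empty word and by their commutation with
   the shifts, hence the recursions on words below. *)
Definition fock : Type := seq int -> M.
HB.instance Definition _ := GRing.Lmodule.on fock.
Implicit Types (f : fock) (L : seq int).

Fact fock0_neq0 : (fun _ => m0 : M) != (0 : fock).
Proof.
by apply: contra m0_neq0 => /eqP e; rewrite -[m0]/((fun _ : seq int => m0) [::]) e.
Qed.
Local Notation E := (endo fock0_neq0).

Definition fock_shift k f : fock := fun L => f (k :: L).
(** [cplus] and, up to sign, [cminus] are the structure constants of [h_s, x^+_k] and [h_s, x^-_l]
    once gamma^(1/2) is the scalar g. *)
Definition cplus s : F := qi (2 * s) / s%:~R * g ^ (- `|s|).
Definition cminus s : F := qi (2 * s) / s%:~R * g ^ `|s|.
Fixpoint fock_h s L f : M :=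
  if L is k :: L' then fock_h s L' (fock_shift k f) - cplus s *: f (k + s :: L')
  else h s (f [::]).
Definition fock_K f : fock := fun L => ((q ^ (-2)) ^+ size L * kap) *: f L.
Definition fock_KV f : fock := fun L => ((q ^ 2) ^+ size L * kap^-1) *: f L.
Definition fock_D f : fock := fun L => q ^ (- \sum_(k <- L) k) *: d (f L).
Definition fock_DV f : fock := fun L => q ^ (\sum_(k <- L) k) *: dV (f L).

Fact fock_shift_lin k : linear (fock_shift k). Proof. by []. Qed.
Definition Sh k : E := mk_endo fock0_neq0 (@fock_shift_lin k).
Fact fock_h_lin s : linear (fun f => (fun L => fock_h s L f) : fock).
Proof.
move=> c f1 f2; apply/funext => L; rewrite -[RHS]/(c *: fock_h s L f1 + fock_h s L f2).
elim: L f1 f2 => [|k L IH] f1 f2 /=; first exact: h_lin.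
have -> : fock_shift k (c *: f1 + f2) = c *: fock_shift k f1 + fock_shift k f2 by [].
rewrite IH.
have -> : (c *: f1 + f2) (k + s :: L) = c *: f1 (k + s :: L) + f2 (k + s :: L) by [].
set u := fock_h s L _; set v := fock_h s L _; set w := f1 _; set z := f2 _.
by lmod F M.
Qed.
Definition Hh s : E := mk_endo fock0_neq0 (@fock_h_lin s).
Fact fock_K_lin : linear fock_K.
Proof.
move=> c f1 f2; apply/funext => L.
transitivity (c *: fock_K f1 L + fock_K f2 L) => //; rewrite /fock_K.
have -> : (c *: f1 + f2) L = c *: f1 L + f2 L by [].
by rewrite scalerDr !scalerA mulrC.
Qed.
Definition Kk : E := mk_endo fock0_neq0 fock_K_lin.
Fact fock_KV_lin : linear fock_KV.
Proof.
move=> c f1 f2; apply/funext => L.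
transitivity (c *: fock_KV f1 L + fock_KV f2 L) => //; rewrite /fock_KV.
have -> : (c *: f1 + f2) L = c *: f1 L + f2 L by [].
by rewrite scalerDr !scalerA mulrC.
Qed.
Definition KkV : E := mk_endo fock0_neq0 fock_KV_lin.
Fact fock_D_lin : linear fock_D.
Proof.
move=> c f1 f2; apply/funext => L.
transitivity (c *: fock_D f1 L + fock_D f2 L) => //; rewrite /fock_D.
have -> : (c *: f1 + f2) L = c *: f1 L + f2 L by [].
by rewrite d_lin scalerDr !scalerA mulrC.
Qed.
Definition Dd : E := mk_endo fock0_neq0 fock_D_lin.
Fact fock_DV_lin : linear fock_DV.
Proof.
move=> c f1 f2; apply/funext => L.
transitivity (c *: fock_DV f1 L + fock_DV f2 L) => //; rewrite /fock_DV.
have -> : (c *: f1 + f2) L = c *: f1 L + f2 L by [].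
by rewrite dV_lin scalerDr !scalerA mulrC.
Qed.
Definition DdV : E := mk_endo fock0_neq0 fock_DV_lin.

Definition aplus l : E := qq *: Hh (Posz l.+1).
Definition aminus l : E := - qq *: Hh (Negz l).
Definition Psi (k : int) : E := if k is Posz n then Kk * expc aplus n else 0.
Definition Phi (k : int) : E := if - k is Posz n then KkV * expc aminus n else 0.
Fact Ax_key : unit. Proof. exact: tt. Qed.
(** The value that [x^+_k, x^-_l] has to take. The lock keeps the exponentials inside from being
    unfolded when operators are compared. *)
Definition Ax k l : E := locked_with Ax_key
  (qq^-1 *: (g ^ (k - l) *: Psi (k + l) - g ^ (l - k) *: Phi (k + l))).
Lemma AxE k l :
  Ax k l = qq^-1 *: (g ^ (k - l) *: Psi (k + l) - g ^ (l - k) *: Phi (k + l)).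
Proof. by rewrite /Ax unlock. Qed.

(** The value 0 on the empty word says that the x^-_l act by zero on the M from which the module is
    coinduced, opposite to the induced module, where the x^+_k annihilate M. *)
Fixpoint fock_x l L f : M :=
  if L is k :: L' then fock_x l L' (fock_shift k f) + endo_fun (Ax k l) f L' else 0.
Fact fock_x_lin l : linear (fun f => (fun L => fock_x l L f) : fock).
Proof.
move=> c f1 f2; apply/funext => L; rewrite -[RHS]/(c *: fock_x l L f1 + fock_x l L f2).
elim: L f1 f2 => [|k L IH] f1 f2 /=; first by rewrite scaler0 addr0.
have -> : fock_shift k (c *: f1 + f2) = c *: fock_shift k f1 + fock_shift k f2 by [].
rewrite IH linearP.
have -> (u v : fock) : (c *: u + v) L = c *: u L + v L by [].
by rewrite scalerDr addrACA.
Qed.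
Definition Xm l : E := mk_endo fock0_neq0 (@fock_x_lin l).

Lemma endo_fockP (T T' : E) : (forall f L, endo_fun T f L = endo_fun T' f L) -> T = T'.
Proof. by move=> hT; apply: endoP => f; apply/funext. Qed.

Lemma Sh_K k : Sh k * Kk = q ^ (-2) *: (Kk * Sh k).
Proof.
apply: endo_fockP => f L /=.
rewrite -[LHS]/(fock_K f (k :: L)) -[RHS]/(q ^ (-2) *: fock_K (fock_shift k f) L) /fock_K /=.
by rewrite exprS scalerA mulrA.
Qed.
Lemma Sh_KV k : Sh k * KkV = q ^ 2 *: (KkV * Sh k).
Proof.
apply: endo_fockP => f L /=.
rewrite -[LHS]/(fock_KV f (k :: L)) -[RHS]/(q ^ 2 *: fock_KV (fock_shift k f) L) /fock_KV /=.
by rewrite exprS scalerA mulrA.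
Qed.
Lemma Sh_D k : Sh k * Dd = q ^ (- k) *: (Dd * Sh k).
Proof.
apply: endo_fockP => f L /=.
rewrite -[LHS]/(fock_D f (k :: L)) -[RHS]/(q ^ (- k) *: fock_D (fock_shift k f) L) /fock_D /=.
by rewrite big_cons opprD scalerA expfzDr.
Qed.
Lemma Sh_DV k : Sh k * DdV = q ^ k *: (DdV * Sh k).
Proof.
apply: endo_fockP => f L /=.
rewrite -[LHS]/(fock_DV f (k :: L)) -[RHS]/(q ^ k *: fock_DV (fock_shift k f) L) /fock_DV /=.
by rewrite big_cons scalerA expfzDr.
Qed.
Lemma Sh_H k s : Sh k * Hh s = Hh s * Sh k - cplus s *: Sh (k + s).
Proof. exact: endo_fockP. Qed.
Lemma Sh_X k l : Sh k * Xm l = Xm l * Sh k + Ax k l.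
Proof. exact: endo_fockP. Qed.

Lemma Sh_KA k T : Sh k * (Kk * T) = q ^ (-2) *: (Kk * (Sh k * T)).
Proof. by rewrite mulrA Sh_K -scalerAl -mulrA. Qed.
Lemma Sh_DA k T : Sh k * (Dd * T) = q ^ (- k) *: (Dd * (Sh k * T)).
Proof. by rewrite mulrA Sh_D -scalerAl -mulrA. Qed.
Lemma Sh_HA k s T : Sh k * (Hh s * T) = Hh s * (Sh k * T) - cplus s *: (Sh (k + s) * T).
Proof. by rewrite mulrA Sh_H mulrBl -scalerAl -mulrA. Qed.
Lemma Sh_XA k l T : Sh k * (Xm l * T) = Xm l * (Sh k * T) + Ax k l * T.
Proof. by rewrite mulrA Sh_X mulrDl -mulrA. Qed.
Definition expandE := (@mulrBl E, @mulrBr E, @mulrDl E, @mulrDr E, @mulNr E, @mulrN E,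
  =^~ @scalerAl F E, =^~ @scalerAr F E, =^~ @mulrA E).
Definition pushE := (expandE, Sh_HA, Sh_H, Sh_KA, Sh_K, Sh_DA, Sh_D, Sh_XA, Sh_X).

(* An operator that vanishes on the empty word and skew-commutes with the
   shifts is zero; every relation among the operators is checked this way. *)
Lemma endo_fock0 (T : E) : (forall f, endo_fun T f [::] = 0) ->
  (forall k, exists c, Sh k * T = c *: (T * Sh k)) -> T = 0.
Proof.
move=> T0 TS; apply: endo_fockP => f L; rewrite -[RHS]/(0 : M).
elim: L f => [|k L IH] f; first exact: T0.
have [c e] := TS k.
rewrite -[LHS]/(endo_fun (Sh k * T) f L) e -[LHS]/(c *: endo_fun T (fock_shift k f) L).
by rewrite IH scaler0.
Qed.

Lemma KkVK : KkV * Kk = 1.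
Proof.
apply: endo_fockP => f L; rewrite -[LHS]/(_ *: (_ *: f L)) -[RHS]/(f L) scalerA.
rewrite mulrACA mulVf // mulr1 -exprMn -expfzDr //= expr1n scale1r //.
Qed.
Lemma KkKV : Kk * KkV = 1.
Proof.
apply: endo_fockP => f L; rewrite -[LHS]/(_ *: (_ *: f L)) -[RHS]/(f L) scalerA.
rewrite mulrACA mulfV // mulr1 -exprMn -expfzDr //= expr1n scale1r //.
Qed.
Lemma DdVK : DdV * Dd = 1.
Proof.
have dVZ := linear_scalable dV_lin.
apply: endo_fockP => f L; rewrite -[LHS]/(_ *: dV (_ *: d (f L))) -[RHS]/(f L).
by rewrite dVZ dVK scalerA -expfzDr // subrr scale1r.
Qed.
Lemma DdKV : Dd * DdV = 1.
Proof.
have dZ := linear_scalable d_lin.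
apply: endo_fockP => f L; rewrite -[LHS]/(_ *: d (_ *: dV (f L))) -[RHS]/(f L).
by rewrite dZ dK scalerA -expfzDr // addNr scale1r.
Qed.

Lemma HhC k l : k != 0 -> l != 0 ->
  Hh k * Hh l - Hh l * Hh k = (if k == - l then kc k else 0) *: 1.
Proof.
move=> k0 l0; set c := (if _ then _ else _).
apply/eqP; rewrite -subr_eq0; apply/eqP/endo_fock0 => [f|p].
  have := hhM (f [::]) k0 l0; rewrite -/c => e.
  by rewrite -[LHS]/(h k (h l (f [::])) - h l (h k (f [::])) - c *: f [::]) e subrr.
exists 1; rewrite scale1r !pushE mulr1 mul1r (_ : p + l + k = p + k + l); last by ring.
by lmod F E.
Qed.

Lemma KkC s : Kk * Hh s = Hh s * Kk.
Proof.
apply/eqP; rewrite -subr_eq0; apply/eqP/endo_fock0 => [f|p].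
  have hZ := linear_scalable (h_lin s).
  by rewrite -[LHS]/(_ *: h s (f [::]) - h s (_ *: f [::])) hZ subrr.
exists (q ^ (-2)); rewrite !pushE.
by lmod F E.
Qed.

Lemma DdH s : s != 0 -> Dd * Hh s = q ^ s *: (Hh s * Dd).
Proof.
move=> s0; apply/eqP; rewrite -subr_eq0; apply/eqP/endo_fock0 => [f|p].
  have hZ := linear_scalable (h_lin s).
  rewrite -[LHS]/(q ^ (- \sum_(k <- [::]) k) *: d (h s (f [::]))
     - q ^ s *: h s (q ^ (- \sum_(k <- [::]) k) *: d (f [::]))) hZ dhM //.
  by rewrite big_nil oppr0 expr0z !scale1r subrr.
exists (q ^ (- p)); rewrite !pushE [- (p + s)]opprD expfzDr //.
have -> : q ^ (- s) = (q ^ s)^-1 by rewrite invr_expz.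
have : q ^ s != 0 by rewrite expfz_neq0.
by move=> ?; lmod_eq F E; field.
Qed.

Lemma DdK : Dd * Kk = Kk * Dd.
Proof.
have dZ := linear_scalable d_lin.
apply: endo_fockP => f L; rewrite -[LHS]/(_ *: d (_ *: f L)) -[RHS]/(_ *: (_ *: d (f L))).
by rewrite dZ !scalerA mulrC.
Qed.

Lemma Phi_opp n : Phi (- Posz n) = KkV * expc aminus n.
Proof. by rewrite /Phi opprK. Qed.
Lemma Phi_gt0 n : (0 < n)%R -> Phi n = 0.
Proof. by case: n => // -[|n] //. Qed.
Lemma Psi_lt0 n : (n < 0)%R -> Psi n = 0.
Proof. by case: n. Qed.

Lemma KkVC s : KkV * Hh s = Hh s * KkV.
Proof.
by rewrite -[LHS]mulr1 -KkKV -mulrA [Hh s * _]mulrA -KkC !mulrA KkVK mul1r.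
Qed.

Let HCl0 k l c : k != - l -> k != 0 -> l != 0 ->
  (c *: Hh k) * (c *: Hh l) = (c *: Hh l) * (c *: Hh k).
Proof.
move=> hkl k0 l0; rewrite -!scalerAl -!scalerAr; congr (_ *: (_ *: _)).
by apply/eqP; rewrite -subr_eq0 HhC // (negbTE hkl) scale0r.
Qed.

Lemma recPsi : exp_rec Kk aplus (fun n => Psi (Posz n)).
Proof.
apply: (exp_rec_expc char0) => [i j|l]; first exact: HCl0.
by rewrite /aplus -scalerAr KkC scalerAl.
Qed.
Lemma recPhi : exp_rec KkV aminus (fun n => Phi (- Posz n)).
Proof.
have := @exp_rec_expc _ _ char0 aminus _ KkV.
case=> [i j|l|e1 e2]; first exact: HCl0.
  by rewrite /aminus -scalerAr KkVC scalerAl.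
by split=> [|n]; rewrite !Phi_opp ?e1 // e2; apply: eq_bigr => l _; rewrite Phi_opp.
Qed.

(** Only [aplus l] with l + 1 = - s fails to commute with h_s, and it exists only for s < 0;
    [exp_rec_heis] turns this into a shift of the index. *)
Lemma HhPsi s n : s != 0 ->
  Hh s * Psi n - Psi n * Hh s = (if (s < 0)%R then qq * kc s else 0) *: Psi (n + s).
Proof.
case: n => n; last first.
  rewrite mulr0 mul0r subrr; case: ifP => hs; last by rewrite scale0r.
  by rewrite Psi_lt0 ?scaler0 //; lia.
case: s => m s0.
  rewrite ltNge /= scale0r (exp_rec_comm char0 recPsi) ?subrr // => [|l]; first exact: esym (KkC _).
  have := HhC (k := Posz m) (l := Posz l.+1) s0 isT.
  case: eqP => [|_]; first by lia.
  by rewrite scale0r /aplus -scalerAr -scalerAl => /eqP; rewrite subr_eq0 => /eqP ->.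
rewrite (exp_rec_heis char0 recPsi (s := m) (k := (qq * kc (Negz m))%:A)) ; last first.
- move=> l; have := HhC (k := Negz m) (l := Posz l.+1) s0 isT.
  rewrite /aplus -scalerAr -scalerAl -scalerBr => ->.
  have -> : (Negz m == - l.+1%:Z) = (l == m) by lia.
  by case: eqP => _; rewrite scalerA ?mulr0 ?scale0r.
- by move=> l; rewrite mulr_algl mulr_algr.
- exact: esym (KkC _).
rewrite (_ : (Negz m < 0)%R = true) //; case: ltnP => hmn; last by rewrite Psi_lt0 ?scaler0 //; lia.
rewrite mulr_algl; congr (_ *: Psi _); lia.
Qed.

Lemma HhPhi s n : s != 0 ->
  Hh s * Phi n - Phi n * Hh s = (if (0 < s)%R then - (qq * kc s) else 0) *: Phi (n + s).
Proof.
move=> s0; have [n0|n0] := ltP 0 n.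
  rewrite Phi_gt0 // mulr0 mul0r subrr; case: ifP => hs; last by rewrite scale0r.
  by rewrite Phi_gt0 ?scaler0 //; lia.
have {n0} [{}n ->] : exists p, n = - Posz p by exists `|n|%N; lia.
case: s s0 => m s0; last first.
  rewrite ltNge /= scale0r (exp_rec_comm char0 recPhi) ?subrr // => [|l]; first exact: esym (KkVC _).
  have := HhC (k := Negz m) (l := Negz l) s0 isT.
  case: eqP => [|_]; first by lia.
  by rewrite scale0r /aminus -scalerAr -scalerAl => /eqP; rewrite subr_eq0 => /eqP ->.
case: m s0 => // m s0.
rewrite (exp_rec_heis char0 recPhi (s := m) (k := (- qq * kc m.+1)%:A)) ; last first.
- move=> l; have := HhC (k := Posz m.+1) (l := Negz l) s0 isT.
  rewrite /aminus -scalerAr -scalerAl -scalerBr => ->.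
  have -> : (m.+1%:Z == - Negz l) = (l == m) by lia.
  by case: eqP => _; rewrite scalerA ?mulr0 ?scale0r.
- by move=> l; rewrite mulr_algl mulr_algr.
- exact: esym (KkVC _).
rewrite (_ : (0 < Posz m.+1)%R = true) //; case: ltnP => hmn; last by rewrite Phi_gt0 ?scaler0 //; lia.
rewrite mulr_algl mulNr; congr (_ *: Phi _); lia.
Qed.

(** The Jacobi identity for h_s, x^+_k and x^-_l, verified on the explicit formula, since the
    commutation of h_s with x^-_l will be deduced from it. For either sign of s only one of the two
    currents fails to commute with h_s; the contributions of the other cancel on the right. *)
Lemma HhA s k l : s != 0 -> Hh s * Ax k l - Ax k l * Hh s
  = cplus s *: Ax (k + s) l - cminus s *: Ax k (l + s).
Proof.
move=> s0; rewrite !AxE -scalerAl -scalerAr -scalerBr mulrBr mulrBl -!scalerAl -!scalerAr.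
have -> : k + s + l = k + l + s by ring.
have -> : k + (l + s) = k + l + s by ring.
have e1 := HhPsi (k + l) s0; have e2 := HhPhi (k + l) s0.
move: (k + l) e1 e2 => n e1 e2.
transitivity (qq^-1 *: (g ^ (k - l) *: (Hh s * Psi n - Psi n * Hh s)
     - g ^ (l - k) *: (Hh s * Phi n - Phi n * Hh s))).
  by lmod F E.
rewrite e1 e2 /cplus /cminus /kc.
have -> : k + s - l = (k - l) + s by ring.
have -> : k - (l + s) = (k - l) - s by ring.
have -> : l - (k + s) = (l - k) - s by ring.
have -> : l + s - k = (l - k) + s by ring.
have -> : 2 * s = s + s by ring.
have s1 : (s%:~R : F) != 0.
  by case: s s0 {e1 e2} => [[|m]|m] // _; rewrite ?NegzE ?mulrNz ?oppr_eq0 char0.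
have gs : g ^ s != 0 by rewrite expfz_neq0.
have h1 : g ^ (- s) = (g ^ s)^-1 by rewrite invr_expz.
rewrite !opprD !expfzDr // h1.
case: (ltgtP s 0) s0 => // hs _.
  rewrite (_ : `|s| = - s) ?opprK ?h1; last by rewrite ltr0_norm.
  move: (qi (s + s)) qq_neq0 => Y; move: qq => Q Q0.
  by lmod_eq F E; field; rewrite ?gs ?s1 ?Q0.
rewrite (_ : `|s| = s) ?h1; last by rewrite gtr0_norm.
move: (qi (s + s)) qq_neq0 => Y; move: qq => Q Q0.
by lmod_eq F E; field; rewrite ?gs ?s1 ?Q0.
Qed.

Lemma KkPsi n : Kk * Psi n = Psi n * Kk.
Proof.
case: n => n; last by rewrite mulr0 mul0r.
apply: (exp_rec_comm char0 recPsi) => // l.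
by rewrite /aplus -scalerAr KkC scalerAl.
Qed.
Lemma KkPhi n : Kk * Phi n = Phi n * Kk.
Proof.
have [n0|n0] := ltP 0 n; first by rewrite Phi_gt0 // mulr0 mul0r.
have -> : n = - Posz `|n|%N by lia.
apply: (exp_rec_comm char0 recPhi) => [|l]; first by rewrite KkKV KkVK.
by rewrite /aminus -scalerAr KkC scalerAl.
Qed.
Lemma DdPsi n : Dd * Psi n = q ^ n *: (Psi n * Dd).
Proof.
case: n => n; last by rewrite mulr0 mul0r scaler0.
apply: (exp_rec_twist char0 recPsi) => [|l]; first exact: DdK.
by rewrite /aplus -scalerAr DdH // -scalerAl !scalerA mulrC.
Qed.
Lemma DdKkV : Dd * KkV = KkV * Dd.
Proof. by rewrite -[LHS]mul1r -KkVK -!mulrA [Kk * _]mulrA -DdK -mulrA KkKV mulr1. Qed.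
Lemma DdPhi n : Dd * Phi n = q ^ n *: (Phi n * Dd).
Proof.
have [n0|n0] := ltP 0 n; first by rewrite Phi_gt0 // mulr0 mul0r scaler0.
have -> : n = - Posz `|n|%N by lia.
have -> p : q ^ (- Posz p) = q^-1 ^+ p by rewrite -invr_expz exprVn.
apply: (exp_rec_twist char0 recPhi) => [|l]; first exact: DdKkV.
by rewrite /aminus -scalerAr DdH // -scalerAl !scalerA mulrC exprVn.
Qed.

Lemma KkA k l : Kk * Ax k l = Ax k l * Kk.
Proof.
by rewrite !AxE -scalerAr -scalerAl mulrBr mulrBl -!scalerAr -!scalerAl KkPsi KkPhi.
Qed.
Lemma DdA k l : Dd * Ax k l = q ^ (k + l) *: (Ax k l * Dd).
Proof.
rewrite !AxE -scalerAr -scalerAl mulrBr mulrBl -!scalerAr -!scalerAl DdPsi DdPhi.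
by lmod F E.
Qed.

Section RelCurrents.
Variables (t u : F) (x : int -> E).
Hypotheses (t_neq0 : t != 0) (u_neq0 : u != 0).
Hypothesis Kx : forall p, Kk * x p = t *: (x p * Kk).

(** Extends the relation to every integer n: at n = -1 only the coefficient K is left, and the
    relation is its skew commutation with x. *)
Lemma Psi_quad : (forall (l : nat) p, l.+1%:R *: (aplus l * x p - x p * aplus l)
    = ((t ^+ l.+1 - t^-1 ^+ l.+1) * u ^+ l.+1) *: x (p + l.+1%:Z)) ->
  forall n p, qbr t (Psi (n + 1)) (x p) + u *: qbr t (x (p + 1)) (Psi n) = 0.
Proof.
move=> ax [n|n] p.
  have := current_quad_up char0 recPsi t_neq0 Kx ax n p.
  by rewrite -PoszD addn1.
rewrite [X in u *: X]qbr0r scaler0 addr0; case: n => [|n]; last first.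
  by rewrite Psi_lt0 ?qbr0l //; lia.
by rewrite (_ : Negz 0 + 1 = 0) // recPsi.1; apply/qbr_eq0.
Qed.

(** The constant term of this current is K^-1, so the descending relation is applied with t^-1 at p
    + 1, and [qbr_swap] leads back to t. *)
Lemma Phi_quad : (forall (l : nat) p, l.+1%:R *: (aminus l * x p - x p * aminus l)
    = ((t^-1 ^+ l.+1 - t^-1^-1 ^+ l.+1) * u ^+ l.+1) *: x (p - l.+1%:Z)) ->
  forall n p, u *: qbr t (Phi (n + 1)) (x p) + qbr t (x (p + 1)) (Phi n) = 0.
Proof.
move=> ax n p; have KVx r : KkV * x r = t^-1 *: (x r * KkV).
  rewrite -[LHS]mulr1 -KkKV -mulrA [x r * _]mulrA.
  have -> : x r * Kk = t^-1 *: (Kk * x r) by rewrite Kx scalerA mulVf ?scale1r.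
  by rewrite -!scalerAl -scalerAr !mulrA KkVK mul1r.
have tV0 : t^-1 != 0 by rewrite invr_eq0.
have [n0|n0] := ltP 0 n.
  by rewrite !Phi_gt0 ?qbr0l ?qbr0r ?scaler0 ?addr0 //; lia.
case: (eqVneq n 0) => [->|n1].
  rewrite (Phi_gt0 (n := 0 + 1)) // qbr0l scaler0 add0r.
  rewrite -[0]oppr0 recPhi.1 -[t]invrK qbr_swap //.
  by rewrite (_ : qbr _ KkV _ = 0) ?scaler0 //; apply/qbr_eq0.
have [m em] : exists m : nat, n = - Posz m.+1 by exists `|n|.-1%N; lia.
have := current_quad_down char0 recPhi tV0 KVx ax m (p + 1).
rewrite !qbr_swap // (_ : p + 1 - 1 = p) ?addrK // -em (_ : - Posz m = n + 1); last by lia.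
move=> e; set X := qbr t (x (p + 1)) _ in e *; set Y := qbr t _ _ in e *.
transitivity (- t *: (- t^-1 *: X + u *: (- t^-1 *: Y))); last by rewrite e scaler0.
by lmod_eq F E; field.
Qed.

(** Raising k multiplies the weights of [Psi] and [Phi] in [Ax] by g and g^-1. With u = g^-1 this
    merges the two relations containing u into one that does not. *)
Lemma Ax_quad_left w : (forall n p, qbr t (Psi (n + 1)) (x p) + u *: qbr t (x (p + 1)) (Psi n) = 0) ->
  (forall n p, u *: qbr t (Phi (n + 1)) (x p) + qbr t (x (p + 1)) (Phi n) = 0) ->
  u * g = 1 -> forall k p, qbr t (Ax (k + 1) w) (x p) + qbr t (x (p + 1)) (Ax k w) = 0.
Proof.
move=> h1 h2 ug k p; rewrite !AxE !qbrZl !qbrZr !(qbrDl, qbrDr, qbrNl, qbrNr, qbrZl, qbrZr).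
have := h1 (k + w) p; have := h2 (k + w) p.
have -> : k + 1 + w = k + w + 1 by ring.
have -> : k + 1 - w = k - w + 1 by ring.
have -> : w - (k + 1) = w - k - 1 by ring.
have gV : g ^ (-1) = u by rewrite -[LHS]mul1r -ug -mulrA mulfV ?mulr1.
rewrite !(expfzDr _ _ g_neq0) gV expr1z; set Y1 := qbr _ (Psi _) _; set Y2 := qbr _ _ (Psi _).
set Z1 := qbr _ (Phi _) _; set Z2 := qbr _ _ (Phi _) => e2 e1.
transitivity (qq^-1 *: ((g ^ (k - w) * g) *: (Y1 + u *: Y2) - g ^ (w - k) *: (u *: Z1 + Z2))).
  have uE : u = g^-1 by rewrite -gV.
  rewrite uE !(expfzDr _ _ g_neq0).
  move: qq_neq0 (g ^ k) (g ^ w) (g ^ (- k)) (g ^ (- w)); move: qq => Q Q0 ? ? ? ?.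
  by lmod_eq F E; field; rewrite g_neq0 Q0.
by rewrite e1 e2 !scaler0 subr0 scaler0.
Qed.

Lemma Ax_quad_right k : (forall n p, qbr t (Psi (n + 1)) (x p) + u *: qbr t (x (p + 1)) (Psi n) = 0) ->
  (forall n p, u *: qbr t (Phi (n + 1)) (x p) + qbr t (x (p + 1)) (Phi n) = 0) ->
  u = g -> forall w p, qbr t (Ax k (w + 1)) (x p) + qbr t (x (p + 1)) (Ax k w) = 0.
Proof.
move=> h1 h2 ug w p; rewrite !AxE !qbrZl !qbrZr !(qbrDl, qbrDr, qbrNl, qbrNr, qbrZl, qbrZr).
have := h1 (k + w) p; have := h2 (k + w) p.
have -> : k + (w + 1) = k + w + 1 by ring.
have -> : k - (w + 1) = k - w - 1 by ring.
have -> : w + 1 - k = w - k + 1 by ring.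
rewrite !(expfzDr _ _ g_neq0) expr1z; set Y1 := qbr _ (Psi _) _; set Y2 := qbr _ _ (Psi _).
set Z1 := qbr _ (Phi _) _; set Z2 := qbr _ _ (Phi _) => e2 e1.
transitivity (qq^-1 *: ((g ^ (k - w) * g^-1) *: (Y1 + u *: Y2) - g ^ (w - k) *: (u *: Z1 + Z2))).
  have ug' : g^-1 * u = 1 by rewrite ug mulVf.
  rewrite ug (_ : g ^ (-1) = g^-1) // !(expfzDr _ _ g_neq0).
  move: qq_neq0 (g ^ k) (g ^ w) (g ^ (- k)) (g ^ (- w)); move: qq => Q Q0 ? ? ? ?.
  by lmod_eq F E; field; rewrite g_neq0 Q0.
by rewrite e1 e2 !scaler0 subr0 scaler0.
Qed.
End RelCurrents.

Lemma HhX s l : s != 0 -> Hh s * Xm l - Xm l * Hh s = - cminus s *: Xm (l + s).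
Proof.
move=> s0; apply/eqP; rewrite -subr_eq0; apply/eqP/endo_fock0 => [f|p].
  have h0 : h s 0 = 0 by have := linear_scalable (h_lin s) 0 0; rewrite !scale0r.
  by transitivity ((h s 0 : M) - (0 : M) - - cminus s *: (0 : M)) => //; rewrite h0 scaler0 !subr0.
exists 1; have e := HhA p l s0.
(* The vanishing difference from [HhA] appears as the correction when the shift passes the
   relation. *)
transitivity ((Hh s * Xm l * Sh p - Xm l * Hh s * Sh p + cminus s *: (Xm (l + s) * Sh p))
   + ((Hh s * Ax p l - Ax p l * Hh s) - (cplus s *: Ax (p + s) l - cminus s *: Ax p (l + s)))).
  by rewrite !pushE; lmod F E.
by rewrite e !expandE; lmod F E.
Qed.

Lemma KkX l : Kk * Xm l = q ^ (-2) *: (Xm l * Kk).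
Proof.
apply/eqP; rewrite -subr_eq0; apply/eqP/endo_fock0 => [f|p].
  by transitivity (((q ^ (-2)) ^+ 0 * kap) *: (0:M) - q ^ (-2) *: (0:M)) => //; rewrite !scaler0 subr0.
exists (q ^ (-2)).
by rewrite !pushE KkA; lmod F E.
Qed.

Lemma DdX l : Dd * Xm l = q ^ l *: (Xm l * Dd).
Proof.
apply/eqP; rewrite -subr_eq0; apply/eqP/endo_fock0 => [f|p].
  have d0 : d 0 = 0 by have := linear_scalable d_lin 0 0; rewrite !scale0r.
  by transitivity (q ^ (- \sum_(k <- [::]) k) *: d (0:M) - q ^ l *: (0:M)) => //; rewrite d0 !scaler0 subr0.
exists (q ^ (- p)).
have qp : q ^ p != 0 by rewrite expfz_neq0.
have h1 : q ^ (- p) = (q ^ p)^-1 by rewrite invr_expz.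
rewrite !pushE DdA expfzDr // h1.
by lmod_eq F E; field.
Qed.

(** Brings the Drinfeld coefficients to the shape t^l - t^-l of the crossing lemmas, with t =
    q^2. *)
Lemma int_qint (l : nat) :
  l.+1%:R * (qq * (qi (2 * l.+1%:Z) / l.+1%:~R)) = (q ^ 2) ^+ l.+1 - (q ^ 2)^-1 ^+ l.+1.
Proof.
have e : q ^ (2 * l.+1%:Z) = (q ^ 2) ^+ l.+1 by rewrite -exprz_exp.
rewrite /qi -invr_expz e exprVn; move: (_ ^+ _) qq_neq0 (char0 l) => Y; move: (Y^-1) => Z.
by rewrite -[l.+1%:~R]/(l.+1%:R : F); move: qq (l.+1%:R) => Q n Q0 n0; field; rewrite ?Q0 ?n0.
Qed.

Lemma qi_Negz l : qi (2 * Negz l) / (Negz l)%:~R = qi (2 * l.+1%:Z) / l.+1%:~R.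
Proof.
have qiN x : qi (- x) = - qi x by rewrite /qi opprK -mulNr opprB.
by rewrite NegzE mulrN qiN mulrNz invrN mulrNN.
Qed.

Lemma cplus_Posz l : l.+1%:R * (qq * cplus l.+1%:Z)
  = ((q ^ 2) ^+ l.+1 - (q ^ 2)^-1 ^+ l.+1) * g^-1 ^+ l.+1.
Proof.
by rewrite -int_qint exprVn /cplus -invr_expz -!mulrA.
Qed.
Lemma cplus_Negz l : l.+1%:R * (qq * cplus (Negz l))
  = ((q ^ 2) ^+ l.+1 - (q ^ 2)^-1 ^+ l.+1) * g^-1 ^+ l.+1.
Proof. by rewrite -cplus_Posz /cplus qi_Negz. Qed.
Lemma cminus_Posz l : l.+1%:R * (qq * cminus l.+1%:Z)
  = ((q ^ 2) ^+ l.+1 - (q ^ 2)^-1 ^+ l.+1) * g ^+ l.+1.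
Proof. by rewrite /cminus -int_qint -!mulrA. Qed.
Lemma cminus_Negz l : l.+1%:R * (qq * cminus (Negz l))
  = ((q ^ 2) ^+ l.+1 - (q ^ 2)^-1 ^+ l.+1) * g ^+ l.+1.
Proof. by rewrite -cminus_Posz /cminus qi_Negz. Qed.

Let swap (x y z : F) : (x - y) * z = - ((y - x) * z).
Proof. by ring. Qed.
Let q2_neq0 : q ^ 2 != 0. Proof. by rewrite expfz_neq0. Qed.
Let gV_neq0 : g^-1 != 0. Proof. by rewrite invr_eq0. Qed.

Lemma Kk_Sh p : Kk * Sh p = q ^ 2 *: (Sh p * Kk).
Proof. by rewrite Sh_K scalerA mulfV ?scale1r. Qed.

Lemma Ax_Sh_quad w k p :
  qbr (q ^ 2) (Ax (k + 1) w) (Sh p) + qbr (q ^ 2) (Sh (p + 1)) (Ax k w) = 0.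
Proof.
apply: (@Ax_quad_left (q ^ 2) g^-1).
- apply: Psi_quad => // [r|l r]; first exact: Kk_Sh.
  rewrite /aplus -cplus_Posz -scalerAl -scalerAr Sh_H.
  by lmod F E.
- apply: Phi_quad => // [r|l r]; first exact: Kk_Sh.
  rewrite /aminus invrK (swap ((q ^ 2)^-1 ^+ l.+1)) -cplus_Negz -scalerAl -scalerAr Sh_H NegzE.
  by lmod F E.
- by rewrite mulVf.
Qed.

Lemma Ax_Xm_quad k w p :
  qbr (q ^ (-2)) (Ax k (w + 1)) (Xm p) + qbr (q ^ (-2)) (Xm (p + 1)) (Ax k w) = 0.
Proof.
have e : q ^ (-2) = (q ^ 2)^-1 by [].
have t0 : q ^ (-2) != 0 by rewrite e invr_eq0.
apply: (@Ax_quad_right (q ^ (-2)) g) => //.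
- apply: Psi_quad => // [r|l r]; first exact: KkX.
  rewrite e invrK (swap ((q ^ 2)^-1 ^+ l.+1)) -cminus_Posz /aplus -scalerAl -scalerAr.
  transitivity (l.+1%:R *: (qq *: (Hh l.+1 * Xm r - Xm r * Hh l.+1))); first by lmod F E.
  by rewrite HhX //; lmod F E.
- apply: Phi_quad => // [r|l r]; first exact: KkX.
  rewrite e !invrK -cminus_Negz /aminus -scalerAl -scalerAr.
  transitivity (- l.+1%:R *: (qq *: (Hh (Negz l) * Xm r - Xm r * Hh (Negz l)))); first by lmod F E.
  by rewrite HhX // NegzE; lmod F E.
Qed.

(** Moving a shift past the relation produces two instances of [Ax_Xm_quad], both zero, so the
    relation commutes with the shifts. *)
Lemma Xm_quad l p :
  qbr (q ^ (-2)) (Xm (l + 1)) (Xm p) + qbr (q ^ (-2)) (Xm (p + 1)) (Xm l) = 0.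
Proof.
apply: endo_fock0 => [f|k].
  transitivity ((0:M) - q ^ (-2) *: (0:M) + ((0:M) - q ^ (-2) *: (0:M))) => //.
  by rewrite scaler0 subr0 addr0.
exists 1; have h1 := Ax_Xm_quad k l p; have h2 := Ax_Xm_quad k p l.
set t := q ^ (-2) in h1 h2 *.
transitivity ((qbr t (Xm (l + 1)) (Xm p) + qbr t (Xm (p + 1)) (Xm l)) * Sh k
   + (qbr t (Ax k (l + 1)) (Xm p) + qbr t (Xm (p + 1)) (Ax k l))
   + (qbr t (Ax k (p + 1)) (Xm l) + qbr t (Xm (l + 1)) (Ax k p))).
  by rewrite /qbr !pushE; lmod F E.
by rewrite h1 h2 !addr0 scale1r.
Qed.

(** The quadratic relation of the x^+_k as an operator; its common kernel has to be cut out of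
    [fock]. *)
Definition Rel k p : E := qbr (q ^ 2) (Sh (k + 1)) (Sh p) + qbr (q ^ 2) (Sh (p + 1)) (Sh k).

(* Shifts lower the depth [n] by one, so that stability under the other
   operators is proved by induction on it. *)
Fixpoint Wn n f : Prop :=
  if n is n'.+1 then (forall k p, endo_fun (Rel k p) f = 0) /\ forall k, Wn n' (fock_shift k f)
  else True.
Definition quad_sub f : Prop := forall n, Wn n f.

Lemma Wn_lin n c f1 f2 : Wn n f1 -> Wn n f2 -> Wn n (c *: f1 + f2).
Proof.
elim: n f1 f2 => //= n IH f1 f2 [h1 h1'] [h2 h2']; split=> [k p|k].
  by rewrite (endo_linear (Rel k p)) h1 h2 scaler0 addr0.
exact: (IH (fock_shift k f1) (fock_shift k f2) (h1' k) (h2' k)).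
Qed.
Lemma Wn0 n : Wn n 0.
Proof. by elim: n => //= n IH; split=> [k p|k]; rewrite ?linear0. Qed.
Lemma WnW n f : Wn n.+1 f -> Wn n f.
Proof. by elim: n f => //= n IH f [h1 h2]; split=> // k; apply: IH. Qed.

Definition pres : {pred E} := [pred T | `[< forall n f, Wn n f -> Wn n (endo_fun T f) >]].

Lemma pres_subalg : subalg_closed pres.
Proof.
split.
- by apply/asboolP.
- by move=> c u v /asboolP hu /asboolP hv; apply/asboolP => n f hf; exact: (Wn_lin c (hu _ _ hf) (hv _ _ hf)).
- by move=> u v /asboolP hu /asboolP hv; apply/asboolP => n f hf; exact: (hu _ _ (hv _ _ hf)).
Qed.

(** Three summands are what h_s requires, as it can move either of the two indices of the relation
    or none; other operators fill up with zeros. *)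
Lemma pres_comm T : (forall k p, exists T1 k1 p1 T2 k2 p2 T3 k3 p3,
     Rel k p * T = T1 * Rel k1 p1 + T2 * Rel k2 p2 + T3 * Rel k3 p3) ->
  (forall n, (forall f, Wn n f -> Wn n (endo_fun T f)) -> forall k f, Wn n.+1 f ->
     Wn n (fock_shift k (endo_fun T f))) -> T \in pres.
Proof.
move=> h1 h2; apply/asboolP; elim=> //= n IH f hf.
split=> [k p|k]; last exact: h2.
have [T1 [k1 [p1 [T2 [k2 [p2 [T3 [k3 [p3 e]]]]]]]]] := h1 k p.
rewrite -[LHS]/(endo_fun (Rel k p * T) f) e.
rewrite -[LHS]/(endo_fun T1 (endo_fun (Rel k1 p1) f) + endo_fun T2 (endo_fun (Rel k2 p2) f)
   + endo_fun T3 (endo_fun (Rel k3 p3) f)).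
by rewrite !hf.1 !linear0 !addr0.
Qed.

Lemma W_Sh k f : quad_sub f -> quad_sub (endo_fun (Sh k) f).
Proof. by move=> hf n; case: (hf n.+1) => _; apply. Qed.
Lemma W_pres T f : T \in pres -> quad_sub f -> quad_sub (endo_fun T f).
Proof. by move=> /asboolP hT hf n; apply: hT. Qed.

Lemma pres_skew T (al : int -> F) : (forall k, Sh k * T = al k *: (T * Sh k)) ->
  (forall k p, al (k + 1) * al p = al (p + 1) * al k) -> T \in pres.
Proof.
move=> hT hal; apply: pres_comm => [k p|n IH k f hf].
  exists ((al (k + 1) * al p) *: T), k, p, 0, 0, 0, 0, 0, 0; rewrite !mul0r !addr0.
  have hT0 r : Sh r * T = al r *: (T * Sh r) + 0 by rewrite addr0.
  rewrite mulrDl (qbr_leibR _ (hT0 _) (hT0 _)) (qbr_leibR _ (hT0 _) (hT0 _)).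
  rewrite -hal !mul0r !mulr0 !scaler0 !subr0 !addr0 -scalerDr -mulrDr.
  by rewrite -scalerAl.
have -> : fock_shift k (endo_fun T f) = endo_fun (Sh k * T) f by [].
rewrite hT -[endo_fun _ f]/(al k *: endo_fun T (fock_shift k f)) -[_ *: _]addr0.
by apply: Wn_lin; [apply/IH/hf.2 | exact: Wn0].
Qed.

Lemma pres_Kk : Kk \in pres.
Proof. exact: (pres_skew Sh_K). Qed.
Lemma pres_KkV : KkV \in pres.
Proof. exact: (pres_skew Sh_KV). Qed.
Lemma pres_Dd : Dd \in pres.
Proof.
apply: (pres_skew Sh_D) => k p; rewrite -!expfzDr //; congr (_ ^ _); ring.
Qed.
Lemma pres_DdV : DdV \in pres.
Proof.
apply: (pres_skew Sh_DV) => k p; rewrite -!expfzDr //; congr (_ ^ _); ring.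
Qed.

Lemma pres_Hh s : Hh s \in pres.
Proof.
apply: pres_comm => [k p|n IH k f hf].
  exists (Hh s), k, p, (- (cplus s)%:A), (k + s), p, (- (cplus s)%:A), k, (p + s).
  have hS r : Sh r * Hh s = 1 *: (Hh s * Sh r) + (- cplus s) *: Sh (r + s).
    by rewrite Sh_H scale1r scaleNr.
  rewrite /Rel mulrDl (qbr_leibR _ (hS _) (hS _)) (qbr_leibR _ (hS _) (hS _)).
  rewrite !mulNr !mulr_algl /qbr !mulr1 !scale1r !expandE.
  rewrite (_ : k + 1 + s = k + s + 1) 1?(_ : p + 1 + s = p + s + 1); try ring.
  by lmod F E.
have -> : fock_shift k (endo_fun (Hh s) f) = endo_fun (Sh k * Hh s) f by [].
rewrite Sh_H.
rewrite -[endo_fun _ f]/(endo_fun (Hh s) (fock_shift k f) - cplus s *: fock_shift (k + s) f) addrC -scaleNr.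
by apply: Wn_lin; [exact: hf.2 | apply/IH/hf.2].
Qed.

Lemma presZ c T : T \in pres -> c *: T \in pres.
Proof. by move=> /asboolP hT; apply/asboolP => n f hf; rewrite -[_ f]addr0; apply: (Wn_lin c (hT _ _ hf) (Wn0 _)). Qed.
Lemma pres0 : 0 \in pres.
Proof. by apply/asboolP => n f _; apply: Wn0. Qed.

Lemma pres_Psi n : Psi n \in pres.
Proof.
case: n => n; last exact: pres0.
apply: (exp_rec_in char0 recPsi pres_subalg) => [|l]; first exact: pres_Kk.
exact/presZ/pres_Hh.
Qed.
Lemma pres_Phi n : Phi n \in pres.
Proof.
have [n0|n0] := ltP 0 n; first by rewrite Phi_gt0 // pres0.
have -> : n = - Posz `|n|%N by lia.
apply: (exp_rec_in char0 recPhi pres_subalg) => [|l]; first exact: pres_KkV.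
exact/presZ/pres_Hh.
Qed.
Lemma pres_Ax k l : Ax k l \in pres.
Proof.
rewrite AxE -scaleNr scalerDr scalerA; have [_ hl _] := pres_subalg.
by apply: hl; [exact: pres_Psi | exact/presZ/presZ/pres_Phi].
Qed.

(** The corrections from passing x^-_l are two instances of [Ax_Sh_quad]. *)
Lemma Rel_Xm k p l : Rel k p * Xm l = Xm l * Rel k p.
Proof.
have h1 := Ax_Sh_quad l k p; have h2 := Ax_Sh_quad l p k.
transitivity (Xm l * Rel k p
  + (qbr (q ^ 2) (Ax (k + 1) l) (Sh p) + qbr (q ^ 2) (Sh (p + 1)) (Ax k l))
  + (qbr (q ^ 2) (Ax (p + 1) l) (Sh k) + qbr (q ^ 2) (Sh (k + 1)) (Ax p l))).
  rewrite /Rel; set t := q ^ 2.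
  have hS r : Sh r * Xm l = 1 *: (Xm l * Sh r) + Ax r l by rewrite Sh_X scale1r.
  rewrite mulrDl (qbr_leibR _ (hS _) (hS _)) (qbr_leibR _ (hS _) (hS _)).
  by rewrite /qbr !mulr1 !scale1r !expandE; lmod F E.
by rewrite h1 h2 !addr0.
Qed.

Lemma pres_Xm l : Xm l \in pres.
Proof.
apply: pres_comm => [k p|n IH k f hf].
  by exists (Xm l), k, p, 0, 0, 0, 0, 0, 0; rewrite !mul0r !addr0 Rel_Xm.
have -> : fock_shift k (endo_fun (Xm l) f) = endo_fun (Sh k * Xm l) f by [].
rewrite Sh_X -[endo_fun _ f]/(endo_fun (Xm l) (fock_shift k f) + endo_fun (Ax k l) f).
rewrite -[X in X + _]scale1r; apply: Wn_lin; first exact/IH/hf.2.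
by have /asboolP := pres_Ax k l; apply; apply: WnW.
Qed.

Lemma W_Rel k p f : quad_sub f -> endo_fun (Rel k p) f = 0.
Proof. by move=> hf; case: (hf 1%N). Qed.

Definition vac (m : M) : fock := fun L => if L is [::] then m else 0.

Lemma W_vac m : quad_sub (vac m).
Proof. by case=> // n; split=> [k p|k]; last exact: Wn0; apply/funext=> L; rewrite /Rel;
  transitivity ((0 : M) - q ^ 2 *: (0:M) + ((0:M) - q ^ 2 *: (0:M))) => //; rewrite scaler0 subr0 addr0. Qed.

Lemma Sh_vac k m : endo_fun (Sh k) (vac m) = 0.
Proof. by []. Qed.
Lemma Kk_vac m : endo_fun Kk (vac m) = vac (kap *: m).
Proof.
apply/funext=> -[|k L]; rewrite -[LHS]/(_ *: vac m _) /= ?scaler0 //.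
by rewrite expr0 mul1r.
Qed.
Lemma KkV_vac m : endo_fun KkV (vac m) = vac (kap^-1 *: m).
Proof.
apply/funext=> -[|k L]; rewrite -[LHS]/(_ *: vac m _) /= ?scaler0 //.
by rewrite expr0 mul1r.
Qed.
Lemma Dd_vac m : endo_fun Dd (vac m) = vac (d m).
Proof.
apply/funext=> -[|k L]; rewrite -[LHS]/(_ *: d (vac m _)) /=.
  by rewrite big_nil oppr0 expr0z scale1r.
by have := linear_scalable d_lin 0 0; rewrite !scale0r => ->; rewrite scaler0.
Qed.
Lemma DdV_vac m : endo_fun DdV (vac m) = vac (dV m).
Proof.
apply/funext=> -[|k L]; rewrite -[LHS]/(_ *: dV (vac m _)) /=.
  by rewrite big_nil expr0z scale1r.
by have := linear_scalable dV_lin 0 0; rewrite !scale0r => ->; rewrite scaler0.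
Qed.
Lemma Hh_vac s m : endo_fun (Hh s) (vac m) = vac (h s m).
Proof.
apply/funext=> -[|k L] //.
transitivity (endo_fun (Hh s) (0 : fock) L - cplus s *: (0:M)) => //.
by rewrite linear0 scaler0 subr0.
Qed.

End CoinducedModule.

(** * Lowering to the vacuum *)

Lemma sum_by_key (K : eqType) (T : Type) (V : nmodType) (l : seq T) (key : T -> K)
  (v : T -> V) (js : seq K) : uniq js -> all (fun p => key p \in js) l ->
  \sum_(p <- l) v p = \sum_(j <- js) \sum_(p <- l | key p == j) v p.
Proof.
move=> ujs; elim: l => [|p l IH] /=; first by rewrite big_nil big1 // => j _; rewrite big_nil.
case/andP=> hp /IH e; rewrite big_cons e.
rewrite [RHS](eq_bigr (fun j => (if j == key p then v p else 0)
    + \sum_(i <- l | key i == j) v i)); last first.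
  by move=> j _; rewrite big_cons [j == _]eq_sym; case: eqP; rewrite ?add0r.
have ef : [seq j <- js | j == key p] = [:: key p] := filter_pred1_uniq ujs hp.
by rewrite big_split /= -[in RHS]big_mkcond -[X in _ = X + _]big_filter ef big_seq1.
Qed.

(** * Eigenvectors of h_s for all large s *)

Section Germs.
Variables (F : fieldType) (M : lmodType F) (h : nat -> {linear M -> M}).
Variables (chi : int -> nat -> F) (P : pred int).
Hypothesis chi_sep : forall i j n, P i -> P j -> i != j ->
  exists2 s, (n <= s)%N & chi i s != chi j s.

(** Restricting to large s makes the notion stable under operators that fail to commute with
    finitely many h_s. *)
Definition germ (j : int) (m : M) : Prop :=
  exists n, forall s, (n <= s)%N -> h s m = chi j s *: m.

Lemma germ0 j : germ j 0.
Proof. by exists 0%N => s _; rewrite linear0 scaler0. Qed.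
Lemma germD j m m' : germ j m -> germ j m' -> germ j (m + m').
Proof.
move=> [n hn] [n' hn']; exists (maxn n n') => s; rewrite geq_max => /andP[h1 h2].
by rewrite linearD hn // hn' // scalerDr.
Qed.
Lemma germZ j c m : germ j m -> germ j (c *: m).
Proof. by move=> [n hn]; exists n => s hs; rewrite linearZ /= hn // !scalerA mulrC. Qed.
Lemma germ_sum j (I : Type) (r : seq I) (Q : pred I) (G : I -> M) :
  (forall i, Q i -> germ j (G i)) -> germ j (\sum_(i <- r | Q i) G i).
Proof. by move=> hG; elim/big_ind: _ => //; [exact: germ0 | exact: germD]. Qed.

(** The usual independence of eigenvectors, run with one h_s whose index lies beyond all thresholds
    involved and separates two characters. *)
Lemma germ_indep (js : seq int) (m : int -> M) : uniq js -> all P js ->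
  (forall j, germ j (m j)) -> \sum_(j <- js) m j = 0 -> forall j, j \in js -> m j = 0.
Proof.
elim: js m => //= j0 js IH m /andP[j0n ujs] /andP[Pj0 Pjs] hm.
rewrite big_cons => e.
have h0 j : j \in js -> m j = 0.
  move=> hj; have [n hn] : exists n, forall i, i \in j0 :: js ->
      forall s, (n <= s)%N -> h s (m i) = chi i s *: m i.
    elim: (j0 :: js) => [|i l [n hn]]; first by exists 0%N.
    have [n' hn'] := hm i; exists (maxn n n') => k; rewrite inE => /orP[/eqP ->|hk] s;
      rewrite geq_max => /andP[h1 h2]; [exact: hn' | exact: hn].
  have jj0 : j != j0 by apply: contraNneq j0n => <-.
  have [s hs hne] := chi_sep n (allP Pjs _ hj) Pj0 jj0.
  (* Subtracting the eigenvalue of the j0 term from h_s removes that term from the relation, and the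
     induction hypothesis applies to the rest. *)
  have : (chi j s - chi j0 s) *: m j = 0.
    apply: (IH (fun i => (chi i s - chi j0 s) *: m i)) => // [i|]; first exact: germZ.
    have := congr1 (fun z => h s z - chi j0 s *: z) e.
    rewrite linear0 scaler0 subr0 linearD hn ?mem_head // scalerDr opprD addrACA subrr add0r.
    rewrite linear_sum scaler_sumr -sumrB => e'; rewrite -[RHS]e' !big_seq.
    by apply: eq_bigr => i hi; rewrite hn ?inE ?hi ?orbT // scalerBl.
  by move/eqP; rewrite scaler_eq0 subr_eq0 (negbTE hne) => /eqP.
move=> j; rewrite inE => /orP[/eqP ->|]; last exact: h0.
by move: e; rewrite big_seq big1 ?addr0 // => i /h0.
Qed.

Hypothesis germ_span : forall m, exists l : seq (int * M),
  [/\ all P (map fst l), forall p, p \in l -> germ p.1 p.2 & m = \sum_(p <- l) p.2].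

Variables (phi : nat -> {linear M -> M}) (kappa : nat -> F) (g : F).
Hypotheses (g_neq0 : g != 0) (kappa_neq0 : forall s, (0 < s)%N -> kappa s != 0).
Hypothesis phi0_inj : forall m, phi 0 m = 0 -> m = 0.
Hypothesis hphi : forall s r m, (0 < s)%N ->
  h s (phi r m) - phi r (h s m) = if (s <= r)%N then kappa s *: phi (r - s)%N m else 0.

Lemma germ_phi j r m : germ j m -> germ j (phi r m).
Proof.
move=> [n hn]; exists (maxn n r.+1) => s; rewrite geq_max => /andP[h1 h2].
have := hphi r m (leq_ltn_trans (leq0n r) h2); rewrite leqNgt h2 /= => /eqP.
by rewrite subr_eq0 => /eqP ->; rewrite hn // linearZ.
Qed.

(* With k very negative, applying h_s for s = - k - b extracts, up to nonzero
   scalars, the coefficient of the smallest index b of the family. *)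
Lemma phi_family_neq0 (Z : int -> M) (S : seq int) l (B : int) :
  (forall e, Z e != 0 -> e \in S) -> Z l != 0 ->
  exists2 k : int, k < B & forall N, (forall e, e \in S -> (- k - e < N%:Z)%R) ->
    \sum_(r < N) phi r (g^-1 ^+ r *: Z (- k - r%:Z)) != 0.
Proof.
move=> hS hl; have [L hL] := choice germ_span.
have {hL} [hL1 hL2 hL3] : [/\ forall m, all P (map fst (L m)),
    forall m p, p \in L m -> germ p.1 p.2 & forall m, m = \sum_(p <- L m) p.2].
  by split=> m; case: (hL m).
pose js := undup (flatten [seq map fst (L (Z e)) | e <- S]).
(* The part of Z e with germ j, put equal to 0 outside the finite support. *)
pose c e j := if e \in S then \sum_(p <- L (Z e) | p.1 == j) p.2 else 0.
have hZ e : Z e = \sum_(j <- js) c e j.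
  rewrite /c; case: (boolP (e \in S)) => he; last first.
    by rewrite big1 //; apply/eqP; apply: contraNT he; exact: hS.
  rewrite [LHS]hL3; apply: sum_by_key; first exact: undup_uniq.
  apply/allP => p hp; rewrite mem_undup; apply/flattenP.
  by exists (map fst (L (Z e))); apply/mapP; [exists e | exists p].
have Pjs : all P js.
  apply/allP => j; rewrite mem_undup => /flattenP[? /mapP[e _ ->]].
  exact: (allP (hL1 _)).
have hc e j : germ j (c e j).
  rewrite /c; case: ifP => _; last exact: germ0.
  by rewrite big_seq_cond; apply: germ_sum => p /andP[hp /eqP <-]; exact: (hL2 _ _ hp).
have cS e j : e \notin S -> c e j = 0 by rewrite /c => /negbTE ->.
have [j hj [b0 hb0]] : exists2 j, j \in js & exists e, c e j != 0.
  apply: contrapT => hn; move: hl; rewrite hZ big_seq big1 ?eqxx // => j hj.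
  by apply/eqP; apply: contrapT => /negP he; apply: hn; exists j => //; exists l.
have [b hb hmin] : exists2 b, c b j != 0 & forall e, e < b -> c e j = 0.
  have [K hK] : exists K : nat, forall e, e \in S -> - K%:Z <= e.
    elim: (S) => [|e T [K hK]]; first by exists 0%N.
    exists (maxn K (absz e)) => e'; rewrite inE => /orP[/eqP ->|/hK]; lia.
  have hex : exists n, (fun n : nat => c (n%:Z - K%:Z) j != 0) n.
    have hb0S : b0 \in S by apply: contraR hb0 => /cS ->.
    exists (absz (b0 + K%:Z)); have := hK _ hb0S; move=> ?.
    by rewrite (_ : _ - _ = b0) //; lia.
  have [n hn hmin] := ex_minnP hex; exists (n%:Z - K%:Z) => // e he.
  apply/eqP; apply: contrapT => /negP he'.
  have heS : e \in S by apply: contraR he' => /cS ->.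
  have := hK _ heS; move=> ?; have := hmin (absz (e + K%:Z)).
  by rewrite (_ : _ - _ = e); [move=> /(_ he'); lia | lia].
have bS : b \in S by apply: contraR hb => /cS ->.
have [n hn] : exists n, forall e s, (n <= s)%N -> h s (c e j) = chi j s *: c e j.
  have [n hn] : exists n, forall e s, e \in S -> (n <= s)%N -> h s (c e j) = chi j s *: c e j.
    elim: (S) => [|e T [n hn]]; first by exists 0%N.
    have [n' hn'] := hc e j; exists (maxn n n') => e' s; rewrite inE geq_max.
    by move=> /orP[/eqP ->|he] /andP[h1 h2]; [exact: hn' | exact: hn].
  exists n => e s hs; have [he|/cS ->] := boolP (e \in S); first exact: hn.
  by rewrite linear0 scaler0.
(* Beyond all thresholds of the components with germ j, and so large that k = - s - b lies below
   B. *)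
have [s [hns hs0 hsB]] : exists s : nat, [/\ (n <= s)%N, (0 < s)%N & - s%:Z - b < B].
  by exists (n + absz b + absz B).+1; split; lia.
exists (- s%:Z - b) => [//|N hN].
apply/negP => /eqP hsum; have sN : (s < N)%N by have := hN _ bS; lia.
(* The supposedly vanishing sum is split by germ. Each part [y i] is again a germ, so independence
   makes every part vanish. *)
pose y i := \sum_(r < N) phi r (g^-1 ^+ r *: c (- (- s%:Z - b) - r%:Z) i).
have hy i : germ i (y i) by apply: germ_sum => r _; apply/germ_phi/germZ/hc.
have y0 : \sum_(i <- js) y i = 0.
  rewrite -[RHS]hsum exchange_big /=; apply: eq_bigr => r _.
  by rewrite hZ scaler_sumr linear_sum.
have {y0} y0 := germ_indep (undup_uniq _) Pjs hy y0 hj.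
have := congr1 (h s) y0; rewrite linear0 linear_sum /=.
(* For r < s the operators commute; for r > s the argument of c lies below the minimal index b; r =
   s gives the argument b itself. *)
have e1 (r : 'I_N) : h s (phi r (g^-1 ^+ r *: c (- (- s%:Z - b) - r%:Z) j))
   = chi j s *: phi r (g^-1 ^+ r *: c (- (- s%:Z - b) - r%:Z) j)
     + (if r == s :> nat then kappa s *: phi 0 (g^-1 ^+ s *: c b j) else 0).
  rewrite -[LHS](subrK (phi r (h s (g^-1 ^+ r *: c (- (- s%:Z - b) - r%:Z) j)))) hphi //.
  rewrite addrC; congr (_ + _).
    rewrite linearZ /= hn //.
    by rewrite scalerA mulrC -scalerA linearZ.
  case: (ltngtP r s) => // hr; last by rewrite hr subnn; congr (_ *: phi _ (_ *: c _ _)); lia.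
  by rewrite hmin ?scaler0 ?linear0 ?scaler0 //; lia.
rewrite (eq_bigr _ (fun r _ => e1 r)) big_split /= -scaler_sumr -/(y j) y0 scaler0 add0r.
rewrite -big_mkcond (big_pred1 (Ordinal sN)) /=; last by move=> r; apply/eqP/eqP => [hr|->] //; apply: val_inj.
move/eqP; rewrite scaler_eq0 (negbTE (kappa_neq0 _)) //= => /eqP/phi0_inj/eqP.
by rewrite scaler_eq0 (negbTE hb) orbF expf_eq0 invr_eq0 (negbTE g_neq0) andbF.
Qed.
End Germs.

(** * Functionals on words *)

Section WordPairing.
Variables (F : fieldType) (G : nat -> F).
Implicit Types (L : seq int) (t : seq int -> F).

(* [phi_pull] and [xp_pull] are the transposes, on functions of words, of moving
   a current phi, respectively x^+_k with k very negative, to the right through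
   a word in the x^-_l. *)
Fixpoint phi_pull (j : nat) t L : F :=
  if L is p :: L' then
    \sum_(i < j.+1) G i * phi_pull (j - i) (fun u => t (p - i%:Z :: u)) L'
  else if j == 0%N then t [::] else 0.
Fixpoint xp_pull (e : int) t L : F :=
  if L is l :: L' then
    (if l <= e then phi_pull (absz (e - l)) t L' else 0) + xp_pull e (fun u => t (l :: u)) L'
  else 0.
(** The vacuum functional pulled back along the removal of the letters of e, one after the other. It
    serves as a triangular substitute for the dual vector of the word e. *)
Fixpoint word_pull (e : seq int) : seq int -> F :=
  if e is l :: e' then xp_pull l (word_pull e') else fun L => (L == [::])%:R.

Lemma phi_pull_cons j t p L : phi_pull j t (p :: L) =
  \sum_(i < j.+1) G i * phi_pull (j - i) (fun u => t (p - i%:Z :: u)) L.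
Proof. by []. Qed.
Lemma xp_pull_cons e t l L : xp_pull e t (l :: L) =
  (if l <= e then phi_pull (absz (e - l)) t L else 0) + xp_pull e (fun u => t (l :: u)) L.
Proof. by []. Qed.

Lemma phi_pull_size j t L : (forall u, size u = size L -> t u = 0) -> phi_pull j t L = 0.
Proof.
elim: L j t => [|p L IH] j t ht /=; first by rewrite ht //; case: ifP.
by rewrite big1 // => i _; rewrite IH ?mulr0 // => u hu; apply: ht; rewrite /= hu.
Qed.
Lemma xp_pull_size e t L : (forall u, (size u).+1 = size L -> t u = 0) -> xp_pull e t L = 0.
Proof.
elim: L t => [|l L IH] t ht //=.
rewrite phi_pull_size => [|u hu]; last by apply: ht; rewrite hu.
by rewrite IH => [|u hu]; [case: ifP; rewrite addr0 | apply: ht; rewrite /= hu].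
Qed.
Lemma word_pull_size e L : size L != size e -> word_pull e L = 0.
Proof.
elim: e L => [|l e IH] L hL /=; first by case: L hL.
by apply: xp_pull_size => u hu; apply: IH; move: hL; rewrite -hu.
Qed.

Definition wsum L : int := \sum_(l <- L) l.
Lemma wsum_cons l L : wsum (l :: L) = l + wsum L.
Proof. exact: big_cons. Qed.

Lemma phi_pull_sum (s : int) j t L : (forall u, wsum u != s -> t u = 0) ->
  wsum L != s + j%:Z -> phi_pull j t L = 0.
Proof.
elim: L s j t => [|p L IH] s j t ht hL /=.
  by case: (j =P 0%N) hL => [-> hL|//]; apply: ht; rewrite addr0 in hL.
rewrite big1 // => i _; rewrite (IH (s - (p - i%:Z))) ?mulr0 // => [u hu|].
  by apply: ht; rewrite wsum_cons; lia.
by move: hL; rewrite wsum_cons; have := ltn_ord i; lia.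
Qed.
Lemma xp_pull_sum (s : int) e t L : (forall u, wsum u != s -> t u = 0) ->
  wsum L != s + e -> xp_pull e t L = 0.
Proof.
elim: L s t => [|l L IH] s t ht //= hL; rewrite (IH (s - l)); last first.
- by move: hL; rewrite wsum_cons; lia.
- by move=> u hu; apply: ht; rewrite wsum_cons; lia.
rewrite addr0; case: ifP => // le; rewrite (phi_pull_sum ht) //.
by move: hL; rewrite wsum_cons; lia.
Qed.
Lemma word_pull_sum e L : wsum L != wsum e -> word_pull e L = 0.
Proof.
elim: e L => [|l e IH] L /=; first by case: L => //; rewrite eqxx.
by rewrite wsum_cons addrC; apply: xp_pull_sum.
Qed.

Lemma phi_pull0 t L : phi_pull 0 t L = G 0%N ^+ size L * t L.
Proof.
elim: L t => [|p L IH] t /=; first by rewrite mul1r.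
by rewrite big_ord1 subr0 IH mulrA exprS.
Qed.

(* On a word without letters below [e], [xp_pull e] only sees the removal of a
   letter [e], with this coefficient. *)
Fixpoint xp_pull_coef e L : F :=
  if L is l :: L' then if l == e then G 0%N ^+ size L' + xp_pull_coef e L' else 0 else 0.

(** A letter can be removed only if it is at most e, hence only if it equals e; the current released
    is then phi_0, which merely scales. In a sorted word these letters stand in front, and each
    removal leaves the same word. *)
Lemma xp_pull_min e t L : sorted <=%O L -> all (>= e) L ->
  xp_pull e t L = xp_pull_coef e L * t (behead L).
Proof.
elim: L t => [|l L IH] t /=; first by rewrite mul0r.
move=> hs /andP[el eL]; have sL := path_sorted hs.
rewrite (IH (fun u => t (l :: u)) sL eL).
move: el; rewrite le_eqVlt => /orP[/eqP el|el]; last first.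
  rewrite leNgt el add0r gt_eqF // mul0r.
  case: L {IH eL sL} hs => [|l' L] /=; first by rewrite mul0r.
  by case/andP=> hl _; rewrite gt_eqF ?mul0r // (lt_le_trans el).
subst e; rewrite lexx eqxx subrr phi_pull0 mulrDl; congr (_ + _).
case: L {IH sL eL} hs => [|l' L] /=; first by rewrite !mul0r.
by case: eqP => [->|]; rewrite ?mul0r.
Qed.

(** The i-th copy of l contributes one more power of G_0, whence a geometric sum; its nonvanishing
    is the assumption on G_0 below. *)
Lemma YcE l L : sorted <=%O L -> all (>= l) L ->
  xp_pull_coef l L = G 0%N ^+ (size L - count_mem l L) * \sum_(i < count_mem l L) G 0%N ^+ i.
Proof.
elim: L => [|l' L IH] /=; first by rewrite big_ord0 mulr0.
move=> hs /andP[ll' lL]; have sL := path_sorted hs.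
have [e|ne] := eqVneq l' l; last first.
  have -> : count_mem l L = 0%N.
    apply/count_memPn/negP => h; have := order_path_min le_trans hs => /allP /(_ _ h) h'.
    by case/eqP: ne; apply: le_anti; rewrite h' ll'.
  by rewrite addn0 big_ord0 mulr0.
rewrite (IH sL lL) add1n big_ord_recr mulrDr addrC subSS; congr (_ + _).
by rewrite -exprD subnK // count_size.
Qed.

Hypothesis G0_neq0 : G 0%N != 0.
Hypothesis G_neq0 : forall c, (0 < c)%N -> \sum_(i < c) G 0%N ^+ i != 0.

Lemma xp_pull_coef_head l L : sorted <=%O (l :: L) -> xp_pull_coef l (l :: L) != 0.
Proof.
move=> hs; rewrite YcE //; last by rewrite /= lexx (order_path_min le_trans).
by rewrite mulf_neq0 ?expf_neq0 ?G_neq0 //= eqxx.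
Qed.

Fixpoint lexlt L L' : bool :=
  match L, L' with
  | l :: L1, l' :: L1' => (l < l') || (l == l') && lexlt L1 L1'
  | _, _ => false
  end.

Lemma word_pull_cons l e L : word_pull (l :: e) L = xp_pull l (word_pull e) L.
Proof. by []. Qed.

Lemma word_pull_diag L : sorted <=%O L -> word_pull L L != 0.
Proof.
elim: L => [|l L IH] hs; first exact: oner_neq0.
rewrite word_pull_cons xp_pull_min //; last first.
  by rewrite /= lexx (order_path_min le_trans).
by rewrite mulf_neq0 ?xp_pull_coef_head ?IH //; apply: path_sorted hs.
Qed.

(** Up to the first difference both words lose the same letter. There the letter of L is smaller
    than every remaining letter of L', so nothing can be removed. *)
Lemma word_pull_lex L L' : sorted <=%O L -> sorted <=%O L' -> lexlt L L' -> word_pull L L' = 0.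
Proof.
elim: L L' => [|l L IH] [|l' L'] // hs hs' h.
rewrite /= in h; rewrite word_pull_cons xp_pull_min //; last first.
  have ll' : l <= l' by case/orP: h => [/ltW //|/andP[/eqP-> _]].
  rewrite /= ll'; apply: sub_all (order_path_min le_trans hs') => x.
  exact: le_trans.
case/orP: h => [h|/andP[_ h]]; first by rewrite /= gt_eqF ?mul0r.
by rewrite /= IH ?mulr0 //; [apply: path_sorted hs | apply: path_sorted hs'].
Qed.

Lemma lexlt_total L L' : size L = size L' -> [|| L == L', lexlt L L' | lexlt L' L].
Proof.
elim: L L' => [|l L IH] [|l' L'] //= [/IH h].
by rewrite eqseq_cons [l' == l]eq_sym; case: ltgtP => //= _; rewrite ?orbT.
Qed.
Lemma lexlt_trans : transitive lexlt.
Proof.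
elim=> [|b B IH] [|a A] [|c C] //= /orP[h1|/andP[/eqP-> h1]] /orP[h2|/andP[/eqP e2 h2]].
- by rewrite (lt_trans h1 h2).
- by rewrite -e2 h1.
- by rewrite h2.
- by rewrite e2 eqxx (IH _ _ h1 h2) orbT.
Qed.

(** The leading word is the longest one, and among these the lexicographically least, because
    [word_pull L] vanishes on other lengths and on lexicographically larger sorted words. *)
Lemma lex_min_exists (Ls : seq (seq int)) L0 : L0 \in Ls ->
  exists2 L, L \in Ls & forall L', L' \in Ls ->
    [|| L' == L, (size L' < size L)%N | (size L' == size L) && lexlt L L'].
Proof.
elim: Ls L0 => // L1 Ls IH L0 _.
case: Ls IH => [|L2 Ls] IH.
  by exists L1; rewrite ?mem_head // => L'; rewrite inE => ->.
have [L hL hmin] := IH L2 (mem_head _ _).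
have hcase : [|| L1 == L, (size L1 < size L)%N, (size L1 == size L) && lexlt L L1 |
    (size L < size L1)%N || (size L1 == size L) && lexlt L1 L].
  case: (ltngtP (size L1) (size L)) => h; rewrite ?orbT //=.
  by have /or3P[/eqP->|->|->] := lexlt_total h; rewrite ?eqxx ?orbT.
have [h1|h1] := boolP ([|| L1 == L, (size L1 < size L)%N | (size L1 == size L) && lexlt L L1]).
  by exists L; [rewrite inE hL orbT | move=> L'; rewrite inE => /orP[/eqP->|/hmin]].
have {hcase} h2 : (size L < size L1)%N || (size L1 == size L) && lexlt L1 L.
  by move: h1 hcase; case: (L1 == L) => //=; case: (_ < _)%N => //=; case: (_ && _).
exists L1; first exact: mem_head.
move=> L'; rewrite inE => /orP[->//|/hmin /or3P[/eqP->|h|/andP[/eqP h h']]].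
- by case/orP: h2 => [->|/andP[/eqP-> ->]]; rewrite ?eqxx ?orbT.
- case/orP: h2 => [h2|/andP[/eqP-> _]]; last by rewrite h orbT.
  by rewrite (ltn_trans h h2) orbT.
- rewrite h; case/orP: h2 => [->|/andP[/eqP-> h2]]; rewrite ?orbT //.
  by rewrite eqxx (lexlt_trans h2 h') !orbT.
Qed.
End WordPairing.

(** * Formal combinations of words and their lowering *)

Section WordVectors.
Variables (F : fieldType) (W M : lmodType F) (io : {linear M -> W}).
Variables (x : int -> {linear W -> W}).
Implicit Types (L : seq int) (f : seq (seq int * M)) (t : seq int -> F).

Fixpoint word L m : W := if L is l :: L' then x l (word L' m) else io m.
Definition vec f : W := \sum_(p <- f) word p.1 p.2.
(** Evaluated on formal combinations, since it is not known to depend only on the vector that they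
    represent. *)
Definition pairing t f : M := \sum_(p <- f) t p.1 *: p.2.

Lemma word_linear L : linear (word L).
Proof. by move=> c m m'; elim: L => [|l L IH] /=; rewrite ?IH linearP. Qed.
HB.instance Definition _ L := GRing.isLinear.Build F M W *:%R (word L) (word_linear L).
Lemma vec_cat f f' : vec (f ++ f') = vec f + vec f'.
Proof. exact: big_cat. Qed.
Lemma pairing_cat t f f' : pairing t (f ++ f') = pairing t f + pairing t f'.
Proof. exact: big_cat. Qed.
Lemma vec_cons_map l c f :
  vec [seq (l :: u.1, c *: u.2) | u <- f] = c *: x l (vec f).
Proof.
rewrite /vec big_map linear_sum scaler_sumr; apply: eq_bigr => u _ /=.
by rewrite -[word u.1 _]/(word u.1 (c *: u.2)) !linearZ.
Qed.
Lemma vec_map c f : vec [seq (u.1, c *: u.2) | u <- f] = c *: vec f.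
Proof.
rewrite /vec big_map scaler_sumr; apply: eq_bigr => u _ /=.
by rewrite linearZ.
Qed.
Lemma pairing_cons_map t l c f :
  pairing t [seq (l :: u.1, c *: u.2) | u <- f] = c *: pairing (fun u => t (l :: u)) f.
Proof.
rewrite /pairing big_map scaler_sumr; apply: eq_bigr => u _ /=.
by rewrite !scalerA mulrC.
Qed.
Lemma pairing_map t c f : pairing t [seq (u.1, c *: u.2) | u <- f] = c *: pairing t f.
Proof.
rewrite /pairing big_map scaler_sumr; apply: eq_bigr => u _ /=.
by rewrite !scalerA mulrC.
Qed.
Lemma vec_flatten (I : Type) (fs : I -> seq (seq int * M)) r :
  vec (flatten [seq fs i | i <- r]) = \sum_(i <- r) vec (fs i).
Proof. by rewrite /vec big_flatten big_map. Qed.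
Lemma pairing_flatten t (I : Type) (fs : I -> seq (seq int * M)) r :
  pairing t (flatten [seq fs i | i <- r]) = \sum_(i <- r) pairing t (fs i).
Proof. by rewrite /pairing big_flatten big_map. Qed.

Section Lowering.
Variables (xp : int -> {linear W -> W}) (phi : nat -> {linear W -> W}).
Variables (phiM : nat -> {linear M -> M}) (g C : F) (G : nat -> F).
Hypotheses (g_neq0 : g != 0) (C_neq0 : C != 0).
Hypothesis xp_io : forall k m, xp k (io m) = 0.
Hypothesis xp_x : forall (k l : int) w, k + l < 0 ->
  xp k (x l w) = x l (xp k w) - (C * g ^ (l - k)) *: phi (absz (k + l)%R) w.
Hypothesis phi_x : forall (r : nat) (p : int) w,
  phi r (x p w) = \sum_(i < r.+1) (G i * g ^+ i) *: x (p - i%:Z) (phi (r - i)%N w).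
Hypothesis phi_io : forall r m, phi r (io m) = io (phiM r m).

(** An explicit representative of phi_r applied to a word, on which the functionals can be
    evaluated. *)
Fixpoint phil r L m : seq (seq int * M) :=
  if L is p :: L' then
    flatten [seq [seq (p - i%:Z :: u.1, (G i * g ^+ i) *: u.2) | u <- phil (r - i)%N L' m]
            | i <- iota 0 r.+1]
  else [:: ([::], phiM r m)].

Lemma phil_cons r p L m : phil r (p :: L) m =
  flatten [seq [seq (p - i%:Z :: u.1, (G i * g ^+ i) *: u.2) | u <- phil (r - i)%N L m]
          | i <- index_iota 0 r.+1].
Proof. by []. Qed.

Lemma vec_phil r L m : vec (phil r L m) = phi r (word L m).
Proof.
elim: L r => [|p L IH] r; first by rewrite /vec big_seq1 /= phi_io.
rewrite phil_cons vec_flatten [word _ _]/= phi_x big_mkord.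
by apply: eq_bigr => i _; rewrite vec_cons_map IH.
Qed.

(** The word absorbs j units of the degree r and the current of degree r - j reaches M. The power of
    g depends only on the amount absorbed and factors out. *)
Lemma pairing_phil t r L m :
  pairing t (phil r L m) = \sum_(j < r.+1) phiM (r - j)%N ((g ^+ j * phi_pull G j t L) *: m).
Proof.
elim: L r t => [|p L IH] r t.
  rewrite /pairing big_seq1 big_ord_recl /= subn0 expr0 mul1r -linearZ big1 ?addr0 // => j _.
  by rewrite /= mulr0 scale0r linear0.
rewrite phil_cons pairing_flatten big_mkord.
pose T i j : M := phiM (r - (i + j))%N ((G i * g ^+ i) *:
     ((g ^+ j * phi_pull G j (fun u => t (p - i%:Z :: u)) L) *: m)).
transitivity (\sum_(i < r.+1) \sum_(j < (r - i).+1) T i j).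
  apply: eq_bigr => i _; rewrite pairing_cons_map IH scaler_sumr.
  by apply: eq_bigr => j _; rewrite /T subnDA [RHS]linearZ.
rewrite sum_triangle_diag; apply: eq_bigr => j _.
rewrite phi_pull_cons mulr_sumr scaler_suml linear_sum; apply: eq_bigr => i _.
rewrite /T subnKC ?leq_ord // scalerA; congr (phiM _ (_ *: _)).
have e : g ^+ j = g ^+ i * g ^+ (j - i) by rewrite -exprD subnKC // leq_ord.
by rewrite e; ring.
Qed.

Lemma phil_bound r L m (B : int) p : p \in phil r L m -> all (<= B) L ->
  (size p.1 = size L) /\ all (<= B) p.1.
Proof.
elim: L r p => [|l L IH] r p; first by rewrite inE => /eqP ->.
rewrite phil_cons => /flattenP[? /mapP[i hi ->] /mapP[u hu ->]] /andP[lB LB] /=.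
have lB' : l <= B := lB.
by have [-> ->] := IH _ _ hu LB; split=> //; rewrite andbT; lia.
Qed.

Fixpoint xl (k : int) L m : seq (seq int * M) :=
  if L is l :: L' then
    [seq (l :: u.1, 1 *: u.2) | u <- xl k L' m]
    ++ [seq (u.1, - (C * g ^ (l - k)) *: u.2) | u <- phil (absz (k + l)%R) L' m]
  else [::].

Lemma vec_xl (k : int) L m (B : int) : all (<= B) L -> k + B < 0 ->
  vec (xl k L m) = xp k (word L m).
Proof.
move=> + kB; elim: L => [_|l L IH] /=; first by rewrite /vec big_nil xp_io.
move=> /andP[lB LB]; rewrite vec_cat vec_cons_map scale1r vec_map vec_phil IH //.
by rewrite xp_x ?scaleNr //; have lB' : l <= B := lB; lia.
Qed.

Lemma xl_bound k L m (B : int) p : p \in xl k L m -> all (<= B) L ->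
  ((size p.1).+1 = size L) /\ all (<= B) p.1.
Proof.
elim: L p => [|l L IH] p //=; rewrite mem_cat => /orP[] /mapP[u hu ->] /andP[lB LB] /=.
  by have [-> ->] := IH _ hu LB; rewrite lB.
by have [-> ->] := phil_bound hu LB.
Qed.

(** The index r is the degree of the current that reaches M, so that the word loses the weight e = -
    k - r. N is a common length for the sums coming from different letters l; the surplus terms
    vanish because there e < l. *)
Lemma pairing_xl t (k : int) L m (B : int) N : all (<= B) L -> k + B < 0 ->
  all (fun l => - k - l < N%:Z) L -> pairing t (xl k L m)
  = \sum_(r < N) phiM r ((- C * g ^ (- k - k - r%:Z) * xp_pull G (- k - r%:Z) t L) *: m).
Proof.
move=> + kB; elim: L t => [|l L IH] t.
  by move=> _ _; rewrite /pairing big_nil big1 // => r _; rewrite mulr0 scale0r linear0.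
move=> /andP[lB LB] /andP[lN LN]; rewrite [xl _ _ _]/= pairing_cat pairing_cons_map scale1r IH //.
rewrite pairing_map pairing_phil.
under [RHS]eq_bigr => r _ do rewrite xp_pull_cons mulrDr scalerDl linearD.
rewrite big_split /= addrC; congr (_ + _).
have lN' : - k - l < N%:Z := lN; have lB' : l <= B := lB.
have [r0 hr0] : exists r0 : nat, - k - l = r0%:Z by exists (absz (- k - l)%R); lia.
have -> : absz (k + l)%R = r0 by lia.
rewrite (reindex_inj rev_ord_inj) /= scaler_sumr.
rewrite (big_ord_widen N (fun j => - (C * g ^ (l - k)) *: phiM (r0 - (r0 - j))%N
  ((g ^+ (r0 - j) * phi_pull G (r0 - j) t L) *: m))); last by lia.
rewrite big_mkcond /=; apply: eq_bigr => r _; case: ltnP => hr; last first.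
  by rewrite ifF ?mulr0 ?scale0r ?linear0 //; apply/negbTE; lia.
rewrite ifT; last by lia.
rewrite subKn // -linearZ scalerA; congr (phiM _ (_ *: _)).
have -> : absz (- k - r%:Z - l)%R = (r0 - r)%N by lia.
rewrite mulrA; congr (_ * _).
have -> : - k - k - r%:Z = (l - k) + (r0 - r)%N%:Z by lia.
have -> : g ^ ((l - k) + (r0 - r)%N%:Z) = g ^ (l - k) * g ^+ (r0 - r).
  by rewrite (expfzDr (l - k)).
by rewrite !mulNr mulrA.
Qed.

Definition xf k f := flatten [seq xl k p.1 p.2 | p <- f].

Hypothesis phi_family : forall (Z : int -> M) (S : seq int) l (B : int),
  (forall e, Z e != 0 -> e \in S) -> Z l != 0 ->
  exists2 k : int, k < B & forall N, (forall e, e \in S -> (- k - e < N%:Z)%R) ->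
    \sum_(r < N) phiM r (g^-1 ^+ r *: Z (- k - r%:Z)) != 0.

(** Up to a nonzero scalar, the new pairing is the sum in [phi_family] for the family Z, and the
    hypothesis on f says that Z l is nonzero. *)
Lemma lowering_step l e f (B : int) :
  (forall p, p \in f -> all (<= B) p.1) -> pairing (word_pull G (l :: e)) f != 0 ->
  exists k, [/\ vec (xf k f) = xp k (vec f),
     forall p, p \in xf k f -> all (<= B) p.1,
     forall n, (forall p, p \in f -> (size p.1 <= n.+1)%N) ->
               forall p, p \in xf k f -> (size p.1 <= n)%N
     & pairing (word_pull G e) (xf k f) != 0].
Proof.
move=> fB hf; pose Z e' := pairing (xp_pull G e' (word_pull G e)) f.
(* The functionals are homogeneous in the weight, so Z is supported on the weights of f minus that
   of e. *)
pose S := [seq wsum p.1 - wsum e | p <- f].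
have hS e' : Z e' != 0 -> e' \in S.
  apply: contraR => he'; rewrite /Z /pairing big_seq big1 // => p hp.
  rewrite (@xp_pull_sum _ G (wsum e)) ?scale0r // => [u hu|]; first exact: word_pull_sum.
  apply: contraNneq he' => h; apply/mapP; exists p => //; rewrite h; lia.
(* The bound gives k + B < 0, so that [xp_x] applies to every letter of f. *)
have [k kB hk] := phi_family (- B - 1) hS hf.
have kB' : k + B < 0 by lia.
exists k; split.
- rewrite vec_flatten [in RHS]/vec linear_sum !big_seq; apply: eq_bigr => p hp.
  by rewrite (vec_xl _ (fB _ hp) kB').
- by move=> p /flattenP[? /mapP[u hu ->] hp]; have [] := xl_bound hp (fB _ hu).
- move=> n hn p /flattenP[? /mapP[u hu ->] hp].
  by have [h _] := xl_bound hp (fB _ hu); rewrite -ltnS h hn.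
have [N [hN1 hN2]] : exists N : nat, (forall e', e' \in S -> - k - e' < N%:Z)
    /\ forall p, p \in f -> all (fun l => - k - l < N%:Z) p.1.
  have fin (T : seq int) : exists N : nat, forall e', e' \in T -> - k - e' < N%:Z.
    elim: T => [|a T [N hN]]; first by exists 0%N.
    exists (maxn N (absz (- k - a)%R).+1) => e'; rewrite inE => /orP[/eqP ->|/hN]; lia.
  have [N1 h1] := fin S; have [N2 h2] := fin (flatten (map fst f)).
  exists (maxn N1 N2); split=> [e' /h1|p hp]; first lia.
  apply/allP => l' hl'; have : l' \in flatten (map fst f).
    by apply/flattenP; exists p.1 => //; apply: map_f.
  by move/h2; lia.
have := hk N hN1; apply: contra => /eqP h0.
have e1 : pairing (word_pull G e) (xf k f) = (- C * g ^ (- k - k)) *: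
    \sum_(r < N) phiM r (g^-1 ^+ r *: Z (- k - r%:Z)).
  rewrite pairing_flatten big_seq.
  rewrite (eq_bigr _ (fun p hp => pairing_xl (word_pull G e) p.2 (fB _ hp) kB' (hN2 _ hp))).
  rewrite exchange_big /= scaler_sumr; apply: eq_bigr => r _.
  rewrite -linear_sum -linearZ /Z /pairing scalerA scaler_sumr big_seq; congr (phiM r _).
  apply: eq_bigr => p _; rewrite scalerA; congr (_ * _ *: _).
  by rewrite -mulrA; congr (_ * _); rewrite expfzDr // -invr_expz exprVn.
have := h0; rewrite e1 => /eqP; rewrite scaler_eq0 => /orP[|//].
by rewrite mulf_eq0 oppr_eq0 (negbTE C_neq0) (negbTE (expfz_neq0 _ g_neq0)).
Qed.

(** Each step consumes one letter of e. When e is empty all words are, and the functional returns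
    the coefficient in M. *)
Lemma lowering (Q : W -> Prop) e f (B : int) : (forall k w, Q w -> Q (xp k w)) ->
  (forall p, p \in f -> all (<= B) p.1) ->
  (forall p, p \in f -> (size p.1 <= size e)%N) ->
  pairing (word_pull G e) f != 0 -> Q (vec f) -> exists2 m, m != 0 & Q (io m).
Proof.
move=> QX; elim: e f => [|l e IH] f fB fn hf Qf.
  exists (pairing (word_pull G [::]) f) => //; suff <- : vec f = io (pairing (word_pull G [::]) f) by [].
  rewrite /vec /pairing linear_sum !big_seq; apply: eq_bigr => -[[|l L] m] hp.
    by rewrite /= scale1r.
  by have := fn _ hp.
have [k [h1 h2 h3 h4]] := lowering_step fB hf.
by apply: (IH (xf k f)) => //; [apply: h3 | rewrite h1; apply: QX].
Qed.
End Lowering.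
End WordVectors.

(** * Sorting words by the quadratic relations *)

Section Straightening.
Variables (F : fieldType) (W M : lmodType F) (io : {linear M -> W}).
Variables (x : int -> {linear W -> W}) (t : F).
Hypothesis two_neq0 : (2%:R : F) != 0.
Hypothesis x_quad : forall (k l : int) w,
  x (k + 1) (x l w) - t *: x l (x (k + 1) w)
  = t *: x k (x (l + 1) w) - x (l + 1) (x k w).
Implicit Types (L : seq int) (f : seq (seq int * M)).
Local Notation word := (word io x).
Local Notation vec := (vec io x).

Definition sorted_form (w : W) : Prop :=
  exists2 f, (forall p, p \in f -> sorted <=%O p.1) & w = vec f.

Lemma sorted_formD w w' : sorted_form w -> sorted_form w' -> sorted_form (w + w').
Proof.
move=> [f hf ->] [f' hf' ->]; exists (f ++ f'); last by rewrite vec_cat.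
by move=> p; rewrite mem_cat => /orP[/hf|/hf'].
Qed.
Lemma sorted_formZ c w : sorted_form w -> sorted_form (c *: w).
Proof.
move=> [f hf ->]; exists [seq (u.1, c *: u.2) | u <- f]; last by rewrite vec_map.
by move=> _ /mapP[u hu ->] /=; apply: hf.
Qed.

Definition gap (hi : int) L : nat := \sum_(l <- L) absz (hi - l).
(** Each letter contributes its distance to hi once for every letter before it. The measure thus
    falls when, at constant sum and below hi, the second letter of an adjacent pair grows. *)
Fixpoint wt hi L : nat := if L is l :: L' then wt hi L' + gap hi L' else 0%N.

Lemma gap_cons hi l L : gap hi (l :: L) = (absz (hi - l) + gap hi L)%N.
Proof. exact: big_cons. Qed.

Lemma wt_cat hi L1 L L' : gap hi L = gap hi L' -> (wt hi L < wt hi L')%N ->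
  (wt hi (L1 ++ L) < wt hi (L1 ++ L'))%N.
Proof.
move=> e h; elim: L1 => //= l L1 IH.
have -> : gap hi (L1 ++ L) = gap hi (L1 ++ L') by rewrite /gap !big_cat /= -!/(gap _ _) e.
by rewrite ltn_add2r.
Qed.

Lemma unsorted_split L : ~~ sorted <=%O L ->
  exists L1 (a b : int) L2, L = L1 ++ a :: b :: L2 /\ b < a.
Proof.
elim: L => // a [|b L] IH //=; rewrite negb_and -ltNge => /orP[ba|hL].
  by exists [::], a, b, L.
by have [L1 [a' [b' [L2 [e h]]]]] := IH hL; exists (a :: L1), a', b', L2; rewrite e.
Qed.

Lemma word_quad L1 L2 a b m : word (L1 ++ a :: b :: L2) m =
  t *: word (L1 ++ b :: a :: L2) m + t *: word (L1 ++ (a - 1) :: (b + 1) :: L2) m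
  - word (L1 ++ (b + 1) :: (a - 1) :: L2) m.
Proof.
elim: L1 => [|l L1 IH] /=; last by rewrite IH linearB linearD !linearZ.
have /eqP := x_quad (a - 1) b (word L2 m).
by rewrite subrK subr_eq => /eqP ->; lmod F W.
Qed.

Lemma word_sorted_form L m : sorted_form (word L m).
Proof.
have [hi hL] : exists hi : int, all (<= hi) L.
  elim: L => [|l L [hi h]]; first by exists 0.
  exists (Order.max hi l); rewrite /= le_max lexx orbT /=.
  by apply: sub_all h => z /= hz; rewrite le_max hz.
have [n] := ubnP (wt hi L); elim: n L hL => // n IH L hL hn.
have [sL|/unsorted_split[L1 [a [b [L2 [e ba]]]]]] := boolP (sorted <=%O L).
  by exists [:: (L, m)]; [move=> p; rewrite inE => /eqP -> | rewrite /vec big_seq1].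
subst L; move: hL; rewrite all_cat /= => /and4P[h1 ha hb h2].
have ha' : a <= hi := ha; have hb' : b <= hi := hb.
(* All words on the right of [word_quad] have this form, except the last one when a - 1 = b. *)
have hwt (c d : int) : c + d = a + b -> c <= hi -> b < d -> d <= hi ->
    sorted_form (word (L1 ++ c :: d :: L2) m).
  move=> ecd hc hd hd'; apply: IH; first by rewrite all_cat /= h1 hc hd' h2.
  have : (wt hi (L1 ++ c :: d :: L2) < wt hi (L1 ++ a :: b :: L2))%N.
    by apply: wt_cat; rewrite ?gap_cons /= ?gap_cons; lia.
  by move=> h; apply: leq_trans h _.
have [e|ne] := eqVneq (a - 1) b; last first.
  rewrite word_quad -scaleN1r; apply: sorted_formD; last first.
    by apply/sorted_formZ/hwt; lia.
  by apply: sorted_formD; apply/sorted_formZ/hwt; lia.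
(* Now the last word is the original one and the first two coincide: the relation reads 2 w = 2 t
   w', and 2 can be cancelled. *)
have e2 : word (L1 ++ a :: b :: L2) m = t *: word (L1 ++ b :: a :: L2) m.
  apply: (scalerI two_neq0); have := word_quad L1 L2 a b m.
  rewrite e (_ : b + 1 = a); last by lia.
  move=> /eqP; rewrite eq_sym subr_eq => /eqP h.
  by rewrite scaler_nat mulr2n -h scaler_nat mulr2n.
by rewrite e2; apply/sorted_formZ/hwt; lia.
Qed.

Lemma vec_sorted_form f : sorted_form (vec f).
Proof.
elim: f => [|p f IH]; first by exists [::].
rewrite /vec big_cons; apply: sorted_formD => //; exact: word_sorted_form.
Qed.

Section Nondegeneracy.
Variables (xp : int -> {linear W -> W}) (phi : nat -> {linear W -> W}).
Variables (phiM : nat -> {linear M -> M}) (g C : F) (G : nat -> F).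
Hypotheses (g_neq0 : g != 0) (C_neq0 : C != 0).
Hypothesis G0_neq0 : G 0%N != 0.
Hypothesis G_neq0 : forall c, (0 < c)%N -> \sum_(i < c) G 0%N ^+ i != 0.
Hypothesis xp_io : forall k m, xp k (io m) = 0.
Hypothesis xp_x : forall (k l : int) w, k + l < 0 ->
  xp k (x l w) = x l (xp k w) - (C * g ^ (l - k)) *: phi (absz (k + l)%R) w.
Hypothesis phi_x : forall (r : nat) (p : int) w,
  phi r (x p w) = \sum_(i < r.+1) (G i * g ^+ i) *: x (p - i%:Z) (phi (r - i)%N w).
Hypothesis phi_io : forall r m, phi r (io m) = io (phiM r m).
Hypothesis phi_family : forall (Z : int -> M) (S : seq int) l (B : int),
  (forall e, Z e != 0 -> e \in S) -> Z l != 0 ->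
  exists2 k : int, k < B & forall N, (forall e, e \in S -> (- k - e < N%:Z)%R) ->
    \sum_(r < N) phiM r (g^-1 ^+ r *: Z (- k - r%:Z)) != 0.

(** Equal words are collected and zero coefficients dropped; since the vector is nonzero something
    remains. Of the remaining words only the leading one pairs nontrivially with its own
    functional. *)
Lemma pairing_nondegenerate f : (forall p, p \in f -> sorted <=%O p.1) -> vec f != 0 ->
  exists e f', [/\ vec f' = vec f, forall p, p \in f' -> (size p.1 <= size e)%N
                 & pairing (word_pull G e) f' != 0].
Proof.
move=> sf f0; pose m L := \sum_(p <- f | p.1 == L) p.2.
pose ws := [seq L <- undup (map fst f) | m L != 0].
have uws : uniq ws by rewrite filter_uniq ?undup_uniq.
have vf : vec f = \sum_(L <- ws) word L (m L).
  rewrite /vec (@sum_by_key _ _ _ f fst _ (undup (map fst f))) ?undup_uniq //; last first.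
    by apply/allP => p hp; rewrite mem_undup map_f.
  rewrite /ws big_filter [RHS]big_mkcond; apply: eq_bigr => L _.
  have -> : \sum_(p <- f | p.1 == L) word p.1 p.2 = word L (m L).
    by rewrite /m linear_sum; apply: eq_bigr => p /eqP ->.
  by case: eqP => // ->; rewrite linear0.
have [L1 hL1] : exists L1, L1 \in ws.
  case: (ws) vf => [|L1 ? _]; last by exists L1; rewrite mem_head.
  by rewrite big_nil => /eqP; rewrite (negbTE f0).
have [L0 hL0 hmin] := lex_min_exists hL1.
have sws L : L \in ws -> sorted <=%O L.
  by rewrite mem_filter mem_undup => /andP[_ /mapP[p /sf h ->]].
exists L0, [seq (L, m L) | L <- ws]; split.
- by rewrite vf /vec big_map.
- move=> _ /mapP[L hL ->] /=; have /or3P[/eqP->//|/ltnW//|/andP[/eqP->]//] := hmin _ hL.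
rewrite /pairing big_map (bigD1_seq L0) //= big_seq_cond big1 ?addr0; last first.
  move=> L /andP[hL ne]; have /or3P[e|h|/andP[_ h]] := hmin _ hL.
  - by rewrite e in ne.
  - by rewrite word_pull_size ?scale0r // neq_ltn h.
  - by rewrite word_pull_lex ?scale0r //; apply: sws.
rewrite scaler_eq0 negb_or word_pull_diag ?sws //.
by move: hL0; rewrite mem_filter => /andP[].
Qed.

Lemma lowering_to_vacuum (Q : W -> Prop) w : (forall k w, Q w -> Q (xp k w)) ->
  (exists f, w = vec f) -> w != 0 -> Q w -> exists2 m, m != 0 & Q (io m).
Proof.
move=> QX [f0 ->]; have [f sf ->] := vec_sorted_form f0 => h0 hQ.
have [e [f' [h1 h2 h3]]] := pairing_nondegenerate sf h0.
have [B hB] : exists B : int, forall p, p \in f' -> all (<= B) p.1.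
  have [B hB] : exists B : int, all (<= B) (flatten (map fst f')).
    elim: (flatten _) => [|l L [hi h]]; first by exists 0.
    exists (Order.max hi l); rewrite /= le_max lexx orbT /=.
    by apply: sub_all h => z /= hz; rewrite le_max hz.
  exists B => p hp; apply/allP => l hl; apply: (allP hB).
  by apply/flattenP; exists p.1 => //; apply: map_f.
by apply: (lowering g_neq0 C_neq0 xp_io xp_x phi_x phi_io phi_family QX hB h2 h3); rewrite h1.
Qed.
End Nondegeneracy.
End Straightening.

(** * The quantum affine algebra *)

Section CqFacts.
Variable R : realType.

Lemma Cq_char0 n : (n.+1%:R : Cq R) != 0.
Proof.
rewrite -(rmorph_nat (@tofrac {poly R[i]})) tofrac_eq0 -polyC_natr polyC_eq0.
by rewrite pnatr_eq0.
Qed.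
Lemma qh_neq0 : qh R != 0.
Proof. by rewrite tofrac_eq0 polyX_eq0. Qed.
Lemma q_neq0 : q R != 0.
Proof. by rewrite expf_neq0 ?qh_neq0. Qed.
Lemma qhX_neq1 n : (0 < n)%N -> qh R ^+ n != 1.
Proof.
move=> n0; rewrite -rmorphXn -(rmorph1 (@tofrac {poly R[i]})) tofrac_eq.
by apply/negP => /eqP/(congr1 (fun p => size (polyseq p))); rewrite size_polyXn size_poly1; case: n n0.
Qed.
Lemma qh_exprz_neq1 (n : int) : n != 0 -> qh R ^ n != 1.
Proof.
case: n => [[|n]|n] // _; first exact: qhX_neq1.
by rewrite NegzE -invr_expz invr_eq1 qhX_neq1.
Qed.
Lemma q_exprz_neq1 (n : int) : n != 0 -> q R ^ n != 1.
Proof. by move=> n0; rewrite /q -[qh R ^+ 2]/(qh R ^ 2) exprz_exp qh_exprz_neq1 // mulf_neq0. Qed.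
Lemma qq_neq0 : q R - (q R)^-1 != 0.
Proof.
rewrite subr_eq0; apply: contra (q_exprz_neq1 (n := 2) isT) => /eqP e.
by rewrite -[q R ^ 2]/(q R * q R) {2}e mulfV ?q_neq0.
Qed.
End CqFacts.

Section FreeInduction.
Variables (F : fieldType) (X : choiceType).
Local Notation FA := (free_alg F X).

Lemma free_alg_ind (P : {pred FA}) : subalg_closed P ->
  (forall y, fgen F y \in P) -> forall u, u \in P.
Proof.
move=> [P1 PL PM] Pg u.
have P0 : 0 \in P by have := PL (-1) _ _ P1 P1; rewrite scaleN1r addNr.
have PZ c v : v \in P -> c *: v \in P by move=> /(PL c _ _)/(_ P0); rewrite addr0.
have PD v w : v \in P -> w \in P -> v + w \in P.
  by move=> hv hw; rewrite -[v]scale1r; apply: PL.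
have Pm (m : {fmonom X}) : (<< m >> : {malg F[{fmonom X}]}) \in P.
  rewrite -(fmK m); case: m => s /=; elim: s => [|y s IH].
    suff -> : (<< FMonom [::] >> : {malg F[{fmonom X}]}) = (1 : FA) by [].
    rewrite -[RHS]/(fone F X) fopE.
    by rewrite -fmoneE.
  suff -> : (<< FMonom (y :: s) >> : {malg F[{fmonom X}]})
      = (fgen F y * (<< FMonom s >> : {malg F[{fmonom X}]}) : FA) by apply: PM.
  rewrite -[RHS]/(fmul _ _) fopE /fgen unlock [RHS]fgmulUU mulr1.
  by congr (<< _ >>); apply: val_inj; rewrite /= fmM fmU.
(* The sum is formed with the locked operations of [free_alg], so it has to be compared with the sum
   in [malg] term by term. *)
have -> : u = \sum_(m <- msupp u) (fscale u@_m (<< m >> : {malg F[{fmonom X}]}) : FA).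
  have h (I : Type) (r : seq I) (G : I -> {malg F[{fmonom X}]}) :
      (\sum_(i <- r) (G i : FA) : FA) = \sum_(i <- r) G i.
    elim: r => [|i r IH]; first by rewrite !big_nil -[LHS]/(fzero F X) fopE.
    by rewrite !big_cons -IH -[LHS]/(fadd _ _) fopE.
  rewrite h {1}(monalgE u); apply: eq_bigr => m _.
  rewrite fopE; apply/malgP => m'.
  by rewrite mcoeffZ !mcoeffU mulrnAr mulr1.
by elim/big_ind: _ => // m _; apply: (PZ u@_m _ (Pm m)).
Qed.
End FreeInduction.

Section DrinfeldRelations.
Variable R : realType.
Local Notation FA := (free_alg (Cq R) qgen).
Local Notation U := (Uq R).
Local Notation q := (q R).
Local Notation qq := (q - q^-1).

Definition piU : FA -> U := qpi (@drinfeld_rel R).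
Fact piU_zmod : zmod_morphism piU. Proof. exact: qpiB. Qed.
Fact piU_monoid : monoid_morphism piU. Proof. exact: qpi_monoid_morphism. Qed.
Fact piU_scal : scalable piU. Proof. exact: qpi_scalable. Qed.
HB.instance Definition _ := GRing.isZmodMorphism.Build FA U piU piU_zmod.
HB.instance Definition _ := GRing.isMonoidMorphism.Build FA U piU piU_monoid.
HB.instance Definition _ := GRing.isScalable.Build (Cq R) FA U *:%R piU piU_scal.

Lemma piU_rel l r : drinfeld_rel l r -> piU l = piU r.
Proof. by move=> h; apply/qpi_eq/rel_ideal_rel. Qed.
Lemma piUZ c u : piU (c *: u) = c *: piU u.
Proof. exact: linearZ. Qed.
Lemma piUB u w : piU (u - w) = piU u - piU w.
Proof. exact: rmorphB. Qed.
Lemma piUM u w : piU (u * w) = piU u * piU w.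
Proof. exact: rmorphM. Qed.
Lemma piU_surj (u : U) : exists w, u = piU w.
Proof. by exists (repr u); rewrite /piU qpi_repr. Qed.

Definition ugh (m : int) : U :=
  match m with Posz n => ugam R ^+ n | Negz n => ugamV R ^+ n.+1 end.
Lemma piU_gamma m : piU (gamma_half R m) = ugh m.
Proof. by case: m => n; rewrite /gamma_half rmorphXn. Qed.

Lemma UgamC (u : U) : ugam R * u = u * ugam R.
Proof. by have [w ->] := piU_surj u; rewrite -!(rmorphM piU); apply/piU_rel/RgamC. Qed.
Lemma UgamVC (u : U) : ugamV R * u = u * ugamV R.
Proof. by have [w ->] := piU_surj u; rewrite -!(rmorphM piU); apply/piU_rel/RgamVC. Qed.
Lemma UghC m (u : U) : ugh m * u = u * ugh m.
Proof. by case: m => n; apply/commr_sym/commrX; rewrite /GRing.comm ?UgamC ?UgamVC. Qed.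
Lemma UggV : ugam R * ugamV R = 1.
Proof. by rewrite -piUM -(rmorph1 piU); apply/piU_rel/RggV. Qed.
Lemma UgVg : ugamV R * ugam R = 1.
Proof. by rewrite -piUM -(rmorph1 piU); apply/piU_rel/RgVg. Qed.
Lemma UKKV : uK R * uKV R = 1.
Proof. by rewrite -piUM -(rmorph1 piU); apply/piU_rel/RKKV. Qed.
Lemma UKVK : uKV R * uK R = 1.
Proof. by rewrite -piUM -(rmorph1 piU); apply/piU_rel/RKVK. Qed.
Lemma UDDV : uD R * uDV R = 1.
Proof. by rewrite -piUM -(rmorph1 piU); apply/piU_rel/RDDV. Qed.
Lemma UDVD : uDV R * uD R = 1.
Proof. by rewrite -piUM -(rmorph1 piU); apply/piU_rel/RDVD. Qed.
Lemma piU_bracket u w : piU (bracket u w) = piU u * piU w - piU w * piU u.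
Proof. by rewrite /bracket piUB !piUM. Qed.
Lemma UKh s : uK R * uh R s = uh R s * uK R.
Proof.
by apply/eqP; rewrite -subr_eq0 -(piU_bracket (fK R)) (piU_rel (RKh R s)) rmorph0.
Qed.
Lemma conj_skew (a aV b : U) (c : Cq R) : aV * a = 1 -> a * b * aV = c *: b ->
  a * b = c *: (b * a).
Proof. by move=> h e; rewrite scalerAl -e -!mulrA h mulr1. Qed.
Lemma UDh s : uD R * uh R s = q ^ (val s) *: (uh R s * uD R).
Proof.
by apply: (conj_skew UDVD); have := piU_rel (RDh R s); rewrite piUZ !piUM.
Qed.
Lemma UDx e r : uD R * ux R e r = q ^ r *: (ux R e r * uD R).
Proof.
by apply: (conj_skew UDVD); have := piU_rel (RDx R e r); rewrite piUZ !piUM.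
Qed.
Lemma UKx e r : uK R * ux R e r = q ^ (2 * sg e) *: (ux R e r * uK R).
Proof.
by apply: (conj_skew UKVK); have := piU_rel (RKx R e r); rewrite piUZ !piUM.
Qed.
Lemma UhhE (k l : nzint) : uh R k * uh R l - uh R l * uh R k =
  if val k == - val l then
       (qint R (2 * val k) / (val k)%:~R / qq) *: (ugh (2 * val k) - ugh (- (2 * val k)))
     else 0.
Proof.
rewrite -(piU_bracket (fh R k)) (piU_rel (Rhh R k l)).
by case: ifP => _; rewrite ?rmorph0 // piUZ piUB !piU_gamma.
Qed.
Lemma Uhx (k : nzint) e l : uh R k * ux R e l - ux R e l * uh R k =
  ((sg e)%:~R * qint R (2 * val k) / (val k)%:~R)
       *: (ugh (- sg e * `|val k|) * ux R e (val k + l)).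
Proof.
by rewrite -(piU_bracket (fh R k)) (piU_rel (Rhx R k e l)) piUZ piUM piU_gamma.
Qed.
Lemma Uxx e k l : ux R e (k + 1) * ux R e l - q ^ (2 * sg e) *: (ux R e l * ux R e (k + 1))
  = q ^ (2 * sg e) *: (ux R e k * ux R e (l + 1)) - ux R e (l + 1) * ux R e k.
Proof.
by have := piU_rel (Rxx R e k l); rewrite !piUB !piUZ !piUM.
Qed.

Definition upsi k : U := piU (psi R k).
Definition uphi k : U := piU (phi R k).
Lemma Uxpxm k l : ux R true k * ux R false l - ux R false l * ux R true k
  = qq^-1 *: (ugh (k - l) * upsi (k + l) - ugh (l - k) * uphi (k + l)).
Proof.
rewrite -(piU_bracket (fx R true k)) (piU_rel (Rxpxm R k l)) piUZ piUB !piUM.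
by rewrite !piU_gamma.
Qed.

Definition hposU n : U := piU (hpos R n).
Definition hnegU n : U := piU (hneg R n).
Lemma upsi_Posz n : upsi (Posz n) = uK R * expc (fun l => qq *: hposU l) n.
Proof.
rewrite /upsi piUM; congr (_ * _); rewrite -[exp_coef _ _]/(expc _ _) expc_morph.
by congr (expc _ n); apply/funext => l; rewrite /= piUZ.
Qed.
Lemma uphi_opp n : uphi (- Posz n) = uKV R * expc (fun l => - qq *: hnegU l) n.
Proof.
rewrite /uphi /phi opprK piUM; congr (_ * _); rewrite -[exp_coef _ _]/(expc _ _) expc_morph.
by congr (expc _ n); apply/funext => l; rewrite /= piUZ.
Qed.
Lemma upsi_lt0 k : k < 0 -> upsi k = 0.
Proof. by case: k => // n _; rewrite /upsi rmorph0. Qed.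

Lemma hposUC i j : hposU i * hposU j = hposU j * hposU i.
Proof. by apply/eqP; rewrite -subr_eq0 UhhE /=. Qed.
Lemma hnegUC i j : hnegU i * hnegU j = hnegU j * hnegU i.
Proof. by apply/eqP; rewrite -subr_eq0 UhhE /=. Qed.
Lemma UKVh s : uKV R * uh R s = uh R s * uKV R.
Proof. by rewrite -[LHS]mulr1 -UKKV -mulrA [uh R s * _]mulrA -UKh !mulrA UKVK mul1r. Qed.

Lemma rec_upsi : exp_rec (uK R) (fun l => qq *: hposU l) (fun n => upsi (Posz n)).
Proof.
have [] := @exp_rec_expc _ _ (Cq_char0 R) (fun l => qq *: hposU l) _ (uK R).
- by move=> i j; rewrite -!scalerAl -!scalerAr hposUC.
- by move=> l; rewrite -scalerAl -scalerAr; congr (_ *: _); apply: UKh.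
by move=> e1 e2; split=> [|n]; rewrite !upsi_Posz ?e1 // e2; apply: eq_bigr => l _; rewrite upsi_Posz.
Qed.
Lemma rec_uphi : exp_rec (uKV R) (fun l => - qq *: hnegU l) (fun n => uphi (- Posz n)).
Proof.
have [] := @exp_rec_expc _ _ (Cq_char0 R) (fun l => - qq *: hnegU l) _ (uKV R).
- by move=> i j; rewrite -!scalerAl -!scalerAr hnegUC.
- by move=> l; rewrite -scalerAl -scalerAr; congr (_ *: _); apply: UKVh.
by move=> e1 e2; split=> [|n]; rewrite !uphi_opp ?e1 // e2; apply: eq_bigr => l _; rewrite uphi_opp.
Qed.

Lemma Uq_ind (P : {pred U}) : subalg_closed P -> (forall e k, ux R e k \in P) ->
  (forall s, uh R s \in P) -> uK R \in P -> uKV R \in P -> ugam R \in P ->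
  ugamV R \in P -> uD R \in P -> uDV R \in P -> forall u, u \in P.
Proof.
move=> [P1 PL PM] Px Ph PK PKV Pg PgV PD PDV u; have [w ->] := piU_surj u.
apply: (@free_alg_ind _ _ [pred w | piU w \in P]) => [|g].
  split=> [|c u1 u2|u1 u2]; rewrite !inE ?rmorph1 //.
    by rewrite linearP; apply: PL.
  by rewrite piUM; apply: PM.
by case: g => [e k|s| | | | | |]; rewrite inE;
  [exact: Px|exact: Ph|exact: PK|exact: PKV|exact: Pg|exact: PgV|exact: PD|exact: PDV].
Qed.
End DrinfeldRelations.

(** * Modules over an algebra as vector spaces over the field *)

Section AlgebraModule.
Variables (F : fieldType) (A : algType F) (N : lmodType A).
Definition over_field : lmodType F := res_scalars (GRing.in_alg A) N.
Local Notation NF := over_field.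
Definition scaleby (u : A) (w : NF) : NF := u *: (w : N).
Lemma scaleby_lin u : linear (scaleby u).
Proof.
move=> c w w'; transitivity (u *: (c%:A *: (w : N)) + u *: (w' : N)).
  exact: (@scalerDr _ N).
congr (_ + _); rewrite [LHS](@scalerA _ N) -scalerAr mulr1 -[u in c *: u]mul1r scalerAl.
exact: (esym (@scalerA _ N _ _ _)).
Qed.
HB.instance Definition _ u := GRing.isLinear.Build F NF NF *:%R (scaleby u) (scaleby_lin u).
Lemma scalebyM u u' w : scaleby (u * u') w = scaleby u (scaleby u' w).
Proof. exact: (esym (@scalerA _ N _ _ _)). Qed.
Lemma scaleby1 w : scaleby 1 w = w. Proof. exact: (@scale1r _ N). Qed.
Lemma scaleby0 w : scaleby 0 w = 0. Proof. exact: (@scale0r _ N). Qed.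
Lemma scalebyL c u u' w : scaleby (c *: u + u') w = c *: scaleby u w + scaleby u' w.
Proof.
transitivity ((c *: u) *: (w : N) + u' *: (w : N)); first exact: (@scalerDl _ N).
congr (_ + _); rewrite -[u in LHS]mul1r scalerAl.
exact: (esym (@scalerA _ N _ _ _)).
Qed.
Lemma scalebyZ c u w : scaleby (c *: u) w = c *: scaleby u w.
Proof. by rewrite -[c *: u]addr0 scalebyL scaleby0 addr0. Qed.
Lemma scalebyB u u' w : scaleby (u - u') w = scaleby u w - scaleby u' w.
Proof. by rewrite -[- u']scaleN1r addrC scalebyL scaleN1r addrC. Qed.

Variables (w0 : NF) (w0_neq0 : w0 != 0).
(** In the endomorphism algebra a central element acting by a scalar becomes that scalar, and the
    crossing lemmas for currents apply. *)
Definition scaleby_endo (u : A) : endo w0_neq0 := mk_endo w0_neq0 (scaleby_lin u).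
Lemma scaleby_endoM u u' : scaleby_endo (u * u') = scaleby_endo u * scaleby_endo u'.
Proof. by apply: endoP => w; apply: scalebyM. Qed.
Lemma scaleby_endoL c u u' :
  scaleby_endo (c *: u + u') = c *: scaleby_endo u + scaleby_endo u'.
Proof. by apply: endoP => w; apply: scalebyL. Qed.
Lemma scaleby_endo1 : scaleby_endo 1 = 1.
Proof. by apply: endoP => w; apply: scaleby1. Qed.
End AlgebraModule.

(** * The module over the Borel-type subalgebra *)

Section BorelModule.
Variables (R : realType) (M : lmodType (Bdq R)).
Local Notation F := (Cq R).
Local Notation U := (Uq R).
Local Notation B := (subalg_gen (@Bdq_gen R)).

Definition MF : lmodType F := over_field M.

(** Elements outside the subalgebra go to the default 0. This keeps membership proofs out of [act];
    its sum and product rules ask for membership instead. *)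
Definition toB (u : U) : Bdq R := insubd 0 u.
Lemma toBK u : u \in B -> val (toB u) = u.
Proof. exact: insubdK. Qed.
Definition act (u : U) (m : MF) : MF := scaleby (toB u) m.
Lemma actE u (hu : u \in B) (m : M) : act u m = (Sub u hu : Bdq R) *: m.
Proof. by congr (_ *: m); apply: val_inj; rewrite /= toBK. Qed.

Lemma act_val (b : Bdq R) (m : M) : act (val b) m = b *: m.
Proof. by rewrite /act (_ : toB (val b) = b) //; apply: val_inj; apply/toBK/(valP b). Qed.

Lemma B_h s : uh R s \in B.
Proof.
apply/mem_subalg_gen/Bdq_Hq/mem_subalg_gen/Hq_Hprime/mem_subalg_gen.
exact: Hprime_h.
Qed.
Lemma B_gam : ugam R \in B.
Proof.
apply/mem_subalg_gen/Bdq_Hq/mem_subalg_gen/Hq_Hprime/mem_subalg_gen.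
exact: Hprime_gam.
Qed.
Lemma B_gamV : ugamV R \in B.
Proof.
apply/mem_subalg_gen/Bdq_Hq/mem_subalg_gen/Hq_Hprime/mem_subalg_gen.
exact: Hprime_gamV.
Qed.
Lemma B_D : uD R \in B.
Proof. exact/mem_subalg_gen/Bdq_Hq/mem_subalg_gen/Hq_D. Qed.
Lemma B_DV : uDV R \in B.
Proof. exact/mem_subalg_gen/Bdq_Hq/mem_subalg_gen/Hq_DV. Qed.
Lemma B_K : uK R \in B.
Proof. exact/mem_subalg_gen/Bdq_K. Qed.
Lemma B_KV : uKV R \in B.
Proof. exact/mem_subalg_gen/Bdq_KV. Qed.
Lemma B_xp k : ux R true k \in B.
Proof. exact/mem_subalg_gen/Bdq_xp. Qed.
Lemma B_closed : subalg_closed B.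
Proof. exact: subalg_gen_closed. Qed.

Lemma actM u w m : u \in B -> w \in B -> act (u * w) m = act u (act w m).
Proof.
move=> hu hw; have h : toB (u * w) = toB u * toB w.
  by apply: val_inj; rewrite /= !toBK // rpredM.
by rewrite /act h scalebyM.
Qed.
Lemma act0 m : act 0 m = 0.
Proof.
by rewrite /act (_ : toB 0 = 0) ?scaleby0 //; apply: val_inj; rewrite /= toBK ?rpred0.
Qed.
Lemma act1 m : act 1 m = m.
Proof.
by rewrite /act (_ : toB 1 = 1) ?scaleby1 //; apply: val_inj; rewrite /= toBK ?rpred1.
Qed.
Lemma actZ c u m : u \in B -> act (c *: u) m = c *: act u m.
Proof.
move=> hu; have h : toB (c *: u) = c *: toB u.
  by apply: val_inj; rewrite /= !toBK ?rpredZ.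
by rewrite /act h scalebyZ.
Qed.
Lemma actD u w m : u \in B -> w \in B -> act (u + w) m = act u m + act w m.
Proof.
move=> hu hw; have h : toB (u + w) = 1 *: toB u + toB w.
  by apply: val_inj; rewrite scale1r /= !toBK ?rpredD.
by rewrite /act h scalebyL scale1r.
Qed.
Lemma actB u w m : u \in B -> w \in B -> act (u - w) m = act u m - act w m.
Proof.
move=> hu hw; rewrite (_ : u - w = u + (-1) *: w); last by rewrite scaleN1r.
by rewrite actD ?rpredZ // actZ // scaleN1r.
Qed.
Lemma act_linear u : linear (act u).
Proof. exact: scaleby_lin. Qed.
HB.instance Definition _ u := GRing.isLinear.Build F MF MF *:%R (act u) (act_linear u).

Lemma Hq_closed_pred (S : MF -> Prop) : S 0 ->
  (forall c m m', S m -> S m' -> S (c *: m + m')) ->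
  (forall s m, S m -> S (act (uh R s) m)) ->
  (forall m, S m -> S (act (ugam R) m)) -> (forall m, S m -> S (act (ugamV R) m)) ->
  (forall m, S m -> S (act (uD R) m)) -> (forall m, S m -> S (act (uDV R) m)) ->
  forall (b : Hq R) m, S m -> S (Hq_Bdq R b *: (m : M)).
Proof.
move=> S0 SL Sh Sg SgV SD SDV b.
(* Membership in the subalgebra is carried along because [actM] and [actD] require it. *)
pose P : {pred U} := [pred u | `[< u \in B /\ forall m, S m -> S (act u m) >]].
have PC : subalg_closed P.
  split=> [|c u w /asboolP[hu hu'] /asboolP[hw hw']|u w /asboolP[hu hu'] /asboolP[hw hw']].
  - by apply/asboolP; split=> [|m]; rewrite ?rpred1 ?act1.
  - apply/asboolP; split=> [|m hm]; first by rewrite rpredD ?rpredZ.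
    by rewrite actD ?rpredZ // actZ //; apply: SL; auto.
  - apply/asboolP; split=> [|m hm]; first by rewrite rpredM.
    by rewrite actM; auto.
have hP : val b \in P.
  apply: (subalg_gen_sub PC _ (valP b)) => _ [y|/=|/=].
  - apply: (subalg_gen_sub PC) => _ [||s]; apply/asboolP; split; auto.
    + exact: B_gam.
    + exact: B_gamV.
    + exact: B_h.
  - by apply/asboolP; split; [exact: B_D|].
  - by apply/asboolP; split; [exact: B_DV|].
move=> m hm; have [hb hS] := asboolW hP.
by rewrite -(act_val (Hq_Bdq R b) m); apply: hS.
Qed.

Hypothesis irrM : irreducible (res_scalars (Hq_Bdq R) M).

(** Irreducibility in the form of an induction principle that starts from one nonzero vector. *)
Lemma Hq_irreducible (S : MF -> Prop) : S 0 ->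
  (forall c m m', S m -> S m' -> S (c *: m + m')) ->
  (forall s m, S m -> S (act (uh R s) m)) ->
  (forall m, S m -> S (act (ugam R) m)) -> (forall m, S m -> S (act (ugamV R) m)) ->
  (forall m, S m -> S (act (uD R) m)) -> (forall m, S m -> S (act (uDV R) m)) ->
  forall m0, m0 != 0 -> S m0 -> forall m, S m.
Proof.
move=> S0 SL Sh Sg SgV SD SDV m0 m00 Sm0 m.
pose N : {pred res_scalars (Hq_Bdq R) M} := [pred m | `[< S m >]].
have hN : submod_closed N.
  split=> [|b u w /asboolP hu /asboolP hw]; first exact/asboolP.
  apply/asboolP; have := SL 1 _ _ (Hq_closed_pred S0 SL Sh Sg SgV SD SDV b hu) hw.
  by rewrite scale1r.
have [h|h] := irrM.2 N hN.
  have : m0 \in N by apply/asboolP.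
  by rewrite h inE (negbTE m00).
have hm : (m : res_scalars (Hq_Bdq R) M) \in N by rewrite h.
exact: asboolW hm.
Qed.
End BorelModule.

Section TensorRules.
Variables (B A : pzRingType) (f : {rmorphism B -> A}) (M : lmodType B).

Lemma tpi_eq (x y : free_AM A M) :
  (tpi f x = tpi f y) <-> (x - y \in @tensor_null B A f M).
Proof. by rewrite Quotient.idealrBE; split => [h|/eqP]; first apply/eqP. Qed.
Lemma tensorM a b (m : M) : tensor f (a * f b) m = tensor f a (b *: m).
Proof. exact/tpi_eq/tensor_null_rel/TensorM. Qed.
Lemma tensorDr a (m m' : M) : tensor f a (m + m') = tensor f a m + tensor f a m'.
Proof.
rewrite -[RHS](raddfD (\pi_(Quotient.quot (@tensor_null B A f M)))%qT).
exact/tpi_eq/tensor_null_rel/TensorDr.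
Qed.
Lemma tensorZ a a' (m : M) : a *: tensor f a' m = tensor f (a * a') m.
Proof. exact: ind_scaleE. Qed.
End TensorRules.

Section IntegerIndexedH.
Variable R : realType.

(** The placeholder 0 at s = 0 allows arithmetic on indices without proofs of s != 0 inside the
    terms. *)
Definition uhz (s : int) : Uq R := if insub s is Some s' then uh R s' else 0.
Lemma uhzE (s : nzint) : uhz (val s) = uh R s.
Proof. by rewrite /uhz valK. Qed.
Lemma uhz_nz (s : int) : s != 0 -> exists2 s' : nzint, val s' = s & uhz s = uh R s'.
Proof. by move=> hs; exists (Sub s hs); rewrite ?SubK // -uhzE SubK. Qed.
End IntegerIndexedH.

Section WhittakerVector.
Variables (R : realType) (M : lmodType (Bdq R)).
Local Notation F := (Cq R).
Local Notation U := (Uq R).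
Local Notation B := (subalg_gen (@Bdq_gen R)).
Local Notation q := (q R).
Local Notation MF := (MF M).

(** The vector is the image of 1 (x) v. It cannot vanish: 1 (x) v generates the induced H_q-module,
    so the isomorphism would be zero although M is not. *)
Lemma whittaker_vector (zeta : {lrmorphism Hplus R -> Cq R | *%R}) (a : int)
    (lam : weight) (V : lmodType (Hb R)) (v : V) :
  is_zeta_a_line zeta a v -> is_Mzlam V lam M -> (exists m : M, m != 0) ->
  exists (v0 : MF) (z : nat -> F), [/\ v0 != 0,
    forall s : nat, (0 < s)%N -> act (uhz R s) v0 = z s *: v0
    & act (ugam R) v0 = (qh R ^ a) *: v0].
Proof.
move=> [hline hzeta hgam] [[th thb] _ _ _] [m0 m00].
pose v0 : MF := th (tensor (Hb_Hq R) 1 v).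
have h (b : Hb R) : th (tensor (Hb_Hq R) 1 (b *: v)) = act (val b) v0.
  rewrite -tensorM mul1r -[Hb_Hq R b]mulr1 -tensorZ linearZ /=.
  exact: (esym (act_val (Hq_Bdq R (Hb_Hq R b)) v0)).
have hb (b : Hb R) (c : F) : b *: v = (c%:A : Hb R) *: v -> act (val b) v0 = c *: v0.
  by move=> e; rewrite -h e h /= actZ ?rpred1 // act1.
have hz s : exists c : F, (0 < s)%N -> act (uhz R s) v0 = c *: v0.
  case: s => [|s]; first by exists 0.
  pose s' : nzint := Sub s.+1%:Z isT; have hs : (0 < val s')%R by [].
  pose y : Hplus R := subalg_elt (@Hplus_h R s' hs).
  exists (zeta y) => _; rewrite -(hb (Hplus_Hb R y)) ?hzeta //.
  by rewrite -[s.+1%:Z]/(val s') uhzE.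
have [z hz'] := choice hz; exists v0, z; split=> //; last exact: (hb (subalg_elt (Hb_gam R))).
apply: contra_neq m00 => v00.
have [ith thK ithK] := thb.
have all0 : forall y, th y = 0.
  elim/induced_ind=> [|y y' hy hy'|u w]; first exact: linear0.
    by rewrite linearB hy hy' subrr.
  have [c [-> _]] := hline w.
  rewrite -tensorM -[u * _]mulr1 -tensorZ linearZ /= -/v0 v00; exact: scaler0.
by rewrite -[m0]ithK all0.
Qed.
End WhittakerVector.

(* Unification would otherwise unfold them to fractions of polynomials. *)
Opaque qh Defs.q.

(** Nonvanishing of the last factor amounts to g^(4s) != 1; for g = q^(a/2) this is where the
    central charge must be nonzero. *)
Lemma kc_neq0 (F : fieldType) (q g : F) (s : nat) : (forall n, n.+1%:R != 0 :> F) ->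
  q != 0 -> g != 0 -> q - q^-1 != 0 -> (forall n : int, n != 0 -> q ^ n != 1) ->
  (forall n : int, n != 0 -> g ^ n != 1) -> (0 < s)%N -> kc q g s != 0.
Proof.
move=> char0 q0 g0 qq0 q1 g1 s0.
have hsub (x : F) (n : int) : x != 0 -> x ^ (n + n) != 1 -> x ^ n - x ^ (- n) != 0.
  move=> x0; apply: contra; rewrite subr_eq0 => /eqP e.
  by rewrite expfzDr // {2}e -expfzDr // subrr.
have h4 : 2 * s%:Z + 2 * s%:Z != 0 by lia.
rewrite /kc /qi !mulf_neq0 ?invr_eq0 ?hsub ?q1 ?g1 //.
by case: s s0 {h4} => // s _; apply: char0.
Qed.

Section HeisenbergAction.
Variables (R : realType) (M : lmodType (Bdq R)).
Local Notation F := (Cq R).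
Local Notation U := (Uq R).
Local Notation B := (subalg_gen (@Bdq_gen R)).
Local Notation q := (q R).
Local Notation qq := (q - q^-1).
Local Notation MF := (MF M).
Hypothesis irrM : irreducible (res_scalars (Hq_Bdq R) M).
Variables (v0 : MF) (z : nat -> F) (g kapV : F).
Hypotheses (v0_neq0 : v0 != 0) (kapV_neq0 : kapV != 0).
Hypotheses (g_neq0 : g != 0) (g_exprz_neq1 : forall n : int, n != 0 -> g ^ n != 1).
Hypothesis hz : forall s : nat, (0 < s)%N -> act (uhz R s) v0 = z s *: v0.
Hypothesis hgam : act (ugam R) v0 = g *: v0.
Hypothesis hKV : forall m : MF, act (uKV R) m = kapV *: m.

Lemma act_scale u c (m : MF) : act u (c *: m) = c *: act u m.
Proof. exact: linearZ. Qed.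

(** As gamma^(1/2) is central, its eigenspace for g is stable under H_q, and it contains v0. *)
Lemma act_gam (m : MF) : act (ugam R) m = g *: m.
Proof.
have closed u (m' : MF) : u \in B -> act (ugam R) m' = g *: m' ->
    act (ugam R) (act u m') = g *: act u m'.
  by move=> hu e; rewrite -actM ?B_gam // UgamC actM ?B_gam // e act_scale.
have cl := closed _ _ (B_gam R).
move: m; apply: (Hq_irreducible irrM _ _ _ _ _ _ _ v0_neq0 hgam).
- by rewrite linear0 scaler0.
- by move=> c m m' e e'; rewrite act_linear e e' scalerDr !scalerA mulrC.
- by move=> s m; apply/closed/B_h.
- by move=> m; apply/closed/B_gam.
- by move=> m; apply/closed/B_gamV.
- by move=> m; apply/closed/B_D.
- by move=> m; apply/closed/B_DV.
Qed.
Lemma act_gamV (m : MF) : act (ugamV R) m = g^-1 *: m.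
Proof.
have : act (ugam R * ugamV R) m = m by rewrite UggV act1.
rewrite actM ?B_gam ?B_gamV // act_gam => e.
by rewrite -[in RHS]e scalerA mulVf ?scale1r.
Qed.
Lemma B_ugh n : ugh R n \in B.
Proof. by case: n => n; rewrite rpredX ?B_gam ?B_gamV. Qed.
Lemma act_ugh n (m : MF) : act (ugh R n) m = g ^ n *: m.
Proof.
have actX u c k : u \in B -> (forall m : MF, act u m = c *: m) -> act (u ^+ k) m = c ^+ k *: m.
  move=> hu hc; elim: k => [|k IH]; first by rewrite !expr0 act1 scale1r.
  by rewrite !exprS actM ?rpredX // IH hc scalerA.
case: n => n; first by apply: actX; [exact: B_gam | exact: act_gam].
rewrite /ugh (actX _ g^-1) ?B_gamV //; last exact: act_gamV.
by rewrite exprVn NegzE -invr_expz.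
Qed.

Lemma act_hh (k l : int) (m : MF) : k != 0 -> l != 0 ->
  act (uhz R k) (act (uhz R l) m) - act (uhz R l) (act (uhz R k) m)
  = (if k == - l then kc q g k else 0) *: m.
Proof.
move=> k0 l0; have [k' ek ->] := uhz_nz R k0; have [l' el ->] := uhz_nz R l0; rewrite -ek -el.
have hk := B_h R k'; have hl := B_h R l'.
rewrite -(actM _ hk hl) -(actM _ hl hk) -(actB _ (rpredM hk hl) (rpredM hl hk)) UhhE.
case: ifP => _; last by rewrite act0 scale0r.
by rewrite actZ ?rpredB ?B_ugh // actB ?B_ugh // !act_ugh -scalerBl scalerA.
Qed.

Lemma act_Dh (s : int) (m : MF) : s != 0 ->
  act (uD R) (act (uhz R s) m) = q ^ s *: act (uhz R s) (act (uD R) m).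
Proof.
move=> s0; have [s' es ->] := uhz_nz R s0; rewrite -es.
by rewrite -!actM ?B_h ?B_D // UDh actZ // rpredM ?B_h ?B_D.
Qed.
Lemma act_DK (m : MF) : act (uDV R) (act (uD R) m) = m.
Proof. by rewrite -actM ?B_D ?B_DV // UDVD act1. Qed.
Lemma act_DVK (m : MF) : act (uD R) (act (uDV R) m) = m.
Proof. by rewrite -actM ?B_D ?B_DV // UDDV act1. Qed.

Definition hact (s : nat) : {linear MF -> MF} := @act R M (uhz R s).
(** The eigenvalue of h_s on D^j v0, because D h_s = q^s h_s D. *)
Definition chi (j : int) (s : nat) : F := q ^ (- (j * s%:Z)) * z s.
Local Notation germ := (germ hact chi).

Lemma germ_v0 : germ 0 v0.
Proof. by exists 1%N => s hs; rewrite [LHS](hz hs) /chi mul0r oppr0 expr0z mul1r. Qed.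
(** h_s commutes with every h_r except r = - s, which the bound r > |s| excludes. *)
Lemma germ_h j s (m : MF) : germ j m -> germ j (act (uh R s) m).
Proof.
move=> [n hn]; exists (maxn n (absz (val s)).+1) => r; rewrite geq_max => /andP[h1 h2].
have r0 : r%:Z != 0 by lia.
have := act_hh m r0 (valP s : val s != 0); rewrite uhzE.
case: eqP => [e|_]; first by move: h2; rewrite -[r]/(absz r) e abszN ltnn.
rewrite scale0r => /eqP; rewrite subr_eq0 => /eqP e.
by rewrite /hact /= e -[act (uhz R r) m]/(hact r m) hn // act_scale.
Qed.
Lemma germ_D j (m : MF) : germ j m -> germ (j + 1) (act (uD R) m).
Proof.
move=> [n hn]; exists n.+1 => r hr; have r0 : r%:Z != 0 by lia.
apply: (scalerI (expfz_neq0 r%:Z (q_neq0 R))); rewrite /hact /= -act_Dh //.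
rewrite -[act (uhz R r) m]/(hact r m) hn ?(ltnW hr) // act_scale scalerA; congr (_ *: _).
by rewrite /chi mulrA -expfzDr ?q_neq0 //; congr (_ ^ _ * _); ring.
Qed.
Lemma germ_DV j (m : MF) : germ j m -> germ (j - 1) (act (uDV R) m).
Proof.
move=> [n hn]; exists n.+1 => r hr; have r0 : r%:Z != 0 by lia.
rewrite -[LHS]act_DK /hact /= act_Dh // act_DVK -[act (uhz R r) m]/(hact r m).
rewrite hn ?(ltnW hr) // scalerA act_scale; congr (_ *: _).
by rewrite /chi mulrA -expfzDr ?q_neq0 //; congr (_ ^ _ * _); ring.
Qed.

(** Sums of germs contain v0 and are stable under H_q, where D moves the index j by one. *)
Lemma germ_decomposition (m : MF) : exists l : seq (int * MF),
  (forall p, p \in l -> germ p.1 p.2) /\ m = \sum_(p <- l) p.2.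
Proof.
pose S (m : MF) := exists l : seq (int * MF),
  (forall p, p \in l -> germ p.1 p.2) /\ m = \sum_(p <- l) p.2.
have SM (T : {linear MF -> MF}) (sh : int -> int) (m' : MF) :
    (forall j u, germ j u -> germ (sh j) (T u)) -> S m' -> S (T m').
  move=> hT [l [hl ->]]; exists [seq (sh p.1, T p.2) | p <- l]; split.
    by move=> _ /mapP[p hp ->]; apply/hT/hl.
  by rewrite big_map linear_sum.
have germZ' j c u : germ j u -> germ j (c *: u) by apply: germZ.
move: m; apply: (Hq_irreducible irrM (S := S) _ _ _ _ _ _ _ v0_neq0).
- by exists [::]; rewrite big_nil.
- move=> c m m' [l [hl ->]] [l' [hl' ->]].
  exists ([seq (p.1, c *: p.2) | p <- l] ++ l'); split.
    move=> p; rewrite mem_cat => /orP[/mapP[p' hp' ->]|/hl' //].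
    exact/germZ'/hl.
  by rewrite big_cat big_map scaler_sumr.
- by move=> s m; apply: (SM (@act R M (uh R s)) id) => j u; apply: germ_h.
- move=> m; rewrite act_gam; apply: (SM (GRing.scale g) id) => j u; exact: germZ'.
- move=> m; rewrite act_gamV; apply: (SM (GRing.scale g^-1) id) => j u; exact: germZ'.
- by move=> m; apply: (SM (@act R M (uD R)) (fun j => j + 1)) => j u; apply: germ_D.
- by move=> m; apply: (SM (@act R M (uDV R)) (fun j => j - 1)) => j u; apply: germ_DV.
- exists [:: (0, v0)]; split; last by rewrite big_seq1.
  by move=> p; rewrite inE => /eqP ->; apply: germ_v0.
Qed.

(* If zeta vanishes on h_s for all large s, all germs coincide. *)
Lemma germ_index_set : exists P : pred int,
  (forall i j n, P i -> P j -> i != j -> exists2 s, (n <= s)%N & chi i s != chi j s) /\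
  (forall m : MF, exists l : seq (int * MF),
    [/\ all P (map fst l), forall p, p \in l -> germ p.1 p.2 & m = \sum_(p <- l) p.2]).
Proof.
have [[n hn]|hN] := pselect (exists n, forall s, (n <= s)%N -> z s = 0).
  exists (pred1 0); split=> [i j k /eqP-> /eqP->|m]; first by rewrite eqxx.
  exists [:: (0, m)]; split; rewrite ?big_seq1 //.
  move=> p; rewrite inE => /eqP -> /=; have [l [hl ->]] := germ_decomposition m.
  rewrite big_seq; apply: germ_sum => p' /hl [k hk]; exists (maxn n k) => s.
  by rewrite geq_max => /andP[h1 h2]; rewrite hk // /chi hn // !mulr0.
exists xpredT; split=> [i j n _ _ ij|m]; last first.
  by have [l [hl e]] := germ_decomposition m; exists l; split=> //; apply/allP.
have [s hs zs] : exists2 s, (n.+1 <= s)%N & z s != 0.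
  apply: contrapT => hc; apply: hN; exists n.+1 => s hs; apply/eqP.
  by apply: contrapT => /negP h; apply: hc; exists s.
exists s; first exact: ltnW.
rewrite /chi; apply/negP => /eqP/(mulIf zs) e.
have : q ^ ((j - i) * s%:Z) = 1.
  rewrite mulrBl addrC expfzDr ?q_neq0 // e -expfzDr ?q_neq0 //.
  by rewrite addNr.
apply/eqP/q_exprz_neq1; rewrite mulf_neq0 ?subr_eq0 1?eq_sym //.
by case: s hs {zs e}.
Qed.

Lemma B_uphi r : uphi R (- Posz r) \in B.
Proof.
apply: (exp_rec_in (Cq_char0 R) (rec_uphi R) (B_closed R)) => [|l]; first exact: B_KV.
by rewrite rpredZ // B_h.
Qed.
Definition phiact (r : nat) : {linear MF -> MF} := @act R M (uphi R (- Posz r)).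
Definition heis_phi (s : nat) : F := - (qq * kc q g s).

Lemma heis_phi_neq0 s : (0 < s)%N -> heis_phi s != 0.
Proof.
move=> s0; rewrite /heis_phi oppr_eq0.
apply: mulf_neq0; first exact: qq_neq0.
apply: kc_neq0; [exact: Cq_char0|exact: q_neq0|exact: g_neq0|exact: qq_neq0|exact: q_exprz_neq1|exact: g_exprz_neq1|exact: s0].
Qed.

Lemma phiact0_inj (m : MF) : phiact 0 m = 0 -> m = 0.
Proof.
rewrite /phiact /= (rec_uphi R).1 hKV => /eqP; rewrite scaler_eq0 (negbTE kapV_neq0).
by move/eqP.
Qed.

Lemma hact_phiact s r (m : MF) : (0 < s)%N ->
  hact s (phiact r m) - phiact r (hact s m)
  = if (s <= r)%N then heis_phi s *: phiact (r - s) m else 0.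
Proof.
case: s => // s _; rewrite /hact /phiact /=.
pose s' : nzint := Sub s.+1%:Z isT.
have es : uhz R s.+1 = uh R s' by rewrite -uhzE.
rewrite es -!actM ?B_h ?B_uphi // -actB ?rpredM ?B_h ?B_uphi //.
(* The commutator of h_s with the exponent of phi as an element of U_q; it is turned into a scalar
   only after it acts on M. *)
pose k : U := - (qq * (qint R (2 * s.+1%:Z) / s.+1%:~R / qq))
   *: (ugh R (2 * s.+1%:Z) - ugh R (- (2 * s.+1%:Z))).
have hG (u : U) : (ugh R (2 * s.+1%:Z) - ugh R (- (2 * s.+1%:Z))) * u
    = u * (ugh R (2 * s.+1%:Z) - ugh R (- (2 * s.+1%:Z))).
  by rewrite mulrBl mulrBr; congr (_ - _); apply: UghC.
rewrite (exp_rec_heis (Cq_char0 R) (rec_uphi R) (s := s) (k := k)); last first.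
- move=> l; rewrite -scalerAr -scalerAl -scalerBr [uh R s' * _ - _]UhhE.
  have -> : (val s' == - Negz l) = (l == s) by rewrite /=; lia.
  by case: eqP => _; rewrite ?scaler0 // scalerA mulNr.
- by move=> l; rewrite /k -[LHS]scalerAl hG; exact: scalerAr.
- by rewrite UKVh.
case: ltnP => _; last exact: act0.
rewrite actM ?B_uphi ?rpredZ ?rpredB ?B_ugh // actZ ?rpredB ?B_ugh //.
rewrite actB ?B_ugh // !act_ugh -scalerBl scalerA; congr (_ *: _).
rewrite mulNr; congr (- _); exact: (esym (mulrA _ _ _)).
Qed.
End HeisenbergAction.

(** * Nonvanishing of the induced module *)

Section GeneratorImages.
Variables (R : realType) (E : algType (Cq R)).
Local Notation F := (Cq R).
Local Notation q := (q R).
Local Notation qq := (q - q^-1).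
Local Notation FA := (free_alg (Cq R) qgen).
Variables (X : bool -> int -> E) (H : int -> E) (K KV D DV : E) (g : F).
Hypothesis g_neq0 : g != 0.

Definition gen_image (y : qgen) : E :=
  match y with
  | Gx e k => X e k | Gh s => H (val s) | GK => K | GKV => KV
  | Ggam => g%:A | GgamV => (g^-1)%:A | GD => D | GDV => DV
  end.
Local Notation f := (free_lift gen_image).

Definition Psi_image (k : int) : E :=
  if k is Posz n then K * expc (fun l => qq *: H (Posz l.+1)) n else 0.
Definition Phi_image (k : int) : E :=
  if - k is Posz n then KV * expc (fun l => - qq *: H (Negz l)) n else 0.

Let fM u w : f (u * w) = f u * f w. Proof. exact: rmorphM. Qed.
Let fB u w : f (u - w) = f u - f w. Proof. exact: rmorphB. Qed.
Let fZ c u : f (c *: u) = c *: f u. Proof. exact: free_lift_scalable. Qed.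
Let f1 : f 1 = 1. Proof. exact: rmorph1. Qed.
Let f0 : f 0 = 0. Proof. exact: rmorph0. Qed.
Let fX u n : f (u ^+ n) = f u ^+ n. Proof. exact: rmorphXn. Qed.
Let fg y : f (fgen _ y) = gen_image y. Proof. exact: free_lift_fgen. Qed.
Let fbr u w : f (bracket u w) = f u * f w - f w * f u.
Proof. by rewrite /bracket fB !fM. Qed.

Let algX (c : F) n : (c%:A : E) ^+ n = (c ^+ n)%:A.
Proof. by rewrite exprZn expr1n. Qed.
Lemma free_lift_gamma m : f (gamma_half R m) = (g ^ m)%:A.
Proof.
case: m => n; first by rewrite fX fg algX.
by rewrite fX fg algX exprVn NegzE -invr_expz.
Qed.
Lemma free_lift_psi k : f (psi R k) = Psi_image k.
Proof.
case: k => n; last exact: f0.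
rewrite fM fg; congr (_ * _).
transitivity (f (expc (fun l => qq *: hpos R l) n)) => //.
rewrite expc_morph; congr (expc _ n); apply/funext => l /=.
by rewrite fZ fg.
Qed.
Lemma free_lift_phi k : f (phi R k) = Phi_image k.
Proof.
rewrite /phi /Phi_image; case: (- k) => n; last exact: f0.
rewrite fM fg; congr (_ * _).
transitivity (f (expc (fun l => - qq *: hneg R l) n)) => //.
rewrite expc_morph; congr (expc _ n); apply/funext => l /=.
by rewrite fZ fg.
Qed.

Hypotheses (KKV : K * KV = 1) (KVK : KV * K = 1) (DDV : D * DV = 1) (DVD : DV * D = 1).
Hypotheses (DK : D * K = K * D) (KH : forall s, K * H s = H s * K).
Hypothesis DH : forall s : int, s != 0 -> D * H s = q ^ s *: (H s * D).
Hypothesis DX : forall e r, D * X e r = q ^ r *: (X e r * D).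
Hypothesis KX : forall e r, K * X e r = q ^ (2 * sg e) *: (X e r * K).
Hypothesis HH : forall k l : int, k != 0 -> l != 0 ->
  H k * H l - H l * H k = (if k == - l then kc q g k else 0) *: 1.
Hypothesis HX : forall (s : int) e l, s != 0 -> H s * X e l - X e l * H s
  = ((sg e)%:~R * qint R (2 * s) / s%:~R * g ^ (- sg e * `|s|)) *: X e (s + l).
Hypothesis XX : forall k l, X false (k + 1) * X false l
    - q ^ (-2) *: (X false l * X false (k + 1))
  = q ^ (-2) *: (X false k * X false (l + 1)) - X false (l + 1) * X false k.
Hypothesis XXpm : forall k l, X true k * X false l - X false l * X true k
  = qq^-1 *: (g ^ (k - l) *: Psi_image (k + l) - g ^ (l - k) *: Phi_image (k + l)).

(* The quadratic relations of the x^+_k are left out: in the coinduced module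
   they only hold on a subspace. *)
Lemma free_lift_rel l r : drinfeld_rel l r -> f l = f r \/
  exists k p, f l - f r = (X true (k + 1) * X true p - q ^ 2 *: (X true p * X true (k + 1)))
    - (q ^ 2 *: (X true k * X true (p + 1)) - X true (p + 1) * X true k).
Proof.
have alC c (u : E) : c%:A * u = u * c%:A by rewrite mulr_algl mulr_algr.
have al1 (c c' : F) : c * c' = 1 -> (c%:A : E) * c'%:A = 1.
  by move=> e; rewrite mulr_algl scalerA e scale1r.
have skew (a b aV : E) c : a * aV = 1 -> a * b = c *: (b * a) -> a * b * aV = c *: b.
  by move=> e e'; rewrite e' -scalerAl -mulrA e mulr1.
case=> [u|u| | | | | | | |s|s|e n|e n|k m|k e m|[] k m|k m]; [left|left|left|left|left|left|left|left|left|left|left|left|left|left|left|right|left|left].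
- by rewrite !fM fg /= alC.
- by rewrite !fM fg /= alC.
- by rewrite fM !fg f1.
- by rewrite fM !fg f1.
- by rewrite fM !fg f1.
- by rewrite fM !fg f1.
- by rewrite fM !fg f1 /=; apply: al1; rewrite mulfV.
- by rewrite fM !fg f1 /=; apply: al1; rewrite mulVf.
- by rewrite fbr !fg f0 /= DK subrr.
- by rewrite fbr !fg f0 /= KH subrr.
- by rewrite !fM fZ !fg; apply: skew => //; apply/DH/(valP s).
- by rewrite !fM fZ !fg; apply: skew => //; apply/DX.
- by rewrite !fM fZ !fg; apply: skew => //; apply/KX.
- rewrite fbr !fg /= HH ?(valP k) ?(valP m) //; case: ifP => _; last by rewrite scale0r f0.
  by rewrite fZ fB !free_lift_gamma -scalerBl scalerA.
- rewrite fbr !fg /= HX ?(valP k) // fZ fM free_lift_gamma fg /=.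
  by rewrite mulr_algl scalerA.
- exists k, m.
  by rewrite !fB !fZ !fM !fg.
- by rewrite !fB !fZ !fM !fg; apply: XX.
- rewrite fbr !fg /= XXpm fZ fB !fM !free_lift_gamma free_lift_psi free_lift_phi.
  by rewrite !mulr_algl.
Qed.
End GeneratorImages.

(** * Detecting nonzero tensors by balanced maps *)

Section BalancedMaps.
Variables (B A : pzRingType) (f : {rmorphism B -> A}) (M : lmodType B) (G : zmodType).
Variable beta : A -> M -> G.
Hypothesis betaDl : forall a a' m, beta (a + a') m = beta a m + beta a' m.
Hypothesis betaDr : forall a m m', beta a (m + m') = beta a m + beta a m'.
Hypothesis betaM : forall a b m, beta (a * f b) m = beta a (b *: m).

(** A balanced map extends to the free abelian group on A * M and there kills [tensor_null]. *)
Lemma tensor_eq0 a m : tensor f a m = 0 -> beta a m = 0.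
Proof.
pose L (x : free_AM A M) : G := \sum_(k <- msupp x) beta k.1 k.2 *~ x@_k.
have Lw (d : {fset (A * M)%type}) (x : free_AM A M) : (msupp x `<=` d)%fset ->
    L x = \sum_(k <- d) beta k.1 k.2 *~ x@_k.
  move=> le; rewrite [LHS](big_fset_incl _ le) => //= k _ /mcoeff_outdom ->.
  exact: mulr0z.
have LB (x y : free_AM A M) : L (x - y) = L x - L y.
  rewrite (Lw _ _ (fsubsetUl (msupp x) (msupp y))) (Lw _ _ (fsubsetUr (msupp x) (msupp y))).
  rewrite (Lw _ _ (msuppB_le x y)) -sumrB; apply: eq_bigr => k _.
  by rewrite mcoeffB mulrzBr.
have LU u m' : L (tsym u m') = beta u m'.
  by rewrite (Lw _ _ msuppU_le) big_seq_fset1 mcoeffUU mulr1z.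
have LN (y : free_AM A M) : L (- y) = - L y.
  have L0 : L 0 = 0 by have := LB 0 0; rewrite subrr subr0.
  by rewrite -[- y]sub0r LB L0 sub0r.
have LD (x y : free_AM A M) : L (x + y) = L x + L y by rewrite -{1}[y]opprK LB LN opprK.
pose S : {pred free_AM A M} := [pred x | L x == 0].
have L0 x : x \in @tensor_null B A f M -> L x = 0.
  move=> hx; suff : x \in S by move/eqP.
  apply: tensor_null_ind hx; first split.
  - by apply/eqP; have := LB 0 0; rewrite !subrr.
  - by move=> y z /eqP hy /eqP hz; apply/eqP; rewrite LB hy hz subr0.
  - move=> l r [u u' m'|u m1 m2|u b m']; apply/eqP; rewrite LB ?LD !LU ?betaDl ?betaDr ?betaM subrr //.
move=> e; rewrite -LU -[tsym a m]subr0; apply/L0/tpi_eq.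
by rewrite -/(tensor f a m) e; symmetry; exact: (raddf0 (\pi_(Quotient.quot (@tensor_null B A f M)))%qT).
Qed.
End BalancedMaps.

(** * The action of U_q on a subspace of the functions of words *)

Section FockSubspace.
Variables (F : fieldType) (M : lmodType F) (m0 : M) (m0_neq0 : m0 != 0) (q : F).
Local Notation E := (endo (fock0_neq0 m0_neq0)).
Local Notation W := (quad_sub m0_neq0 q).
Local Notation Sh := (Sh m0_neq0).

Lemma W_lin c (T T' : E) f :
  W (endo_fun T f) -> W (endo_fun T' f) -> W (endo_fun (c *: T + T') f).
Proof. by move=> h h' n; exact: (Wn_lin c (h n) (h' n)). Qed.
Lemma W_scalar c f : W f -> W (endo_fun (c%:A : E) f).
Proof. by have [P1 _ _] := pres_subalg m0_neq0 q; apply/W_pres/presZ/P1. Qed.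
Lemma W_quad k p f : W f ->
  endo_fun ((Sh (k + 1) * Sh p - q ^ 2 *: (Sh p * Sh (k + 1)))
    - (q ^ 2 *: (Sh k * Sh (p + 1)) - Sh (p + 1) * Sh k)) f = 0.
Proof.
move=> hf; have := W_Rel k p hf; rewrite /Rel /qbr => <-; congr (endo_fun _ f).
by lmod F E.
Qed.
Lemma endo_eq_on (T T' : E) f : endo_fun (T - T') f = 0 -> endo_fun T f = endo_fun T' f.
Proof. by move=> h; apply/eqP; rewrite -subr_eq0 -endoBE h. Qed.
Lemma vacD m m' : vac (m + m' : M) = vac m + vac m'.
Proof. by apply/funext => -[|k L] //; rewrite -[RHS]/(0 + 0 : M) addr0. Qed.
End FockSubspace.

Section FockRepresentation.
Variables (R : realType) (M : lmodType (Bdq R)).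
Local Notation F := (Cq R).
Local Notation U := (Uq R).
Local Notation FA := (free_alg (Cq R) qgen).
Local Notation q := (q R).
Local Notation qq := (q - q^-1).
Local Notation MF := (MF M).
Hypothesis irrM : irreducible (res_scalars (Hq_Bdq R) M).
Variables (v0 : MF) (g kap : F).
Hypotheses (v0_neq0 : v0 != 0) (g_neq0 : g != 0) (kap_neq0 : kap != 0).
Hypothesis hgam : act (ugam R) v0 = g *: v0.
Hypothesis hK : forall m : MF, act (uK R) m = kap *: m.
Hypothesis hKV : forall m : MF, act (uKV R) m = kap^-1 *: m.
Hypothesis hxp : forall k (m : MF), act (ux R true k) m = 0.

Definition hM (s : int) (m : MF) : MF := act (uhz R s) m.
Definition dM (m : MF) : MF := act (uD R) m.
Definition dVM (m : MF) : MF := act (uDV R) m.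
Lemma hM_lin s : linear (hM s). Proof. exact: act_linear. Qed.
Lemma dM_lin : linear dM. Proof. exact: act_linear. Qed.
Lemma dVM_lin : linear dVM. Proof. exact: act_linear. Qed.
Let hhM : forall (k l : int) (m : MF), k != 0 -> l != 0 ->
  hM k (hM l m) - hM l (hM k m) = (if k == - l then kc q g k else 0) *: m.
Proof. by move=> k l m; apply: (act_hh irrM v0_neq0 g_neq0 hgam). Qed.
Let dhM : forall (s : int) (m : MF), s != 0 -> dM (hM s m) = q ^ s *: hM s (dM m).
Proof. exact: act_Dh. Qed.
Let dVK : cancel dM dVM. Proof. exact: act_DK. Qed.
Let dK : cancel dVM dM. Proof. exact: act_DVK. Qed.
Let char0 := Cq_char0 R.
Let q0 := q_neq0 R.
Let qq0 := qq_neq0 R.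

Local Notation E := (endo (fock0_neq0 v0_neq0)).
Definition opX (e : bool) (k : int) : E :=
  if e then Sh v0_neq0 k else Xm v0_neq0 q g kap hM_lin k.
Definition opH (s : int) : E := Hh v0_neq0 q g hM_lin s.
Definition opK : E := Kk v0_neq0 q kap.
Definition opKV : E := KkV v0_neq0 q kap.
Definition opD : E := Dd v0_neq0 q dM_lin.
Definition opDV : E := DdV v0_neq0 q dVM_lin.
Local Notation rep := (free_lift (gen_image opX opH opK opKV opD opDV g)).
Local Notation W := (quad_sub v0_neq0 q).

Lemma Xm_quad_rel k l : opX false (k + 1) * opX false l
    - q ^ (-2) *: (opX false l * opX false (k + 1))
  = q ^ (-2) *: (opX false k * opX false (l + 1)) - opX false (l + 1) * opX false k.
Proof.
have := Xm_quad char0 v0_neq0 q0 g_neq0 kap_neq0 qq0 hM_lin hhM k l.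
rewrite /qbr /opX => e.
apply/eqP; rewrite -subr_eq0; apply/eqP; rewrite -[RHS]e.
by lmod F E.
Qed.

Let opHX (s : int) e l : s != 0 -> opH s * opX e l - opX e l * opH s
  = ((sg e)%:~R * qint R (2 * s) / s%:~R * g ^ (- sg e * `|s|)) *: opX e (s + l).
Proof.
move=> s0; rewrite [s + l]addrC; case: e.
  rewrite /opX /opH Sh_H opprB addrCA subrr addr0; congr (_ *: _).
  by rewrite /cplus mulN1r mulr1z mul1r.
rewrite (HhX char0 v0_neq0 q0 g_neq0 kap_neq0 qq0 hM_lin hhM l s0); congr (_ *: _).
by rewrite /cminus opprK mul1r mulrN1z mulN1r !mulNr.
Qed.

Lemma rep_rel l r : drinfeld_rel l r -> rep l = rep r \/
  exists k p, rep l - rep r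
    = (opX true (k + 1) * opX true p - q ^ 2 *: (opX true p * opX true (k + 1)))
    - (q ^ 2 *: (opX true k * opX true (p + 1)) - opX true (p + 1) * opX true k).
Proof.
apply: free_lift_rel.
- exact: g_neq0.
- exact: KkKV.
- exact: KkVK.
- exact: (DdKV v0_neq0 q0 dM_lin dVM_lin dK).
- exact: (DdVK v0_neq0 q0 dM_lin dVM_lin dVK).
- exact: DdK.
- exact: KkC.
- by move=> s s0; exact: (DdH v0_neq0 g q0 hM_lin dM_lin dhM s0).
- move=> [] r'; last exact: (DdX char0 v0_neq0 q0 g_neq0 kap_neq0 qq0 hM_lin dM_lin hhM dhM r').
  by rewrite /opX /opD (Sh_D v0_neq0 q0) scalerA -expfzDr // subrr scale1r.
- move=> [] r'; last exact: (KkX char0 v0_neq0 q0 g_neq0 kap_neq0 qq0 hM_lin hhM r').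
  exact: (Kk_Sh v0_neq0 kap q0 r').
- by move=> k p k0 p0; exact: (HhC v0_neq0 hM_lin hhM k0 p0).
- exact: opHX.
- exact: Xm_quad_rel.
- move=> k p; rewrite /opX Sh_X addrC addrA addNr add0r AxE.
  by [].
Qed.

Local Notation rp u f := (endo_fun (rep u) f).
Let repL c u w : rep (c *: u + w) = c *: rep u + rep w. Proof. exact: linearP. Qed.
Let repM u w : rep (u * w) = rep u * rep w. Proof. exact: rmorphM. Qed.
Let repB u w : rep (u - w) = rep u - rep w. Proof. exact: rmorphB. Qed.
Let rep1 : rep 1 = 1. Proof. exact: rmorph1. Qed.
Let rep0 : rep 0 = 0. Proof. exact: rmorph0. Qed.

Lemma rep_W u f : W f -> W (rp u f).
Proof.
pose P : {pred FA} := [pred u | `[< forall f, W f -> W (rp u f) >]].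
suff hP : u \in P by move=> hf; move/asboolP: hP; apply.
apply: free_alg_ind.
  split=> [|c u1 u2 /asboolP h1 /asboolP h2|u1 u2 /asboolP h1 /asboolP h2].
  - by apply/asboolP => f1; rewrite rep1.
  - apply/asboolP => f1 hf; rewrite repL.
    by apply: W_lin; [exact: h1 | exact: h2].
  - by apply/asboolP => f1 hf; rewrite repM; apply/h1/h2.
move=> y; apply/asboolP => f1 hf; rewrite free_lift_fgen; case: y => [[] k|s| | | | | |].
- exact: W_Sh.
- by apply: W_pres hf; apply: pres_Xm.
- by apply: W_pres hf; apply: pres_Hh.
- by apply: W_pres hf; apply: pres_Kk.
- by apply: W_pres hf; apply: pres_KkV.
- exact: W_scalar.
- exact: W_scalar.
- by apply: W_pres hf; apply: pres_Dd.
- by apply: W_pres hf; apply: pres_DdV.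
Qed.

(** Since W is stable, the elements that act on it by zero form a two-sided ideal, and it suffices
    to look at the defining relations; those between the x^+_k vanish by the choice of W. *)
Lemma rep_rel_ideal u f : u \in rel_ideal (@drinfeld_rel R) -> W f -> rp u f = 0.
Proof.
pose I : {pred FA} := [pred u | `[< forall f, W f -> rp u f = 0 >]].
move=> hu; suff hI : u \in I by move/asboolP: hI; apply.
move/asboolP: hu; apply; first split; first split.
- by apply/asboolP => f1 _; rewrite rep0.
- by move=> x y /asboolP hx /asboolP hy; apply/asboolP => f1 hf; rewrite repB endoBE hx // hy // subrr.
- move=> a x b /asboolP hx; apply/asboolP => f1 hf; rewrite !repM.
  rewrite -[LHS]/(rp a (rp x (rp b f1))) hx ?linear0 //.
  exact: rep_W.
- move=> l r /rep_rel h; apply/asboolP => f1 hf; rewrite repB.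
  case: h => [->|[k [p ->]]]; first by rewrite subrr.
  exact: W_quad.
Qed.

(** Defined through a representative in the free algebra; independence of the representative is
    guaranteed on W, hence the assumption [W f] in the rules below. *)
Definition ev (u : U) (f : fock MF) : fock MF := rp (repr u) f.
Lemma ev_piU w f : W f -> ev (piU w) f = rp w f.
Proof.
move=> hf; apply: endo_eq_on; rewrite -repB; apply: rep_rel_ideal => //.
apply/qpi_eq; exact: qpi_repr.
Qed.
Lemma ev1 f : W f -> ev 1 f = f.
Proof. by move=> hf; rewrite -[1 : U]/(piU 1) ev_piU // rep1. Qed.
Lemma evM u w f : W f -> ev (u * w) f = ev u (ev w f).
Proof.
have [u' ->] := piU_surj u; have [w' ->] := piU_surj w => hf.
rewrite -piUM !ev_piU //; last exact: rep_W.
by rewrite repM.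
Qed.
Lemma ev_lin c u w f : W f -> ev (c *: u + w) f = c *: ev u f + ev w f.
Proof.
have [u' ->] := piU_surj u; have [w' ->] := piU_surj w => hf.
have -> : c *: piU u' + piU w' = piU (c *: u' + w') by rewrite -piUZ; exact: (esym (rmorphD _ _ _)).
by rewrite !ev_piU // repL.
Qed.
Lemma evDr u f1 f2 : ev u (f1 + f2) = ev u f1 + ev u f2.
Proof. exact: linearD. Qed.

Let vac0 : vac (0 : MF) = 0.
Proof. by apply/funext => -[]. Qed.
Let vacL c (m m' : MF) : vac (c *: m + m') = c *: vac m + vac m'.
Proof. by apply/funext => -[|k L] //; rewrite -[RHS]/(c *: 0 + 0 : MF) scaler0 addr0. Qed.

(** Makes the map that sends (u, m) to [ev u (vac m)] balanced over the Borel-type subalgebra. *)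
Lemma ev_vac (u : U) (m : MF) : u \in subalg_gen (@Bdq_gen R) -> ev u (vac m) = vac (act u m).
Proof.
pose P : {pred U} := [pred u | `[< u \in subalg_gen (@Bdq_gen R) /\
  forall m : MF, ev u (vac m) = vac (act u m) >]].
have hW m' : W (vac m') by exact: W_vac.
have PC : subalg_closed P.
  split=> [|c u1 u2 /asboolP[b1 h1] /asboolP[b2 h2]|u1 u2 /asboolP[b1 h1] /asboolP[b2 h2]].
  - by apply/asboolP; split=> [|m']; rewrite ?rpred1 // act1 ev1.
  - apply/asboolP; split=> [|m']; first by rewrite rpredD ?rpredZ.
    by rewrite ev_lin // h1 h2 actD ?rpredZ // actZ // vacL.
  - apply/asboolP; split=> [|m']; first by rewrite rpredM.
    by rewrite evM // h2 h1 actM.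
have Pgen y : piU (fgen _ y) \in subalg_gen (@Bdq_gen R) ->
    (forall m : MF, endo_fun (gen_image opX opH opK opKV opD opDV g y) (vac m)
       = vac (act (piU (fgen _ y)) m)) -> piU (fgen _ y) \in P.
  move=> hB h; apply/asboolP; split=> // m'; rewrite ev_piU // free_lift_fgen; exact: h.
suff sub : {subset subalg_gen (@Bdq_gen R) <= P}.
  by move=> /sub /asboolP[_]; apply.
apply: (subalg_gen_sub PC) => _ [k|y hy| |]; last first.
- by apply: (Pgen GKV); [exact: B_KV | move=> m'; rewrite hKV; exact: KkV_vac].
- by apply: (Pgen GK); [exact: B_K | move=> m'; rewrite hK; exact: Kk_vac].
- apply: (subalg_gen_sub PC) hy => _ [y' hy'| |].
  + apply: (subalg_gen_sub PC) hy' => _ [||s].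
    * apply: (Pgen Ggam); first exact: B_gam.
      by move=> m'; rewrite (act_gam irrM v0_neq0 hgam) -[_ *: m' in RHS]addr0 vacL vac0 addr0.
    * apply: (Pgen GgamV); first exact: B_gamV.
      by move=> m'; rewrite (act_gamV irrM v0_neq0 g_neq0 hgam) -[_ *: m' in RHS]addr0 vacL vac0 addr0.
    * apply: (Pgen (Gh s)); first exact: B_h.
      by move=> m'; rewrite -[piU _]/(uh R s) -uhzE; exact: Hh_vac.
  + by apply: (Pgen GD); [exact: B_D | move=> m'; exact: Dd_vac].
  + by apply: (Pgen GDV); [exact: B_DV | move=> m'; exact: DdV_vac].
- apply: (Pgen (Gx true k)); first exact: B_xp.
  by move=> m'; rewrite hxp vac0; exact: Sh_vac.
Qed.

(** Evaluation at the empty word recovers m from the image of 1 (x) m. *)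
Lemma tensor_inj (m : M) : tensor (@Bdq_Uq R) 1 m = 0 -> m = 0.
Proof.
move=> e; have : ev 1 (vac (m : MF)) = 0.
  pose beta (u : U) (m' : M) : fock MF := ev u (vac (m' : MF)).
  refine (@tensor_eq0 (Bdq R) U (Bdq_Uq R) M (fock MF) beta _ _ _ 1 m e); rewrite /beta.
  - move=> u w m'; rewrite -[u]scale1r ev_lin; last exact: W_vac.
    by rewrite !scale1r.
  - by move=> u m1 m2; rewrite -evDr; congr (ev u _); exact: vacD.
  - move=> u b m'; rewrite evM; last exact: W_vac.
    congr (ev u _); rewrite ev_vac; last exact: (valP b).
    by congr vac; exact: act_val.
rewrite ev1; last exact: W_vac.
by move/(congr1 (fun f => f [::])).
Qed.
End FockRepresentation.

Lemma skew_inv (F : fieldType) (A : algType F) (a aV b : A) (c : F) : a * aV = 1 ->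
  aV * a = 1 -> c != 0 -> a * b = c *: (b * a) -> aV * b = c^-1 *: (b * aV).
Proof.
move=> e1 e2 c0 e; have e' : b * a = c^-1 *: (a * b) by rewrite e scalerA mulVf ?scale1r.
by rewrite -[LHS]mulr1 -e1 -mulrA [b * _]mulrA e' -scalerAl -scalerAr !mulrA e2 mul1r.
Qed.

(** * Crossing relations when gamma acts by a scalar *)

Section CentralCharge.
Variables (R : realType) (E : algType (Cq R)) (s : Uq R -> E) (g : Cq R).
Local Notation F := (Cq R).
Local Notation U := (Uq R).
Local Notation q := (q R).
Local Notation qq := (q - q^-1).
Hypothesis sM : forall u w : U, s (u * w) = s u * s w.
Hypothesis sL : forall (c : F) (u w : U), s (c *: u + w) = c *: s u + s w.
Hypothesis s1 : s 1 = 1.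
Hypotheses (g_neq0 : g != 0) (s_gam : s (ugam R) = g%:A).
Let char0 := Cq_char0 R.

Let s0 : s 0 = 0.
Proof. by have := sL (-1) 0 0; rewrite scaler0 addr0 scaleN1r addNr. Qed.
Let sZ (c : F) (u : U) : s (c *: u) = c *: s u.
Proof. by rewrite -[c *: u]addr0 sL s0 addr0. Qed.
Let sB (u w : U) : s (u - w) = s u - s w.
Proof. by rewrite -[- w]scaleN1r addrC sL scaleN1r addrC. Qed.
Let sX (u : U) n : s (u ^+ n) = s u ^+ n.
Proof. by elim: n => [|n IH]; rewrite ?expr0 // !exprS sM IH. Qed.
Let s_sum n (G : 'I_n -> U) : s (\sum_i G i) = \sum_i s (G i).
Proof.
elim/big_rec2: _ => // i y1 y2 _ <-; by rewrite -[G i]scale1r sL !scale1r.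
Qed.

Lemma s_ugh m : s (ugh R m) = (g ^ m)%:A.
Proof.
have algX (c : F) n : (c%:A : E) ^+ n = (c ^+ n)%:A by rewrite exprZn expr1n.
have s_gamV : s (ugamV R) = (g^-1)%:A.
  rewrite -[LHS]scale1r -(mulVf g_neq0) -scalerA -[s (ugamV R)]mul1r scalerAl -s_gam.
  by rewrite -sM UggV s1.
case: m => n; first by rewrite sX s_gam algX.
by rewrite sX s_gamV algX exprVn NegzE -invr_expz.
Qed.

(** In negative degree psi vanishes, so the commutator reduces to a multiple of phi. *)
Lemma s_xp_x (k l : int) : (k + l < 0)%R -> s (ux R true k) * s (ux R false l)
  = s (ux R false l) * s (ux R true k)
    - (qq^-1 * g ^ (l - k)) *: s (uphi R (- Posz (absz (k + l)%R))).
Proof.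
move=> kl; have := congr1 s (Uxpxm R k l).
rewrite (upsi_lt0 _ kl) mulr0 sZ !sB s0 sub0r !sM s_ugh mulr_algl => e.
have -> : - Posz (absz (k + l)%R) = k + l by lia.
by rewrite -scalerA -scalerN -e addrCA subrr addr0.
Qed.

(** The descending crossing relation for phi: K^-1 contributes t = q^2, and the powers of
    gamma^(1/2) in [h_s, x^-_l] contribute u = g. *)
Lemma s_phi_x n p : s (uphi R (- Posz n)) * s (ux R false p)
  = \sum_(i < n.+1) (Gc (q ^ 2) i * g ^+ i) *:
      (s (ux R false (p - i%:Z)) * s (uphi R (- Posz (n - i)%N))).
Proof.
have q0 := q_neq0 R; have q2 : q ^ 2 != 0 by rewrite expfz_neq0.
have rec : exp_rec (s (uKV R)) (fun l => s (- qq *: hnegU R l)) (fun n => s (uphi R (- Posz n))).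
  have [e0 en] := rec_uphi R; split=> [|m]; first exact: (congr1 s e0).
  rewrite -sZ en s_sum; apply: eq_bigr => l _.
  by rewrite sZ sM.
pose x r := s (ux R false r).
have Kx r : s (uKV R) * x r = q ^ 2 *: (x r * s (uKV R)).
  rewrite -!sM -sZ; congr (s _); have q2V : q ^ (-2) != 0 := expfz_neq0 _ q0.
  have <- : (q ^ (-2))^-1 = q ^ 2 by rewrite invr_expz.
  exact: (skew_inv (UKKV R) (UKVK R) q2V (UKx R false r)).
have ax (l : nat) r : l.+1%:R *: (s (- qq *: hnegU R l) * x r - x r * s (- qq *: hnegU R l))
    = (((q ^ 2) ^+ l.+1 - (q ^ 2)^-1 ^+ l.+1) * g ^+ l.+1) *: x (r - l.+1%:Z).
  have e : s (hnegU R l) * x r - x r * s (hnegU R l)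
      = - cminus q g (Negz l) *: x (r - l.+1%:Z).
    rewrite -!sM -sB (Uhx R (exist _ (Negz l) isT) false r) sZ sM s_ugh mulr_algl scalerA.
    rewrite [_ + r]addrC /= NegzE; congr (_ *: _).
    by rewrite /cminus opprK mul1r mulrN1z mulN1r !mulNr.
  rewrite sZ -scalerAl -scalerAr -scalerBr e !scalerA; congr (_ *: _).
  by rewrite -(cminus_Negz char0 g (qq_neq0 R)) -mulrA mulrNN.
exact: (current_cross_down char0 rec q2 Kx ax n p).
Qed.
End CentralCharge.

(** * Irreducibility of the induced module *)

Section InducedModule.
Variables (R : realType) (M : lmodType (Bdq R)).
Local Notation F := (Cq R).
Local Notation U := (Uq R).
Local Notation B := (subalg_gen (@Bdq_gen R)).
Local Notation q := (q R).
Local Notation qq := (q - q^-1).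
Local Notation MF := (MF M).
Local Notation WF := (over_field (Mhat M)).
Local Notation tens := (tensor (@Bdq_Uq R)).

Definition iota (m : MF) : WF := tens 1 (m : M).
Lemma scaleby_iota u (m : MF) : scaleby u (iota m) = tens u (m : M).
Proof. by rewrite /scaleby /iota tensorZ mulr1. Qed.
Lemma scaleby_act u (m : MF) : u \in B -> scaleby u (iota m) = iota (act u m).
Proof.
move=> hu; rewrite scaleby_iota -[u in LHS](toBK hu) -[val _]mul1r.
exact: tensorM.
Qed.
Lemma iota_lin : linear iota.
Proof.
move=> c m m'; rewrite /iota; transitivity (iota (c *: m) + iota m'); first exact: tensorDr.
congr (_ + _); rewrite -[m in c *: m]act1 -actZ ?rpred1 //.
by rewrite -scaleby_act ?rpredZ ?rpred1 // scalebyZ scaleby1.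
Qed.
HB.instance Definition _ := GRing.isLinear.Build F MF WF *:%R iota iota_lin.

Hypothesis irrM : irreducible (res_scalars (Hq_Bdq R) M).
Variables (v0 : MF) (z : nat -> F) (g kap : F).
Hypotheses (v0_neq0 : v0 != 0) (g_neq0 : g != 0) (kap_neq0 : kap != 0).
Hypothesis g_exprz_neq1 : forall n : int, n != 0 -> g ^ n != 1.
Hypothesis hz : forall s : nat, (0 < s)%N -> act (uhz R s) v0 = z s *: v0.
Hypothesis hgam : act (ugam R) v0 = g *: v0.
Hypothesis hK : forall m : MF, act (uK R) m = kap *: m.
Hypothesis hKV : forall m : MF, act (uKV R) m = kap^-1 *: m.
Hypothesis hxp : forall k (m : MF), act (ux R true k) m = 0.

Lemma scaleby_gam (w : WF) : scaleby (ugam R) w = g *: w.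
Proof.
elim/induced_ind: w => [|w w' hw hw'|u m].
- by rewrite -[0]/(0 : WF) linear0 scaler0.
- by rewrite -[w - w']/((w : WF) - (w' : WF)) linearB /= hw hw' scalerBr.
- rewrite -(scaleby_iota u m) -scalebyM UgamC scalebyM (scaleby_act _ (B_gam R)).
  by rewrite (act_gam irrM v0_neq0 hgam) 2!linearZ.
Qed.
Lemma scaleby_gamV (w : WF) : scaleby (ugamV R) w = g^-1 *: w.
Proof.
rewrite -[w in LHS]scale1r -(mulVf g_neq0) -scalerA -scaleby_gam linearZ /=.
by rewrite -scalebyM UgVg scaleby1.
Qed.

Definition xm (l : int) : {linear WF -> WF} := @scaleby F U (Mhat M) (ux R false l).
Definition in_span (w : WF) : Prop := exists f, w = vec iota xm f.
Local Notation S := in_span.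

Lemma span_lin c (w w' : WF) : S w -> S w' -> S (c *: w + w').
Proof.
move=> [f ->] [f' ->]; exists ([seq (p.1, c *: p.2) | p <- f] ++ f').
rewrite vec_cat /vec big_map scaler_sumr; congr (_ + _).
by apply: eq_bigr => p _; rewrite linearZ.
Qed.
Lemma span0 : S 0. Proof. by exists [::]; rewrite /vec big_nil. Qed.
Lemma span_iota m : S (iota m). Proof. by exists [:: ([::], m)]; rewrite /vec big_seq1. Qed.
Lemma span_xm l w : S w -> S (xm l w).
Proof.
move=> [f ->]; exists [seq (l :: p.1, p.2) | p <- f].
by rewrite /vec big_map linear_sum.
Qed.
Lemma spanZ c w : S w -> S (c *: w).
Proof. by move=> h; rewrite -[c *: w]addr0; apply/span_lin/span0. Qed.
Lemma spanD w w' : S w -> S w' -> S (w + w').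
Proof. by move=> h; rewrite -[w]scale1r; apply: span_lin. Qed.

Lemma span_operator (T : {linear WF -> WF}) : (forall m, S (T (iota m))) ->
  (forall l w, S w -> S (T w) -> S (T (xm l w))) -> forall w, S w -> S (T w).
Proof.
move=> T0 Tx w [f ->]; rewrite linear_sum; elim/big_ind: _ => [|w1 w2|p _].
- exact: span0.
- exact: spanD.
- suff [] : S (word iota xm p.1 p.2) /\ S (T (word iota xm p.1 p.2)) by [].
  elim: p.1 => [|l L [h1 h2]]; split; [exact: span_iota | exact: T0 | exact: span_xm |].
  exact: Tx.
Qed.

(** Stability of the span of words is obtained generator by generator in the order dictated by the
    commutators with x^-_l: gamma and K before h_s and the currents, and x^+_k last. *)
Definition stable (u : U) : Prop := forall w, S w -> S (scaleby (N := Mhat M) u w).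

Lemma stable_closed : subalg_closed [pred u | `[< stable u >]].
Proof.
split=> [|c u u' /asboolP h /asboolP h'|u u' /asboolP h /asboolP h']; apply/asboolP => w hw.
- by rewrite scaleby1.
- by rewrite scalebyL; apply: span_lin; [exact: h | exact: h'].
- by rewrite scalebyM; apply/h/h'.
Qed.
Lemma stable0 : stable 0. Proof. by move=> w _; rewrite scaleby0; exact: span0. Qed.
Lemma stableZ c u : stable u -> stable (c *: u).
Proof. by move=> h w hw; rewrite scalebyZ; apply/spanZ/h. Qed.
Lemma stableD u u' : stable u -> stable u' -> stable (u + u').
Proof. by move=> h h' w hw; rewrite -[u]scale1r scalebyL scale1r; apply: spanD; [exact: h|exact: h']. Qed.
Lemma stableM u u' : stable u -> stable u' -> stable (u * u').
Proof. by move=> h h' w hw; rewrite scalebyM; apply/h/h'. Qed.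
Lemma stable_xm l : stable (ux R false l). Proof. exact: span_xm. Qed.

(** An element of the Borel-type subalgebra maps 1 (x) M to itself, so it is enough to pass it
    through one letter with a stable remainder. *)
Lemma stable_skew u : u \in B -> (forall l, exists c v,
    u * ux R false l = c *: (ux R false l * u) + v /\ stable v) -> stable u.
Proof.
move=> hu hx; apply: span_operator => [m|l w hw huw].
  by rewrite /= scaleby_act //; exact: span_iota.
have [c [v [e hv]]] := hx l.
rewrite /= -scalebyM e scalebyL scalebyM.
by apply: span_lin; [exact: span_xm | exact: hv].
Qed.

Lemma stable_gen : [/\ stable (uK R), stable (uKV R), stable (uD R) & stable (uDV R)].
Proof.
have q0 n : q ^ n != 0 by rewrite expfz_neq0 ?q_neq0.
split; apply: stable_skew => [|l].
- exact: B_K.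
- by exists (q ^ (-2)), 0; rewrite addr0; split; [exact: (UKx R false l) | exact: stable0].
- exact: B_KV.
- exists (q ^ (-2))^-1, 0; rewrite addr0; split; last exact: stable0.
  exact: (skew_inv (UKKV R) (UKVK R) (q0 _) (UKx R false l)).
- exact: B_D.
- by exists (q ^ l), 0; rewrite addr0; split; [exact: UDx | exact: stable0].
- exact: B_DV.
- exists (q ^ l)^-1, 0; rewrite addr0; split; last exact: stable0.
  exact: (skew_inv (UDDV R) (UDVD R) (q0 _) (UDx R false l)).
Qed.
Lemma stable_gam : stable (ugam R).
Proof. by move=> w hw; rewrite scaleby_gam; apply: spanZ. Qed.
Lemma stable_gamV : stable (ugamV R).
Proof. by move=> w hw; rewrite scaleby_gamV; apply: spanZ. Qed.
Lemma stableX u n : stable u -> stable (u ^+ n).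
Proof.
move=> h; elim: n => [|n IH] w hw; first by rewrite expr0 scaleby1.
by rewrite exprS; apply: stableM.
Qed.
Lemma stable_ugh n : stable (ugh R n).
Proof. by case: n => n; apply: stableX; [exact: stable_gam | exact: stable_gamV]. Qed.
Lemma stable_h s : stable (uh R s).
Proof.
apply: stable_skew => [|l]; first exact: B_h.
exists 1; eexists; rewrite scale1r; split.
  by apply/eqP; rewrite addrC -subr_eq; apply/eqP; exact: Uhx.
apply/stableZ/stableM; [exact: stable_ugh | exact: stable_xm].
Qed.
Lemma stable_upsi n : stable (upsi R n).
Proof.
case: n => n; last by rewrite upsi_lt0 //; exact: stable0.
apply: asboolW; apply: (exp_rec_in (Cq_char0 R) (rec_upsi R) stable_closed) => [|l]; apply/asboolP.
  by case: stable_gen.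
exact/stableZ/stable_h.
Qed.
Lemma stable_uphi n : stable (uphi R n).
Proof.
have [n0|n0] := ltP 0 n.
  have e : phi R n = 0 by rewrite /phi; case: n n0 => // -[|n].
  by rewrite /uphi e rmorph0; exact: stable0.
have -> : n = - Posz `|n|%N by lia.
apply: asboolW; apply: (exp_rec_in (Cq_char0 R) (rec_uphi R) stable_closed) => [|l]; apply/asboolP.
  by case: stable_gen.
exact/stableZ/stable_h.
Qed.
Lemma stable_xp k : stable (ux R true k).
Proof.
apply: stable_skew => [|l]; first exact: B_xp.
exists 1; eexists; rewrite scale1r; split.
  by apply/eqP; rewrite addrC -subr_eq; apply/eqP; exact: Uxpxm.
apply/stableZ; rewrite -scaleN1r addrC.
apply: stableD; first apply: stableZ; apply: stableM.
- exact: stable_ugh.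
- exact: stable_uphi.
- exact: stable_ugh.
- exact: stable_upsi.
Qed.

Lemma in_span_all w : S w.
Proof.
have all u : stable u.
  apply: asboolW; apply: (Uq_ind (P := [pred u | `[< stable u >]]) stable_closed)
    => [e k|s| | | | | |]; apply/asboolP.
  - by case: e; [exact: stable_xp|exact: stable_xm].
  - exact: stable_h.
  - by case: stable_gen.
  - by case: stable_gen.
  - exact: stable_gam.
  - exact: stable_gamV.
  - by case: stable_gen.
  - by case: stable_gen.
elim/induced_ind: w => [|w w' hw hw'|u m]; first exact: span0.
- by rewrite -[w - w']/((w : WF) - (w' : WF)) addrC -scaleN1r; apply: span_lin.
- by rewrite -(scaleby_iota u m); apply/all/span_iota.
Qed.

Lemma iota_inj m : iota m = 0 -> m = 0.
Proof. exact: (tensor_inj irrM v0_neq0 g_neq0 kap_neq0 hgam hK hKV hxp). Qed.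
Lemma iota_v0_neq0 : iota v0 != 0.
Proof. by apply: contra v0_neq0 => /eqP h; apply/eqP/iota_inj. Qed.

Definition xp (k : int) : {linear WF -> WF} := @scaleby F U (Mhat M) (ux R true k).
Definition phiW (r : nat) : {linear WF -> WF} := @scaleby F U (Mhat M) (uphi R (- Posz r)).

Lemma xp_xm (k l : int) (w : WF) : (k + l < 0)%R ->
  xp k (xm l w) = xm l (xp k w) - (qq^-1 * g ^ (l - k)) *: phiW (absz (k + l)%R) w.
Proof.
move=> kl; have sg : scaleby_endo iota_v0_neq0 (ugam R) = g%:A.
  by apply: endoP => w'; exact: scaleby_gam.
have := s_xp_x (scaleby_endoM _) (scaleby_endoL _) (scaleby_endo1 _) g_neq0 sg kl.
by move/(congr1 (fun T : endo iota_v0_neq0 => endo_fun T w)).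
Qed.
Lemma phiW_xm r p (w : WF) : phiW r (xm p w)
  = \sum_(i < r.+1) (Gc (q ^ 2) i * g ^+ i) *: xm (p - i%:Z) (phiW (r - i)%N w).
Proof.
have sg : scaleby_endo iota_v0_neq0 (ugam R) = g%:A.
  by apply: endoP => w'; exact: scaleby_gam.
have := s_phi_x (scaleby_endoM _) (scaleby_endoL _) (scaleby_endo1 _) g_neq0 sg r p.
move/(congr1 (fun T : endo iota_v0_neq0 => endo_fun T w)) => e.
by rewrite [LHS]e endo_sumE.
Qed.

(** Each step of the descent applies a single x^+_k, so stability under these operators carries [Q]
    from w down to 1 (x) M. *)
Lemma vacuum_vector (Q : WF -> Prop) (w : WF) : (forall k w', Q w' -> Q (xp k w')) ->
  w != 0 -> Q w -> exists2 m : MF, m != 0 & Q (iota m).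
Proof.
move=> Qxp w0 Qw.
have kapV0 : kap^-1 != 0 by rewrite invr_eq0.
have [P [chi_sep germ_span]] := germ_index_set irrM v0_neq0 kapV0 g_neq0 hz hgam.
have q0 := q_neq0 R; have G0 : Gc (q ^ 2) 0 != 0 by rewrite expfz_neq0.
have C0 : qq^-1 != 0 by rewrite invr_eq0 qq_neq0.
have xquad (k l : int) (w' : WF) : xm (k + 1) (xm l w') - q ^ (-2) *: xm l (xm (k + 1) w')
    = q ^ (-2) *: xm k (xm (l + 1) w') - xm (l + 1) (xm k w').
  rewrite /xm /= -!scalebyM -!scalebyZ -!scalebyB; congr (scaleby _ w').
  exact: (Uxx R false k l).
(* G_0 = q^2 is not a root of unity, so its geometric sums do not vanish. *)
have Gsum (c : nat) : (0 < c)%N -> \sum_(i < c) Gc (q ^ 2) 0 ^+ i != 0.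
  move=> c0; have h : (q ^ 2) ^+ c != 1.
    by rewrite -[_ ^+ c]/((q ^ 2) ^ c%:Z) exprz_exp; apply: q_exprz_neq1; lia.
  apply: contra h => /eqP e; rewrite -subr_eq0 subrX1.
  by rewrite -[X in _ * X]/(\sum_(i < c) Gc (q ^ 2) 0 ^+ i) e mulr0.
have xpio (k : int) (m : MF) : xp k (iota m) = 0.
  by rewrite [LHS](scaleby_act _ (B_xp R k)) hxp linear0.
have phio (r : nat) (m : MF) : phiW r (iota m) = iota (phiact M r m).
  exact: (scaleby_act _ (B_uphi R r)).
have hphi := hact_phiact irrM v0_neq0 kapV0 g_neq0 hgam.
have fam (Z : int -> MF) (T : seq int) (l b : int) :=
  @phi_family_neq0 F MF (hact M) (chi z) P chi_sep germ_span (phiact M)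
    (heis_phi (R := R) g) g g_neq0 (heis_phi_neq0 g_neq0 g_exprz_neq1)
    (phiact0_inj kapV0 hKV) hphi Z T l b.
exact: (@lowering_to_vacuum F WF MF iota xm (q ^ (-2)) (Cq_char0 R 1) xquad xp phiW
  (phiact M) g qq^-1 (Gc (q ^ 2)) g_neq0 C0 G0 Gsum xpio xp_xm phiW_xm phio fam
  Q w Qxp (in_span_all w) w0 Qw).
Qed.

End InducedModule.

(** * Submodules that contain a vacuum vector *)

Section Submodule.
Variables (R : realType) (M : lmodType (Bdq R)) (N : {pred Mhat M}).
Hypothesis irrM : irreducible (res_scalars (Hq_Bdq R) M).
Hypothesis closedN : submod_closed N.

Lemma submod_vacuum_full (m0 : MF M) : m0 != 0 -> iota m0 \in N -> N =i predT.
Proof.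
move=> m00 hm0; have [N0 NL] := closedN.
have ND w w' : w \in N -> w' \in N -> w + w' \in N.
  by move=> hw hw'; rewrite -[w]scale1r; apply: NL.
have NZ u w : w \in N -> u *: w \in N by move=> hw; rewrite -[_ *: _]addr0; apply: NL.
have Na u (m : MF M) : u \in subalg_gen (@Bdq_gen R) -> iota m \in N -> iota (act u m) \in N.
  by move=> hu hm; rewrite -scaleby_act //; apply: NZ.
have Niota (m : MF M) : iota m \in N.
  apply: (Hq_irreducible irrM (S := fun m => iota m \in N) _ _ _ _ _ _ _ m00 hm0).
  - by rewrite linear0.
  - by move=> c m1 m2 h1 h2; rewrite linearP; apply: ND h2; apply: NZ.
  - by move=> s m1; apply/Na/B_h.
  - by move=> m1; apply/Na/B_gam.
  - by move=> m1; apply/Na/B_gamV.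
  - by move=> m1; apply/Na/B_D.
  - by move=> m1; apply/Na/B_DV.
move=> w; rewrite [RHS]inE; elim/induced_ind: w => [//|w w' hw hw'|u m].
  by rewrite -scaleN1r addrC; apply: NL.
rewrite -(scaleby_iota u m); exact: (NZ u _ (Niota m)).
Qed.
End Submodule.

Lemma Mhat_irreducible (R : realType) (M : lmodType (Bdq R)) (v0 : MF M)
    (z : nat -> Cq R) (g kap : Cq R) :
  irreducible (res_scalars (Hq_Bdq R) M) -> v0 != 0 -> g != 0 -> kap != 0 ->
  (forall n : int, n != 0 -> g ^ n != 1) ->
  (forall s : nat, (0 < s)%N -> act (uhz R s) v0 = z s *: v0) ->
  act (ugam R) v0 = g *: v0 ->
  (forall m : MF M, act (uK R) m = kap *: m) ->
  (forall m : MF M, act (uKV R) m = kap^-1 *: m) ->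
  (forall k (m : MF M), act (ux R true k) m = 0) ->
  irreducible (Mhat M).
Proof.
move=> irrM v00 g0 kap0 g1 hz hgam hK hKV hxp; split.
  exists (iota v0); exact: (iota_v0_neq0 irrM v00 g0 kap0 hgam hK hKV hxp).
move=> N closedN.
have [[w [hw w0]]|hN] := pselect (exists w, w \in N /\ w != 0).
  right; pose Q (w' : over_field (Mhat M)) := (w' : Mhat M) \in N.
  have Qxp k w' : Q w' -> Q (xp M k w').
    by move=> hw'; rewrite /Q -[xp M k w' : Mhat M]addr0; apply: closedN.2 => //; exact: closedN.1.
  have [m m0 hm] := vacuum_vector irrM v00 g0 kap0 g1 hz hgam hK hKV hxp Qxp w0 hw.
  exact: (submod_vacuum_full irrM closedN m0 hm).
left=> w; rewrite [RHS]inE; apply/idP/eqP => [hw|->]; last exact: closedN.1.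
by apply: contrapT => /eqP w0; apply: hN; exists w.
Qed.

Theorem mainTheorem3 (R : realType)
    (zeta : {lrmorphism Hplus R -> Cq R | *%R}) (a : int) (lam : weight)
    (V : lmodType (Hb R)) (v : V) (M : lmodType (Bdq R)) :
  a != 0 ->
  is_zeta_a_line zeta a v ->
  is_Mzlam V lam M ->
  irreducible (res_scalars (Hq_Bdq R) M) ->
  irreducible (Mhat M).
Proof.
move=> a0 hline hM irrM; have [v0 [z [v00 hz hgam]]] := whittaker_vector hline hM irrM.1.
have [_ hK hKV hxp] := hM.
apply: (Mhat_irreducible (z := z) (kap := q R ^ coroot_value lam) irrM v00 _ _ _ hz hgam).
- by rewrite expfz_neq0 ?qh_neq0.
- by rewrite expfz_neq0 ?q_neq0.
(* Here g^n = (q^(1/2))^(a n), and a n != 0 because a != 0. *)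
- by move=> n n0; rewrite exprz_exp qh_exprz_neq1 // mulf_neq0.
- move=> m; exact: etrans (actE (mem_subalg_gen (Bdq_K R)) m) (hK m).
- move=> m; rewrite invr_expz; exact: etrans (actE (mem_subalg_gen (Bdq_KV R)) m) (hKV m).
- move=> k m; exact: etrans (actE (mem_subalg_gen (Bdq_xp R k)) m) (hxp k m).
Qed.
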